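(* A diagram $$K_1\xleftarrow{f_1}L_1\xrightarrow{g_1}K_2\xleftarrow{f_2}L_2\xrightarrow{g_2}K_3\ \cdots\ K_{l-1}\xleftarrow{f_{l-1}}L_{l-1}\xrightarrow{g_{l-1}}K_l$$ of strong Steiner complexes whose morphisms $f_1,\dots,f_{l-1},g_1,\dots,g_{l-1}$ are ordered rigid inclusions is a strong Steiner system. In particular, the colimit of such a diagram is a strong Steiner complex and the functor $\nu:\mathcal{C}_{\mathrm{da}}\to\infty\text{-}\mathbf{Cat}$ commutes with this colimit.
   Context: All $\infty$-categories are strict and small; $\infty\text{-}\mathbf{Cat}$ is the category of these and strict $\infty$-functors. An augmented directed complex is a triple $(K,K^*,e)$ with $K$ a chain complex of abelian groups in degrees $\ge 0$, $e:K_0\to\mathbb{Z}$ a morphism with $ed_1=0$, and $K^*_n\subset K_n$ a submonoid for each $n\ge0$ (no compatibility with $d$ required). Morphisms are chain maps compatible with the augmentations and sending $K^*_n$ into $K'^*_n$. The category of these is $\mathcal{C}_{\mathrm{da}}$. The functor $\nu:\mathcal{C}_{\mathrm{da}}\to\infty\text{-}\mathbf{Cat}$: an $i$-cell of $\nu(K)$ is a table $(x^\varepsilon_k)_{0\le k\le i,\ \varepsilon=0,1}$ with $x^\varepsilon_k\in K^*_k$, $x^0_i=x^1_i$, $d(x^\varepsilon_k)=x^1_{k-1}-x^0_{k-1}$ for $0<k\le i$, $e(x^\varepsilon_0)=1$. The source (resp. target) keeps the entries of degree $<i-1$ and has both entries of degree $i-1$ equal to $x^0_{i-1}$ (resp.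 $x^1_{i-1}$); the identity adds two zeros in degree $i+1$; $x*_jy$ (defined when $s_j(x)=t_j(y)$) has entries $(y^0_k,x^1_k)$ for $k\le j$ and $x^\varepsilon_k+y^\varepsilon_k$ for $k>j$. On morphisms $\nu$ acts entrywise. A basis of $K$ is a graded set $B=(B_n)$ with $B_n$ a $\mathbb{Z}$-basis of $K_n$ generating the monoid $K_n^*$ (it is unique if it exists). Given a basis, for $x\in K_i$ let $\mathrm{supp}(x)$ be the set of basis elements with non-zero coefficient in $x$, and write $x=x_+-x_-$ with $x_+,x_-\in K^*_i$ of disjoint supports. Put $\langle x\rangle^0_i=\langle x\rangle^1_i=x$ and, descending, $\langle x\rangle^0_{k-1}=d(\langle x\rangle^0_k)_-$, $\langle x\rangle^1_{k-1}=d(\langle x\rangle^1_k)_+$. The basis is unitary if $e(\langle b\rangle^0_0)=1=e(\langle b\rangle^1_0)$ for all $b\in B$. Let $\le_{\mathbb N}$ be the smallest preorder on $\coprod_nB_n$ with $x\le_{\mathbb N}y$ whenever $x\in\mathrm{supp}(d(y)_-)$ or $y\in\mathrm{supp}(d(x)_+)$ (with $d=0$ on $B_0$); the basis is strongly loop-free if $\le_{\mathbb N}$ is an order. A strong Steiner complex is a complex with a unitary strongly loop-free basis. A morphism $f:K\to L$ between complexes with bases is rigid if it sends every basis element to a basis element and $f(\langle b\rangle^\varepsilon_k)=\langle f(b)\rangle^\varepsilon_k$ for every basis element $b$ of $K$, $\varepsilon=0,1$ and $0\le k\le|b|$. It is an ordered rigid inclusion if it is a rigid monomorphism and, for basis elements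 $x,y$ of $K$, $x\le_{\mathbb N}y$ if and only if $f(x)\le_{\mathbb N}f(y)$. A functor $F:I\to\mathcal{C}_{\mathrm{da}}$, $I$ a small category, is a strong Steiner system if: every $F(i)$ is a strong Steiner complex; for every arrow $u$ of $I$ the morphism $F(u)$ is rigid; $\varinjlim_{i\in I}F(i)$ is a strong Steiner complex; and for every object $i_0$ of $I$ the canonical morphism $F(i_0)\to\varinjlim_{i\in I}F(i)$ is rigid. The functor $\nu$ commutes with the colimit of $F$ if the canonical $\infty$-functor $\varinjlim\nu F\to\nu(\varinjlim F)$ is an isomorphism. *)

(* Defs.v *)
From HB Require Import structures.
From Stdlib Require Export Relations.Relation_Operators.
From mathcomp Require Export all_boot all_order all_algebra.
From mathcomp Require Export mathcomp_extra boolp classical_sets cardinality fsbigop.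

Set Implicit Arguments.
Unset Strict Implicit.
Unset Printing Implicit Defensive.

Import Order.TTheory GRing.Theory Num.Theory.
Local Open Scope classical_set_scope.
Local Open Scope ring_scope.

Record category := Category {
  ob :> Type;
  hom : ob -> ob -> Type;
  idm : forall a, hom a a;
  cmp : forall a b c, hom b c -> hom a b -> hom a c;
  cmp1m : forall a b (f : hom a b), cmp (idm b) f = f;
  cmpm1 : forall a b (f : hom a b), cmp f (idm a) = f;
  cmpA : forall a b c d (h : hom c d) (g : hom b c) (f : hom a b),
    cmp h (cmp g f) = cmp (cmp h g) f }.

Arguments hom {_} a b.
Arguments idm {_} a.
Arguments cmp {_ a b c} g f.

Definition is_iso (C : category) (a b : C) (f : hom a b) : Prop :=
  exists g : hom b a, cmp g f = idm a /\ cmp f g = idm b.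

Definition monomorphism (C : category) (a b : C) (f : hom a b) : Prop :=
  forall (z : C) (g h : hom z a), cmp f g = cmp f h -> g = h.

Record functor (C D : category) := Functor {
  fob :> C -> D;
  fmor : forall a b, hom a b -> hom (fob a) (fob b);
  fmor1 : forall a, fmor (idm a) = idm (fob a);
  fmorM : forall a b c (g : hom b c) (f : hom a b),
    fmor (cmp g f) = cmp (fmor g) (fmor f) }.

Arguments fmor {C D} F {a b} u : rename.

Section FunctorComp.
Variables (C D E : category) (G : functor D E) (F : functor C D).

Let cob (a : C) : E := G (F a).
Let cmor a b (u : hom a b) : hom (cob a) (cob b) := fmor G (fmor F u).

Lemma functor_comp1 a : cmor (idm a) = idm (cob a).
Proof. by rewrite /cmor !fmor1. Qed.

Lemma functor_compM a b c (g : hom b c) (f : hom a b) :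
  cmor (cmp g f) = cmp (cmor g) (cmor f).
Proof. by rewrite /cmor !fmorM. Qed.

Definition functor_comp : functor C E := Functor functor_comp1 functor_compM.

End FunctorComp.

Record cocone (I C : category) (F : functor I C) := Cocone {
  apex : C;
  leg : forall i : I, hom (F i) apex;
  legE : forall (i j : I) (u : hom i j), cmp (leg j) (fmor F u) = leg i }.

Definition is_colimit (I C : category) (F : functor I C) (c : cocone F) : Prop :=
  forall c' : cocone F,
    exists! h : hom (apex c) (apex c'), forall i, cmp h (leg c i) = leg c' i.

(** [h] below is the canonical comparison morphism from the colimit of [G F]
    to the image under [G] of the colimit of [F]. *)
Definition commutes_with_colimit (I C D : category) (G : functor C D)
    (F : functor I C) : Prop :=
  (exists c' : cocone (functor_comp G F), is_colimit c') /\
  forall c : cocone F, is_colimit c ->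
  forall c' : cocone (functor_comp G F), is_colimit c' ->
  forall h : hom (apex c') (G (apex c)),
    (forall i, cmp h (leg c' i) = fmor G (leg c i)) -> is_iso h.

(** The free category on a quiver, so that a diagram indexed by a quiver is a
    functor on a small category. *)

Record quiver := Quiver { vertex : Type; edge : vertex -> vertex -> Type }.

Arguments edge {_} a b.

Inductive qpath (Q : quiver) : vertex Q -> vertex Q -> Type :=
| qnil a : qpath a a
| qcons a b c : edge a b -> qpath b c -> qpath a c.

Arguments qnil {Q} a.
Arguments qcons {Q a b c} e p.

Fixpoint qcat (Q : quiver) (a b c : vertex Q) (p : qpath a b) :
    qpath b c -> qpath a c :=
  match p with
  | qnil _ => fun q => q
  | qcons _ _ _ e p' => fun q => qcons e (qcat p' q)
  end.

Section FreeCategory.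
Variable Q : quiver.

Let qcmp (a b c : vertex Q) (q : qpath b c) (p : qpath a b) := qcat p q.

Lemma qcmp1m a b (p : qpath a b) : qcmp (qnil b) p = p.
Proof. by rewrite /qcmp; elim: p => //= ? ? ? ? ? ->. Qed.

Lemma qcmpm1 a b (p : qpath a b) : qcmp p (qnil a) = p.
Proof. by []. Qed.

Lemma qcmpA a b c d (r : qpath c d) (q : qpath b c) (p : qpath a b) :
  qcmp r (qcmp q p) = qcmp (qcmp r q) p.
Proof. by rewrite /qcmp; elim: p q => //= ? ? ? ? ? IH q; rewrite IH. Qed.

Definition free_category : category := Category qcmp1m qcmpm1 qcmpA.

Variables (C : category) (X : vertex Q -> C).
Variable Xe : forall a b : vertex Q, edge a b -> hom (X a) (X b).

Fixpoint qpath_mor (a b : vertex Q) (p : qpath a b) : hom (X a) (X b) :=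
  match p with
  | qnil a => idm (X a)
  | qcons _ _ _ e p' => cmp (qpath_mor p') (Xe e)
  end.

Lemma qpath_morM (a b c : free_category) (q : hom b c) (p : hom a b) :
  qpath_mor (cmp q p) = cmp (qpath_mor q) (qpath_mor p).
Proof.
rewrite /=; elim: p q => [x|x y z e p IH] q /=; first by rewrite cmpm1.
by rewrite IH cmpA.
Qed.

Definition free_functor : functor free_category C :=
  @Functor free_category C X qpath_mor (fun=> erefl) qpath_morM.

End FreeCategory.

(** [bd false j] and [bd true j] are the iterated source [s_j] and target [t_j],
    and [idt] is the iterated identity; the data for [i = j.+1] determines the
    rest through [bd_bd] and [idt_idt].  [icomp x y _] is the composite [x *_j y],
    defined when [s_j x = t_j y]. *)
Record infcat := InfCat {
  cell :> nat -> Type;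
  bd : forall (eps : bool) (j i : nat), (j < i)%N -> cell i -> cell j;
  idt : forall (j i : nat), (j < i)%N -> cell j -> cell i;
  icomp : forall (j i : nat) (ji : (j < i)%N) (x y : cell i),
    bd false ji x = bd true ji y -> cell i;
  bd_bd : forall (k j i : nat) (kj : (k < j)%N) (ji : (j < i)%N) (ki : (k < i)%N)
    (eps eps' : bool) (x : cell i), bd eps kj (bd eps' ji x) = bd eps ki x;
  idt_idt : forall (k j i : nat) (kj : (k < j)%N) (ji : (j < i)%N) (ki : (k < i)%N)
    (x : cell k), idt ji (idt kj x) = idt ki x;
  bd_idt : forall (j i : nat) (ji : (j < i)%N) (eps : bool) (x : cell j),
    bd eps ji (idt ji x) = x;
  src_comp : forall (j i : nat) (ji : (j < i)%N) (x y : cell i) H,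
    bd false ji (@icomp j i ji x y H) = bd false ji y;
  tgt_comp : forall (j i : nat) (ji : (j < i)%N) (x y : cell i) H,
    bd true ji (@icomp j i ji x y H) = bd true ji x;
  bd_comp : forall (k j i : nat) (kj : (k < j)%N) (ji : (j < i)%N) (ki : (k < i)%N)
    (eps : bool) (x y : cell i) H H',
    bd eps ji (@icomp k i ki x y H) = @icomp k j kj (bd eps ji x) (bd eps ji y) H';
  icomp_idr : forall (j i : nat) (ji : (j < i)%N) (x : cell i) H,
    @icomp j i ji x (idt ji (bd false ji x)) H = x;
  icomp_idl : forall (j i : nat) (ji : (j < i)%N) (x : cell i) H,
    @icomp j i ji (idt ji (bd true ji x)) x H = x;
  icompA : forall (j i : nat) (ji : (j < i)%N) (x y z : cell i) Hxy Hyz H H',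
    @icomp j i ji x (@icomp j i ji y z Hyz) H =
    @icomp j i ji (@icomp j i ji x y Hxy) z H';
  idt_comp : forall (k j i : nat) (kj : (k < j)%N) (ji : (j < i)%N) (ki : (k < i)%N)
    (x y : cell j) H H',
    idt ji (@icomp k j kj x y H) = @icomp k i ki (idt ji x) (idt ji y) H';
  exchange : forall (k j i : nat) (kj : (k < j)%N) (ji : (j < i)%N) (ki : (k < i)%N)
    (x y z w : cell i) Hxy Hzw H Hxz Hyw H',
    @icomp k i ki (@icomp j i ji x y Hxy) (@icomp j i ji z w Hzw) H =
    @icomp j i ji (@icomp k i ki x z Hxz) (@icomp k i ki y w Hyw) H' }.

Arguments bd {_} eps {j i} ji x.
Arguments idt {_ j i} ji x.
Arguments icomp {_ j i} ji x y _.

Record inffun (A B : infcat) := InfFun {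
  cmap :> forall i, A i -> B i;
  cmap_bd : forall (j i : nat) (ji : (j < i)%N) (eps : bool) (x : A i),
    cmap (bd eps ji x) = bd eps ji (cmap x);
  cmap_idt : forall (j i : nat) (ji : (j < i)%N) (x : A j),
    cmap (idt ji x) = idt ji (cmap x);
  cmap_comp : forall (j i : nat) (ji : (j < i)%N) (x y : A i) H H',
    cmap (icomp ji x y H) = icomp ji (cmap x) (cmap y) H' }.

Lemma inffun_ext (A B : infcat) (f g : inffun A B) :
  (forall i (x : A i), f i x = g i x) -> f = g.
Proof.
case: f g => [f p1 p2 p3] [g q1 q2 q3] /= fg.
have {fg}: f = g by apply: functional_extensionality_dep => i; apply/funext/fg.
by move=> E; subst g; congr InfFun; exact: Prop_irrelevance.
Qed.

Section InfCategory.

Definition inffun_id (A : infcat) : inffun A A :=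
  @InfFun A A (fun _ x => x) (fun _ _ _ _ _ => erefl) (fun _ _ _ _ => erefl)
    (fun j i ji x y H H' => congr1 (icomp ji x y) (Prop_irrelevance H H')).

Variables (A B C : infcat) (g : inffun B C) (f : inffun A B).

Let gf i (x : A i) : C i := g i (f i x).

Lemma inffun_comp_bd (j i : nat) (ji : (j < i)%N) (eps : bool) (x : A i) :
  gf (bd eps ji x) = bd eps ji (gf x).
Proof. by rewrite /gf !cmap_bd. Qed.

Lemma inffun_comp_idt (j i : nat) (ji : (j < i)%N) (x : A j) :
  gf (idt ji x) = idt ji (gf x).
Proof. by rewrite /gf !cmap_idt. Qed.

Lemma inffun_comp_comp (j i : nat) (ji : (j < i)%N) (x y : A i) H H' :
  gf (icomp ji x y H) = icomp ji (gf x) (gf y) H'.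
Proof.
have Hf : bd false ji (f i x) = bd true ji (f i y) by rewrite -!cmap_bd H.
by rewrite /gf (cmap_comp H Hf) (cmap_comp Hf H').
Qed.

Definition inffun_cmp : inffun A C :=
  InfFun inffun_comp_bd inffun_comp_idt inffun_comp_comp.

End InfCategory.

Definition infCat : category.
Proof.
refine (@Category infcat inffun inffun_id inffun_cmp _ _ _).
- by move=> a b f; apply: inffun_ext.
- by move=> a b f; apply: inffun_ext.
- by move=> a b c d h g f; apply: inffun_ext.
Defined.

Definition submonoid (V : zmodType) (M : set V) : Prop :=
  M 0 /\ forall x y, M x -> M y -> M (x + y).

Record adc := ADC {
  chain :> nat -> zmodType;
  dif : forall n, {additive chain n.+1 -> chain n};
  aug : {additive chain 0 -> int};
  kpos : forall n, set (chain n);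
  dif_dif : forall n (x : chain n.+2), dif n (dif n.+1 x) = 0;
  aug_dif : forall x : chain 1, aug (dif 0 x) = 0;
  submonoid_kpos : forall n, submonoid (@kpos n) }.

Arguments dif K {n} : rename.
Arguments kpos K {n} : rename.

Record adcmor (K L : adc) := AdcMor {
  amap :> forall n, {additive K n -> L n};
  amap_dif : forall n (x : K n.+1), amap n (dif K x) = dif L (amap n.+1 x);
  amap_aug : forall x : K 0%N, aug L (amap 0%N x) = aug K x;
  amap_pos : forall n (x : K n), kpos K x -> kpos L (amap n x) }.

Lemma additive_ext (U V : zmodType) (f g : {additive U -> V}) : f =1 g -> f = g.
Proof.
case: f g => [f [[pf]]] [g [[pg]]] /= /funext fg; subst g.
by rewrite (Prop_irrelevance pf pg).
Qed.

Lemma adcmor_ext (K L : adc) (f g : adcmor K L) :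
  (forall n (x : K n), f n x = g n x) -> f = g.
Proof.
case: f g => [f p1 p2 p3] [g q1 q2 q3] /= fg.
have {fg}: f = g.
  by apply: functional_extensionality_dep => n; apply/additive_ext/fg.
by move=> E; subst g; congr AdcMor; exact: Prop_irrelevance.
Qed.

Definition adcmor_id (K : adc) : adcmor K K :=
  @AdcMor K K (fun n => idfun) (fun _ _ => erefl) (fun _ => erefl)
    (fun _ _ h => h).

Section AdcComp.
Variables (K L M : adc) (g : adcmor L M) (f : adcmor K L).

Let gf n : {additive K n -> M n} := g n \o f n.

Lemma adcmor_cmp_dif n (x : K n.+1) : gf n (dif K x) = dif M (gf n.+1 x).
Proof. by rewrite /= !amap_dif. Qed.

Lemma adcmor_cmp_aug (x : K 0%N) : aug M (gf 0%N x) = aug K x.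
Proof. by rewrite /= !amap_aug. Qed.

Lemma adcmor_cmp_pos n (x : K n) : kpos K x -> kpos M (gf n x).
Proof. by move=> /(amap_pos f) /(amap_pos g). Qed.

Definition adcmor_cmp : adcmor K M :=
  AdcMor adcmor_cmp_dif adcmor_cmp_aug adcmor_cmp_pos.

End AdcComp.

Definition Cda : category.
Proof.
refine (@Category adc adcmor adcmor_id adcmor_cmp _ _ _).
- by move=> a b f; apply: adcmor_ext.
- by move=> a b f; apply: adcmor_ext.
- by move=> a b c d h g f; apply: adcmor_ext.
Defined.

(** An [i]-cell is a table indexed by the degrees [0 <= k <= i]; it is encoded
    as a family indexed by all degrees which is zero in degrees [> i].
    [ent x false k] is $x^0_k$ and [ent x true k] is $x^1_k$. *)
Record nu_cell (K : adc) (i : nat) := NuCell {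
  ent : forall (eps : bool) (k : nat), K k;
  ent_gt : forall eps k, (i < k)%N -> ent eps k = 0;
  ent_pos : forall eps k, kpos K (ent eps k);
  ent_top : ent false i = ent true i;
  ent_dif : forall eps k, (k < i)%N ->
    dif K (ent eps k.+1) = ent true k - ent false k;
  ent_aug : forall eps, aug K (ent eps 0%N) = 1 }.

Lemma nu_cell_ext (K : adc) i (x y : nu_cell K i) :
  (forall eps k, ent x eps k = ent y eps k) -> x = y.
Proof.
case: x y => [x p1 p2 p3 p4 p5] [y q1 q2 q3 q4 q5] /= xy.
have {xy}: x = y.
  by apply: funext => eps; apply: functional_extensionality_dep => k; apply: xy.
by move=> E; subst y; congr NuCell; exact: Prop_irrelevance.
Qed.

Section Nu.
Variable K : adc.

Lemma kpos0 n : kpos K (0 : K n).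
Proof. by have [] := submonoid_kpos K n. Qed.

Lemma kposD n (x y : K n) : kpos K x -> kpos K y -> kpos K (x + y).
Proof. by have [_] := submonoid_kpos K n; apply. Qed.

Section Bd.
Variables (eps : bool) (j i : nat) (ji : (j < i)%N) (x : nu_cell K i).

Definition nu_bd_ent (eta : bool) (k : nat) : K k :=
  if (k < j)%N then ent x eta k else if k == j then ent x eps k else 0.

Definition nu_bd : nu_cell K j.
Proof.
exists nu_bd_ent; rewrite /nu_bd_ent.
- by move=> eta k jk; rewrite ltnNge (ltnW jk) /= gtn_eqF.
- move=> eta k; case: ifP => _; first exact: ent_pos.
  by case: ifP => _; [exact: ent_pos | exact: kpos0].
- by rewrite ltnn eqxx.
- move=> eta k kj; rewrite kj.
  have ki := ltn_trans kj ji.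
  case: ltnP => [_|jk]; first exact: ent_dif.
  have -> : k.+1 == j by rewrite eqn_leq kj jk.
  exact: ent_dif.
- by move=> eta; case: (posnP j) => [->|_]; exact: ent_aug.
Defined.

End Bd.

Definition nu_idt (j i : nat) (ji : (j < i)%N) (x : nu_cell K j) : nu_cell K i.
Proof.
exists (ent x); [| exact: ent_pos | | | exact: ent_aug].
- by move=> eps k ik; apply: ent_gt; exact: ltn_trans ik.
- by rewrite !ent_gt.
- move=> eps k _; case: (ltngtP k j) => [kj|jk|->]; first exact: ent_dif.
  + by rewrite (ent_gt x _ (leqW jk)) !(ent_gt x _ jk) raddf0 subrr.
  + by rewrite ent_gt // raddf0 ent_top subrr.
Defined.

Section Comp.
Variables (j i : nat) (ji : (j < i)%N) (x y : nu_cell K i).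
Hypothesis xy : nu_bd false ji x = nu_bd true ji y.

Definition nu_comp_ent (eps : bool) (k : nat) : K k :=
  if (k <= j)%N then (if eps then ent x true k else ent y false k)
  else ent x eps k + ent y eps k.

Lemma nu_composable_lt eps k : (k < j)%N -> ent x eps k = ent y eps k.
Proof.
move=> kj; have := congr1 (fun z => ent z eps k) xy.
by rewrite /= /nu_bd_ent kj.
Qed.

Lemma nu_composable_eq : ent x false j = ent y true j.
Proof.
have := congr1 (fun z => ent z true j) xy.
by rewrite /= /nu_bd_ent ltnn eqxx.
Qed.

Definition nu_comp : nu_cell K i.
Proof.
exists nu_comp_ent; rewrite /nu_comp_ent.
- move=> eps k ik; rewrite leqNgt (ltn_trans ji ik) /=.
  by rewrite !ent_gt // addr0.
- move=> eps k; case: ifP => _; last by apply: kposD; exact: ent_pos.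
  by case: eps; exact: ent_pos.
- by rewrite leqNgt ji /= !ent_top.
- move=> eps k ki; case: (ltngtP k j) => [kj|jk|->].
  + by case: eps; rewrite ent_dif // !nu_composable_lt.
  + by rewrite raddfD !ent_dif // opprD addrACA.
  + rewrite raddfD !ent_dif // nu_composable_eq.
    by rewrite addrA addrNK.
- by move=> eps; rewrite leq0n; case: eps; exact: ent_aug.
Defined.

End Comp.

Definition nu_ob : infcat.
Proof.
refine (@InfCat (nu_cell K) nu_bd nu_idt nu_comp _ _ _ _ _ _ _ _ _ _ _).
- move=> k j i kj ji ki eps eps' x; apply: nu_cell_ext => eta p /=.
  rewrite /nu_bd_ent /=; case: ltngtP => // [pk|->].
  + by rewrite /nu_bd_ent (ltn_trans pk kj).
  + by rewrite /nu_bd_ent kj.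
- by move=> *; apply: nu_cell_ext.
- move=> j i ji eps x; apply: nu_cell_ext => eta p /=.
  rewrite /nu_bd_ent /=; case: ltngtP => // [jp|->]; first by rewrite ent_gt.
  by case: eps eta => -[]; rewrite ?ent_top.
- move=> j i ji x y H; apply: nu_cell_ext => eta p /=.
  rewrite /nu_bd_ent /= /nu_comp_ent; case: ltngtP => // pj.
  by case: eta; rewrite ?(nu_composable_lt H).
- move=> j i ji x y H; apply: nu_cell_ext => eta p /=.
  rewrite /nu_bd_ent /= /nu_comp_ent; case: ltngtP => // pj.
  by case: eta; rewrite ?(nu_composable_lt H).
- move=> k j i kj ji ki eps x y H H'; apply: nu_cell_ext => eta p /=.
  rewrite /nu_bd_ent /= /nu_comp_ent /= /nu_bd_ent.
  case: (ltngtP p j) => [pj|jp|->] //.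
  + by rewrite leqNgt (ltn_trans kj jp) /= addr0.
  + by rewrite leqNgt kj.
- move=> j i ji x H; apply: nu_cell_ext => eta p /=.
  rewrite /nu_comp_ent /= /nu_bd_ent; case: ltngtP => [pj|jp|->].
  + by case: eta.
  + by rewrite addr0.
  + by case: eta.
- move=> j i ji x H; apply: nu_cell_ext => eta p /=.
  rewrite /nu_comp_ent /= /nu_bd_ent; case: ltngtP => [pj|jp|->].
  + by case: eta.
  + by rewrite add0r.
  + by case: eta.
- move=> j i ji x y z Hxy Hyz H H'; apply: nu_cell_ext => eta p /=.
  rewrite /nu_comp_ent /= /nu_comp_ent; case: leqP => pj; last by rewrite addrA.
  by case: eta.
- by move=> *; apply: nu_cell_ext.
- move=> k j i kj ji ki x y z w Hxy Hzw H Hxz Hyw H'.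
  apply: nu_cell_ext => eta p /=; rewrite /nu_comp_ent /= /nu_comp_ent.
  case: (leqP p k) => pk; last first.
    by case: (leqP p j) => _; [case: eta | rewrite addrACA].
  by rewrite (leq_trans pk (ltnW kj)); case: eta.
Defined.

End Nu.

Section NuMor.
Variables (K L : adc) (f : adcmor K L).

Definition nu_map i (x : nu_cell K i) : nu_cell L i.
Proof.
exists (fun eps k => f k (ent x eps k)).
- by move=> eps k ik; rewrite ent_gt // raddf0.
- by move=> eps k; apply: amap_pos; exact: ent_pos.
- by rewrite ent_top.
- by move=> eps k ki; rewrite -amap_dif ent_dif // raddfB.
- by move=> eps; rewrite amap_aug ent_aug.
Defined.

Definition nu_mor : inffun (nu_ob K) (nu_ob L).
Proof.
refine (@InfFun (nu_ob K) (nu_ob L) nu_map _ _ _).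
- move=> j i ji eps x; apply: nu_cell_ext => eta k /=.
  by rewrite /nu_bd_ent /=; case: ifP => // _; case: ifP => // _; rewrite raddf0.
- by move=> *; apply: nu_cell_ext.
- move=> j i ji x y H H'; apply: nu_cell_ext => eta k /=.
  by rewrite /nu_comp_ent /=; case: ifP => _; [case: eta | rewrite raddfD].
Defined.

End NuMor.

Definition nu : functor Cda infCat.
Proof.
refine (@Functor Cda infCat nu_ob nu_mor _ _).
- by move=> K; apply: inffun_ext => i x; apply: nu_cell_ext.
- by move=> K L M g f; apply: inffun_ext => i x; apply: nu_cell_ext.
Defined.

Section Basis.
Variables (V : zmodType) (B : set V).

(** [c] is the family of coordinates of [x] in [B], extended by zero. *)
Definition is_coord (x : V) (c : V -> int) : Prop :=
  [/\ finite_set [set b | c b != 0],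
      [set b | c b != 0] `<=` B &
      x = \sum_(b \in B) b *~ c b].

Definition is_zbasis : Prop := forall x, exists! c, is_coord x c.

End Basis.

Definition is_basis (K : adc) (B : forall n, set (K n)) : Prop :=
  forall n, is_zbasis (B n) /\ @kpos K n = smallest (@submonoid (K n)) (B n).

Definition has_basis (K : adc) : Prop := exists B, @is_basis K B.

(** A basis being unique when it exists, this is the basis of [K]. *)
Definition basis (K : adc) (n : nat) : set (K n) :=
  [set b | exists2 B, @is_basis K B & B n b].
Arguments basis : clear implicits.

Section Supports.
Variables (K : adc) (n : nat).

Definition coef (x : K n) : K n -> int :=
  xget (fun=> 0) [set c | is_coord (basis K n) x c].

Definition supp (x : K n) : set (K n) := [set b | coef x b != 0].

(** $x = x_+ - x_-$ with [ppart x] $= x_+$ and [npart x] $= x_-$. *)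
Definition ppart (x : K n) : K n :=
  \sum_(b \in basis K n) b *~ Num.max (coef x b) 0.

Definition npart (x : K n) : K n :=
  \sum_(b \in basis K n) b *~ Num.max (- coef x b) 0.

End Supports.

(** For [x] of degree [i = n + k], [angle eps n k x] is $\langle x\rangle^{eps}_k$. *)
Fixpoint angle (K : adc) (eps : bool) (n k : nat) : K (n + k)%N -> K k :=
  match n with
  | 0 => fun x => x
  | n'.+1 => fun x : K (n' + k).+1 =>
      angle eps (if eps then ppart (dif K x) else npart (dif K x))
  end.

(** Degree [n + 0] is the general degree [n], in the form expected by [angle]. *)
Definition unitary (K : adc) : Prop :=
  forall n (b : K (n + 0)%N), basis K (n + 0) b ->
  forall eps, aug K (angle eps b) = 1.

(** Generators of the preorder; elements of the disjoint union of the [B_n] are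
    seen as elements of [{n & K n}]. *)
Inductive steiner_le_gen (K : adc) : {n : nat & K n} -> {n : nat & K n} -> Prop :=
| LeSource n (x : K n) (y : K n.+1) :
    basis K n x -> basis K n.+1 y -> supp (npart (dif K y)) x ->
    steiner_le_gen (existT _ n x) (existT _ n.+1 y)
| LeTarget n (x : K n.+1) (y : K n) :
    basis K n.+1 x -> basis K n y -> supp (ppart (dif K x)) y ->
    steiner_le_gen (existT _ n.+1 x) (existT _ n y).

Definition steiner_le (K : adc) : {n : nat & K n} -> {n : nat & K n} -> Prop :=
  clos_refl_trans _ (@steiner_le_gen K).

Definition strongly_loop_free (K : adc) : Prop :=
  forall (n m : nat) (x : K n) (y : K m), basis K n x -> basis K m y ->
  steiner_le (existT _ n x) (existT _ m y) -> steiner_le (existT _ m y) (existT _ n x) ->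
  existT (fun p => K p : Type) n x = existT _ m y.

Definition strong_steiner (K : adc) : Prop :=
  [/\ has_basis K, unitary K & strongly_loop_free K].

Definition rigid (K L : adc) (f : adcmor K L) : Prop :=
  [/\ has_basis K, has_basis L,
      forall n (b : K n), basis K n b -> basis L n (f n b) &
      forall (eps : bool) n k (b : K (n + k)%N), basis K (n + k) b ->
        f k (angle eps b) = angle eps (f (n + k)%N b)].

Definition ordered_rigid_inclusion (K L : adc) (f : adcmor K L) : Prop :=
  [/\ rigid f, @monomorphism Cda K L f &
      forall n m (x : K n) (y : K m), basis K n x -> basis K m y ->
        steiner_le (existT _ n x) (existT _ m y) <->
        steiner_le (existT _ n (f n x)) (existT _ m (f m y))].

(** The colimit is only defined up to isomorphism, so the last two conditions
    are required of any colimiting cocone, besides existence. *)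
Definition strong_steiner_system (I : category) (F : functor I Cda) : Prop :=
  [/\ forall i, strong_steiner (F i),
      forall (i j : I) (u : hom i j), rigid (fmor F u),
      exists c : cocone F, is_colimit c,
      forall c : cocone F, is_colimit c -> strong_steiner (apex c) &
      forall c : cocone F, is_colimit c -> forall i, rigid (leg c i)].

(** The quiver [K_0 <- L_0 -> K_1 <- L_1 -> ... <- L_(l-1) -> K_l];
    [inl] are the [K]s and [inr] the [L]s. *)
Inductive zz_edge (l : nat) : 'I_l.+1 + 'I_l -> 'I_l.+1 + 'I_l -> Type :=
| ZZl (i : 'I_l) : zz_edge (inr i) (inl (widen_ord (leqnSn l) i))
| ZZr (i : 'I_l) : zz_edge (inr i) (inl (lift ord0 i)).

Definition zz_quiver (l : nat) : quiver := Quiver (@zz_edge l).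

Section Zigzag.
Variables (C : category) (l : nat) (K : 'I_l.+1 -> C) (L : 'I_l -> C).
Variable f : forall i : 'I_l, hom (L i) (K (widen_ord (leqnSn l) i)).
Variable g : forall i : 'I_l, hom (L i) (K (lift ord0 i)).

Definition zz_ob (v : vertex (zz_quiver l)) : C :=
  match v with inl k => K k | inr i => L i end.

Definition zz_mor (v w : vertex (zz_quiver l)) (e : edge v w) :
    hom (zz_ob v) (zz_ob w) :=
  match e with ZZl i => f i | ZZr i => g i end.

Definition zigzag : functor (free_category (zz_quiver l)) C :=
  free_functor zz_mor.

End Zigzag.

(* Main.v *)
(** By Steiner's theorem, [nu M] is freely generated by the atoms of a strong Steiner
    complex [M].  If [M] is the colimit of a diagram of strong Steiner complexes with
    rigid transition maps and rigid legs, then the atoms of [M] are the images of those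
    of the diagram, so compatible oo-functors on the [nu (F i)] prescribe values on the
    atoms of [M] and extend uniquely to [nu M].

    For a zigzag of ordered rigid inclusions, the basis of the colimit is the union of
    the bases of the [K k] glued along those of the [L i].  Every principal up-set of some
    [K k] extends to an up-set of the colimit with the same trace on [K k], by propagating
    it along the zigzag in both directions.  Hence each [K k] embeds into the colimit
    as an ordered set: the legs are injective on bases, thus rigid, and the preorder of
    the colimit is antisymmetric. *)

From HB Require Import structures.
From mathcomp Require Import all_boot all_order all_algebra.
From mathcomp Require Import zify finmap.
From mathcomp Require Import mathcomp_extra boolp classical_sets cardinality functions fsbigop.
Require Import Defs.

Set Implicit Arguments.
Unset Strict Implicit.
Unset Printing Implicit Defensive.

Import Order.TTheory GRing.Theory Num.Theory.
Local Open Scope classical_set_scope.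
Local Open Scope ring_scope.

(** * Coordinates in a basis *)

(** A cell of [nu M] has many expressions as a composite of atoms, so values prescribed on atoms do
    not visibly define a map. Steiner's theorem is therefore proved for graphs: inside a product
    with the target, the cells generated by pairs over atoms must form a single-valued graph closed
    under composition. The bridge between tables and composites is a level [P]: a cell is a sum of
    atoms in degrees at least [P], which always holds in the top degree and means being one atom for
    [P = 0]. Going down one level requires splitting the cell so that sources and targets of
    different atoms do not cancel; loop-freeness supplies an atom to split off, unitarity ends the
    descent. Single-valuedness and closure under composition depend on each other and are proved
    jointly, by induction on dimension and then on level.

    For the zigzag, embedding each complex as an ordered set does not yet exclude a cycle through
    several complexes; such a cycle is pushed back through the glued parts, one index at a time. *)

Section Zbasis.
Variables (V : zmodType) (B : set V).

Lemma is_coordP (x : V) (c : V -> int) : is_coord B x c <->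
  exists s : seq V, [/\ uniq s, forall b, b \in s -> B b,
    forall b, b \notin s -> c b = 0 & x = \sum_(b <- s) b *~ c b].
Proof.
split.
  case=> fin sub ->; exists (fset_set [set b | c b != 0]); split; first exact: fset_uniq.
  - by move=> b; rewrite in_fset_set // inE => /sub.
  - by move=> b; rewrite in_fset_set // notin_setE /= => /negP; rewrite negbK => /eqP.
  rewrite (fsbigE (fset_set [set b | c b != 0])) ?fset_uniq //=.
  - rewrite big_seq_cond [RHS]big_seq; apply: eq_bigl => b; apply: andb_idr.
    by rewrite in_fset_set // inE => cb; apply: mem_set; exact: sub.
  - by move=> b /=; rewrite in_fset_set // inE => /sub.
  - by move=> b _; rewrite in_fset_set // notin_setE /= => /negP; rewrite negbK => /eqP->; rewrite mulr0z.
case=> s [us sB c0 ->]; split.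
- apply: sub_finite_set (finite_seq s) => b /=; apply: contra_neqT.
  by move=> /c0.
- by move=> b /=; case: (boolP (b \in s)) => [/sB //|/c0 ->]; rewrite eqxx.
- rewrite (fsbigE s) //; last by move=> b _ bs; rewrite c0 // mulr0z.
  rewrite big_seq [RHS]big_seq_cond; apply: eq_bigl => b; apply/esym/andb_idr.
  by move=> bs; apply: mem_set; exact: sB.
Qed.

Hypothesis zB : is_zbasis B.

(** [coef] is by conversion the case [B := basis K n]. A general [B] is kept because the same facts
    serve the free groups from which the colimit is built. *)
Definition zcoef (x : V) : V -> int := xget (fun=> 0) [set c | is_coord B x c].

Lemma zcoef_coord x : is_coord B x (zcoef x).
Proof. by have [c [cP _]] := zB x; exact: (xgetPex _ (ex_intro _ c cP)). Qed.

Lemma zcoef_unique x c : is_coord B x c -> zcoef x = c.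
Proof.
by have [c' [_ c'U]] := zB x => cP; rewrite -(c'U _ (zcoef_coord x)) (c'U _ cP).
Qed.

Lemma zcoef_notin x b : ~ B b -> zcoef x b = 0.
Proof.
have [_ sub _] := zcoef_coord x => nB; apply/eqP; apply: contra_notT nB => /sub.
exact.
Qed.

Lemma zcoef_sum x : exists s : seq V, [/\ uniq s, forall b, b \in s -> B b,
  forall b, b \notin s -> zcoef x b = 0 & x = \sum_(b <- s) b *~ zcoef x b].
Proof. by apply/is_coordP/zcoef_coord. Qed.

Lemma big_seq_widen (s t : seq V) (F : V -> V) : uniq s -> uniq t ->
  {subset s <= t} -> (forall b, b \notin s -> F b = 0) ->
  \sum_(b <- t) F b = \sum_(b <- s) F b.
Proof.
move=> us ut st F0; rewrite (bigID (mem s)) /= [X in _ + X]big1 ?addr0 //.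
rewrite -big_filter; apply: perm_big; apply: uniq_perm => //; first exact: filter_uniq.
move=> b; rewrite mem_filter; case: (boolP (b \in s)) => //= /st ->.
by [].
Qed.

Lemma zcoefD x y b : zcoef (x + y) b = zcoef x b + zcoef y b.
Proof.
suff -> : zcoef (x + y) = fun b => zcoef x b + zcoef y b by [].
apply: zcoef_unique; apply/is_coordP.
have [s [us sB s0 xE]] := zcoef_sum x; have [t [ut tB t0 yE]] := zcoef_sum y.
exists (undup (s ++ t)); split; first exact: undup_uniq.
- by move=> {}b; rewrite mem_undup mem_cat => /orP[/sB|/tB].
- by move=> {}b; rewrite mem_undup mem_cat negb_or => /andP[/s0 -> /t0 ->].
- under eq_bigr do rewrite mulrzDr; rewrite big_split /= {1}xE {1}yE; congr (_ + _).
  + apply/esym/big_seq_widen => //; first exact: undup_uniq.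
    by move=> ?; rewrite mem_undup mem_cat => ->.
    by move=> ? /s0 ->; rewrite mulr0z.
  + apply/esym/big_seq_widen => //; first exact: undup_uniq.
    by move=> ?; rewrite mem_undup mem_cat orbC => ->.
    by move=> ? /t0 ->; rewrite mulr0z.
Qed.

Lemma zcoef0 b : zcoef 0 b = 0.
Proof. by have := zcoefD 0 0 b; rewrite addr0; lia. Qed.

Lemma zcoefN x b : zcoef (- x) b = - zcoef x b.
Proof. by have := zcoefD x (- x) b; rewrite subrr zcoef0; lia. Qed.

Lemma zcoefB x y b : zcoef (x - y) b = zcoef x b - zcoef y b.
Proof. by rewrite zcoefD zcoefN. Qed.

Lemma zcoefMn x n b : zcoef (x *+ n) b = zcoef x b *+ n.
Proof. by elim: n => [|n IH]; rewrite ?mulr0n ?zcoef0 // !mulrS zcoefD IH. Qed.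

Lemma zcoefMz x (n : int) b : zcoef (x *~ n) b = zcoef x b * n.
Proof.
by case: n => n; rewrite ?NegzE ?mulrNz ?zcoefN -pmulrn zcoefMn -mulr_natr ?mulrN natz.
Qed.

Lemma zcoef_sumE (I : Type) (s : seq I) (F : I -> V) b :
  zcoef (\sum_(i <- s) F i) b = \sum_(i <- s) zcoef (F i) b.
Proof.
by elim: s => [|i s IH]; rewrite ?big_nil ?zcoef0 // !big_cons zcoefD IH.
Qed.

Lemma zcoef_basis b b' : B b -> zcoef b b' = (b' == b)%:R.
Proof.
move=> Bb; suff -> : zcoef b = fun b' => (b' == b)%:R by [].
apply: zcoef_unique; apply/is_coordP; exists [:: b]; split => //.
- by move=> ?; rewrite inE => /eqP ->.
- by move=> ?; rewrite inE => /negbTE ->.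
- by rewrite big_seq1 eqxx.
Qed.

Lemma zcoef_ext x y : (forall b, B b -> zcoef x b = zcoef y b) -> x = y.
Proof.
move=> xy; have {xy}xy : zcoef x = zcoef y.
  by apply/funext => b; case: (pselect (B b)) => [/xy //|nB]; rewrite !zcoef_notin.
have [_ _ xE] := zcoef_coord x; have [_ _ yE] := zcoef_coord y.
by rewrite xE yE xy.
Qed.

Lemma zbasis_neq0 b : B b -> b != 0.
Proof.
move=> Bb; apply/eqP => b0; have := zcoef_basis b Bb.
by rewrite eqxx b0 zcoef0.
Qed.

Definition zspan_ge0 : set V := [set x | forall b, 0 <= zcoef x b].

Lemma zspan_ge0_sub_submonoid (M : set V) (x : V) :
  submonoid M -> B `<=` M -> zspan_ge0 x -> M x.
Proof.
case=> M0 MD BM x0; have [s [us sB s0 ->]] := zcoef_sum x.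
rewrite big_seq; apply: big_ind => // b /sB /BM Mb.
have := x0 b; case: (zcoef x b) => // n _; rewrite -pmulrn.
by elim: n => [|n IH]; rewrite ?mulr0n // mulrS; exact: MD.
Qed.

Lemma smallest_submonoid : smallest (@submonoid V) B = zspan_ge0.
Proof.
apply/seteqP; split => x /=.
  apply; split.
    split; first by move=> b; rewrite zcoef0.
    by move=> u v u0 v0 b; rewrite zcoefD addr_ge0.
  by move=> b Bb b'; rewrite zcoef_basis.
by move=> x0 M [sM BM]; exact: zspan_ge0_sub_submonoid sM BM x0.
Qed.

End Zbasis.

(* The basis is recovered as the set of indecomposable elements of the monoid. *)
Lemma zbasis_unique_sub (V : zmodType) (B B' : set V) :
  is_zbasis B -> is_zbasis B' ->
  smallest (@submonoid V) B = smallest (@submonoid V) B' -> B `<=` B'.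
Proof.
move=> zB zB'; rewrite !smallest_submonoid // => E b Bb.
have Pb : zspan_ge0 B b by move=> b'; rewrite zcoef_basis.
have Pb' : zspan_ge0 B' b by rewrite -E.
have [b' B'b' b'0] : exists2 b', B' b' & zcoef B' b b' != 0.
  apply: contrapT => H; have := zbasis_neq0 zB Bb; case/eqP.
  apply: (zcoef_ext zB') => b' B'b'; rewrite zcoef0 //.
  by apply/eqP; apply: contra_notT H => ?; exists b'.
(* Both [b'] and [b - b'] lie in the monoid, so in the coordinates of [B] the element [b'] is
   dominated by [b]: it is a multiple of [b] with factor 0 or 1. *)
have P1 : zspan_ge0 B b' by rewrite E => a; rewrite zcoef_basis.
have P2 : zspan_ge0 B (b - b').
  rewrite E => a; rewrite zcoefB // (zcoef_basis zB' a B'b'); have := Pb' a.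
  by case: eqP => [->|_] /=; have := Pb' b'; lia.
have b'0' : b' = b *~ zcoef B b' b.
  apply: (zcoef_ext zB) => a Ba; rewrite zcoefMz // (zcoef_basis zB a Bb).
  case: eqP => [->|/eqP ab]; first by rewrite mul1r.
  have := P1 a; have := P2 a; rewrite zcoefB // (zcoef_basis zB a Bb) (negbTE ab) /=; lia.
have := P2 b; have := P1 b; rewrite zcoefB // (zcoef_basis zB b Bb) eqxx /= => h1 h2.
have : zcoef B b' b != 0.
  by apply/eqP => h; move: (zbasis_neq0 zB' B'b'); rewrite b'0' h mulr0z eqxx.
move=> h; have : zcoef B b' b = 1 by lia.
by move=> h'; rewrite -[b]mulr1z -h' -b'0'.
Qed.

Lemma is_basis_unique (K : adc) (B B' : forall n, set (K n)) :
  is_basis B -> is_basis B' -> forall n, B n = B' n.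
Proof.
move=> hB hB' n; have [zB kB] := hB n; have [zB' kB'] := hB' n.
by apply/seteqP; split; apply: zbasis_unique_sub => //; rewrite -kB.
Qed.

Lemma basisE (K : adc) (B : forall n, set (K n)) n : is_basis B -> basis K n = B n.
Proof.
move=> hB; apply/seteqP; split => b; last by exists B.
by case=> B' hB' /=; rewrite (is_basis_unique hB hB').
Qed.

(** * Coefficients, positive parts and the positive monoid of a complex with basis *)

Section Coef.
Variables (K : adc) (hK : has_basis K).

Lemma basis_zbasis n : is_zbasis (basis K n).
Proof. by case: hK => B hB; rewrite (basisE _ hB); have [] := hB n. Qed.

Let zb := basis_zbasis.

Lemma coefD n (x y : K n) b : coef (x + y) b = coef x b + coef y b.
Proof. exact: (zcoefD (@zb n)). Qed.

Lemma coef0 n b : coef (0 : K n) b = 0.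
Proof. exact: (zcoef0 (@zb n)). Qed.

Lemma coefB n (x y : K n) b : coef (x - y) b = coef x b - coef y b.
Proof. exact: (zcoefB (@zb n)). Qed.

Lemma coefMz n (x : K n) (i : int) b : coef (x *~ i) b = coef x b * i.
Proof. exact: (zcoefMz (@zb n)). Qed.

Lemma coef_sum n (I : Type) (s : seq I) (F : I -> K n) b :
  coef (\sum_(i <- s) F i) b = \sum_(i <- s) coef (F i) b.
Proof. exact: (zcoef_sumE (@zb n)). Qed.

Lemma coef_basis n (b b' : K n) : basis K n b -> coef b b' = (b' == b)%:R.
Proof. exact: (zcoef_basis (@zb n)). Qed.

Lemma coef_ext n (x y : K n) : (forall b, coef x b = coef y b) -> x = y.
Proof. by move=> xy; apply: (zcoef_ext (@zb n)) => b _; exact: xy. Qed.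

Lemma coef_notin n (x : K n) b : ~ basis K n b -> coef x b = 0.
Proof. exact: (zcoef_notin (@zb n)). Qed.

Lemma coef_decomp n (x : K n) : exists s : seq (K n),
  [/\ uniq s, forall b, b \in s -> basis K n b,
    forall b, b \notin s -> coef x b = 0 & x = \sum_(b <- s) b *~ coef x b].
Proof. exact: (zcoef_sum (@zb n)). Qed.

Lemma kposE n (x : K n) : kpos K x <-> forall b, 0 <= coef x b.
Proof.
case: hK => B hB; have [zB kB] := hB n.
by rewrite kB smallest_submonoid // /coef (basisE _ hB).
Qed.

Lemma kpos_basis n (b : K n) : basis K n b -> kpos K b.
Proof. by move=> Bb; apply/kposE => b'; rewrite coef_basis. Qed.

(** [ppart] and [npart] are both of this form; [s 0 = 0] keeps the support finite and inside the
    basis. *)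
Lemma coef_positive_part n (x : K n) (s : int -> int) b :
  s 0 = 0 ->
  coef (\sum_(b \in basis K n) b *~ s (coef x b)) b = s (coef x b).
Proof.
move=> s0; have [t [ut tB t0 _]] := coef_decomp x.
suff /(zcoef_unique (@zb n)) E : is_coord (basis K n)
    (\sum_(b \in basis K n) b *~ s (coef x b)) (fun b => s (coef x b)).
  by rewrite /coef; change (zcoef (basis K n) (\sum_(b \in basis K n) b *~ s (coef x b)) b = s (coef x b)); rewrite E.
split => //.
- apply: sub_finite_set (finite_seq t) => a /=; apply: contra_neqT.
  by move=> /t0 ->.
- move=> a /=; case: (boolP (a \in t)) => [/tB //|/t0 ->].
  by rewrite s0 eqxx.
Qed.

Lemma coef_ppart n (x : K n) b : coef (ppart x) b = Num.max (coef x b) 0.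
Proof. exact: (coef_positive_part x (s := fun i => Num.max i 0)). Qed.

Lemma coef_npart n (x : K n) b : coef (npart x) b = Num.max (- coef x b) 0.
Proof. exact: (coef_positive_part x (s := fun i => Num.max (- i) 0)). Qed.

Lemma ppartBnpart n (x : K n) : ppart x - npart x = x.
Proof. by apply: coef_ext => b; rewrite coefB coef_ppart coef_npart; lia. Qed.

Lemma kpos_ppart n (x : K n) : kpos K (ppart x).
Proof. by apply/kposE => b; rewrite coef_ppart; lia. Qed.

Lemma kpos_npart n (x : K n) : kpos K (npart x).
Proof. by apply/kposE => b; rewrite coef_npart; lia. Qed.

Lemma kpos_sum n (I : eqType) (s : seq I) (F : I -> K n) :
  (forall i, i \in s -> kpos K (F i)) -> kpos K (\sum_(i <- s) F i).
Proof.
move=> h; rewrite big_seq; apply: big_ind => //; first exact: kpos0.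
exact: kposD.
Qed.

Lemma kpos_decomp n (x : K n) : kpos K x -> exists s : seq (K n),
  (forall b, b \in s -> basis K n b) /\ x = \sum_(b <- s) b.
Proof.
rewrite kposE => x0; have [s [us sB _ ->]] := coef_decomp x.
elim: s us sB => [|b s IH] /=; first by exists [::]; rewrite !big_nil.
case/andP=> _ us sB; have [|t [tB tE]] := IH us.
  by move=> a ain; apply: sB; rewrite inE ain orbT.
exists (nseq `|coef x b|%N b ++ t); split.
  move=> a; rewrite mem_cat mem_nseq => /orP[/andP[_ /eqP->]|]; last exact: tB.
  by apply: sB; rewrite mem_head.
rewrite big_cat big_cons tE; congr (_ + _).
have [m ->] : exists m : nat, coef x b = m by exists `|coef x b|%N; have := x0 b; lia.
by rewrite -pmulrn /=; elim: m => [|m IHm]; rewrite ?big_nil ?mulr0n //= big_cons -IHm mulrS.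
Qed.

(** [x] is a sum of basis elements, so some summand has a positive value. With [psi] a coefficient
    of [d], this traces a coefficient of a boundary back to one basis element of [x]. *)
Lemma kpos_posterm n (x : K n) (psi : K n -> int) : {morph psi : x y / x + y} ->
  kpos K x -> 0 < psi x -> exists2 b, 0 < coef x b & 0 < psi b.
Proof.
move=> psiD /kpos_decomp[s [sB xE]].
have psi0 : psi 0 = 0 by have := psiD 0 0; rewrite addr0; lia.
rewrite xE (big_morph psi psiD psi0) => h.
have [b bs pb] : exists2 b, b \in s & 0 < psi b.
  apply: contrapT => H; move: h; rewrite ltNge => /negP; apply.
  rewrite big_seq; apply: sumr_le0 => b bs; rewrite leNgt; apply/negP => pb.
  by apply: H; exists b.
exists b => //; rewrite coef_sum (perm_big _ (perm_to_rem bs)) big_cons /=.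
rewrite coef_basis; last exact: sB.
rewrite eqxx ltr_pwDl // big_seq; apply: sumr_ge0 => a /mem_rem /sB Ba.
by rewrite coef_basis.
Qed.

End Coef.

(** * Atoms *)

Section Dirac.
Variable K : adc.

(* The family equal to [x] in degree [m] and to [0] elsewhere. *)
Definition dirac_fam (m : nat) (x : K m) (k : nat) : K k :=
  if m =P k is ReflectT e then ecast n (K n) e x else 0.

Lemma dirac_fam_diag m (x : K m) : dirac_fam x m = x.
Proof.
by rewrite /dirac_fam; case: eqP => // e; rewrite (eq_irrelevance e erefl).
Qed.

Lemma dirac_fam_neq m (x : K m) k : m != k -> dirac_fam x k = 0.
Proof. by rewrite /dirac_fam; case: eqP. Qed.

Definition sgn_part (eps : bool) n (x : K n) : K n :=
  if eps then ppart x else npart x.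

(* [atom_ent x eps k] is $\langle x\rangle^{eps}_k$ for [k <= m] and [0] for [k > m]; unlike
   [angle], it is defined for all [m] and [k] without a cast. *)
Fixpoint atom_ent (m : nat) : K m -> bool -> forall k, K k :=
  match m with
  | 0 => fun x eps k => dirac_fam x k
  | m'.+1 => fun x eps k =>
      dirac_fam x k + atom_ent (sgn_part eps (dif K x)) eps k
  end.

Lemma atom_ent_gt m (x : K m) eps k : (m < k)%N -> atom_ent x eps k = 0.
Proof.
elim: m x => [|m IH] x mk /=; first by rewrite dirac_fam_neq // ltn_eqF.
by rewrite IH ?dirac_fam_neq ?addr0 // ?ltn_eqF //; exact: ltnW.
Qed.

Lemma atom_ent_top m (x : K m) eps : atom_ent x eps m = x.
Proof.
case: m x => [|m] x /=; first exact: dirac_fam_diag.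
by rewrite dirac_fam_diag atom_ent_gt // addr0.
Qed.

(** [atom_ent] peels off the top degree; this recovers the descending recursion of the angle
    brackets, from degree [k+1] to degree [k]. *)
Lemma atom_ent_step m (x : K m) eps k : (k < m)%N ->
  atom_ent x eps k = sgn_part eps (dif K (atom_ent x eps k.+1)).
Proof.
elim: m x => // m IH x km /=; rewrite dirac_fam_neq ?add0r ?gtn_eqF //.
move: km; rewrite ltnS leq_eqVlt => /orP[/eqP->|km].
  by rewrite atom_ent_top dirac_fam_diag atom_ent_gt // addr0.
rewrite IH // dirac_fam_neq ?add0r //; apply/eqP; lia.
Qed.

Lemma angle_atom_ent eps n k (x : K (n + k)%N) :
  angle eps x = atom_ent x eps k.
Proof.
elim: n x => [|n IH] x /=; first by rewrite atom_ent_top.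
by rewrite dirac_fam_neq ?add0r ?IH //; apply/eqP; lia.
Qed.

Hypothesis hK : has_basis K.

Lemma sgn_partB n (x : K n) : sgn_part true x - sgn_part false x = x.
Proof. exact: ppartBnpart. Qed.

Lemma kpos_sgn_part eps n (x : K n) : kpos K (sgn_part eps x).
Proof. by case: eps; [exact: kpos_ppart | exact: kpos_npart]. Qed.

(** Downward induction on [k]: the two elements of degree [k+1] differ by a boundary, so they have
    the same [d], whose positive and negative parts are the two elements of degree [k]. *)
Lemma atom_ent_dif m (x : K m) eps k : (k < m)%N ->
  dif K (atom_ent x eps k.+1) = atom_ent x true k - atom_ent x false k.
Proof.
move=> km; have [p pE] : exists p, (m = p + k.+1)%N by exists (m - k.+1)%N; lia.
elim: p k eps km pE => [|p IH] k eps km pE.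
  have {pE}mE : m = k.+1 by [].
  subst m; rewrite (atom_ent_step x true) // (atom_ent_step x false) //.
  by rewrite !atom_ent_top sgn_partB.
have E eps' : dif K (atom_ent x eps' k.+1) = dif K (atom_ent x false k.+1).
  apply/eqP; case: eps'; rewrite -subr_eq0 -raddfB; last by rewrite subrr raddf0.
  rewrite -(IH k.+1 false); [by rewrite dif_dif | lia | lia].
rewrite (atom_ent_step x true) // (atom_ent_step x false) // (E true) sgn_partB.
exact: E.
Qed.

Lemma atom_ent_kpos m (x : K m) eps k : kpos K x -> kpos K (atom_ent x eps k).
Proof.
case: (ltngtP k m) => [km|mk|->] x0; last by rewrite atom_ent_top.
- by rewrite atom_ent_step //; exact: kpos_sgn_part.
- by rewrite atom_ent_gt //; exact: kpos0.
Qed.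

Lemma atom_ent_dif_eps m (x : K m) eps eps' k : (k < m)%N ->
  dif K (atom_ent x eps k.+1) = dif K (atom_ent x eps' k.+1).
Proof. by move=> km; rewrite !atom_ent_dif. Qed.

(** The two are the positive and negative parts of one element, as the boundary of the entry in
    degree [k+1] does not depend on the sign. *)
Lemma atom_ent_disjoint m (x : K m) k b : (k < m)%N ->
  coef (atom_ent x true k) b = 0 \/ coef (atom_ent x false k) b = 0.
Proof.
move=> km; rewrite (atom_ent_step x true) // (atom_ent_step x false) //.
rewrite (atom_ent_dif_eps x true false km) /sgn_part.
rewrite coef_ppart // coef_npart //; lia.
Qed.

Lemma unitaryE : unitary K <->
  forall m (b : K m), basis K m b -> forall eps, aug K (atom_ent b eps 0%N) = 1.
Proof.
split=> U m b Bb eps; last by rewrite angle_atom_ent; exact: U.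
have [n E] : exists n, m = (n + 0)%N by exists m; lia.
by subst m; rewrite -angle_atom_ent; exact: U.
Qed.

End Dirac.

(** * Morphisms sending basis elements to basis elements *)

Section BasisMaps.
Variables (K L : adc) (f : adcmor K L).
Hypotheses (hK : has_basis K) (hL : has_basis L).
Hypothesis fB : forall n (b : K n), basis K n b -> basis L n (f n b).

Lemma coef_amap n (x : K n) b :
  (forall b', basis K n b' -> f n b' = f n b -> b' = b) ->
  basis K n b -> coef (f n x) (f n b) = coef x b.
Proof.
move=> inj Bb; have [s [us sB s0 {1}->]] := coef_decomp hK x.
rewrite raddf_sum coef_sum //.
have H a : a \in s -> coef (f n (a *~ coef x a)) (f n b) = (b == a)%:R * coef x a.
  move=> /sB Ba; rewrite raddfMz /=.
  rewrite (coefMz hL) (coef_basis hL _ (fB Ba)); suff -> : (f n b == f n a) = (b == a) by [].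
  by apply/eqP/eqP => [E|->] //; rewrite (inj _ Ba).
rewrite big_seq (eq_bigr _ H) -big_seq.
case: (boolP (b \in s)) => [bs|bs].
  rewrite (perm_big _ (perm_to_rem bs)) big_cons eqxx mul1r big_seq big1 ?[RHS]addr0; first exact: addr0.
  move=> a; rewrite mem_rem_uniq // inE => /andP[/negbTE ab _].
  by rewrite eq_sym ab mul0r.
rewrite s0 // big_seq big1 // => a as_; case: eqP => [E|_]; last by rewrite mul0r.
by rewrite E as_ in bs.
Qed.

Lemma coef_amap_notin n (x : K n) b :
  (forall b', basis K n b' -> f n b' <> b) -> coef (f n x) b = 0.
Proof.
move=> H; have [s [us sB s0 ->]] := coef_decomp hK x.
rewrite raddf_sum coef_sum // big_seq big1 // => a /sB Ba; rewrite raddfMz /=.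
rewrite (coefMz hL) (coef_basis hL _ (fB Ba)); case: eqP => [E|]; last by rewrite mul0r.
by case: (H _ Ba).
Qed.

Lemma rigidE : (forall m (b : K m) eps k, basis K m b ->
    f k (atom_ent b eps k) = atom_ent (f m b) eps k) <-> rigid f.
Proof.
split=> [H|[_ _ _ H] m b eps k Bb].
  by split=> // eps n k b Bb; rewrite !angle_atom_ent H.
case: (leqP k m) => [km|mk]; last by rewrite !atom_ent_gt // raddf0.
have [n E] : exists n, m = (n + k)%N by exists (m - k)%N; lia.
subst m.
by rewrite -!angle_atom_ent H.
Qed.

Hypothesis finj : forall n (b b' : K n), basis K n b -> basis K n b' ->
  f n b = f n b' -> b = b'.

(** No two basis elements are identified, so no coefficients merge or cancel. By descent [f] then
    commutes with the angle brackets, which yields rigidity. *)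
Lemma amap_sgn_part eps n (x : K n) : f n (sgn_part eps x) = sgn_part eps (f n x).
Proof.
apply: (coef_ext hL) => b.
case: (pselect (exists2 b', basis K n b' & f n b' = b)) => [[b' Bb' <-]|H].
  have inj : forall b, basis K n b -> f n b = f n b' -> b = b'.
    by move=> a Ba; exact: finj.
  rewrite coef_amap //; case: eps; rewrite ?(coef_ppart hK) ?(coef_ppart hL).
    by rewrite coef_amap.
  by rewrite (coef_npart hK) (coef_npart hL) coef_amap.
have {}H b' : basis K n b' -> f n b' <> b by move=> Bb' E; apply: H; exists b'.
rewrite coef_amap_notin //; case: eps; rewrite ?(coef_ppart hL) ?(coef_npart hL);
by rewrite coef_amap_notin.
Qed.

Lemma amap_dirac_fam m (x : K m) k : f k (dirac_fam x k) = dirac_fam (f m x) k.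
Proof.
case: (eqVneq m k) => [E|mk]; last by rewrite !dirac_fam_neq // raddf0.
by subst k; rewrite !dirac_fam_diag.
Qed.

Lemma amap_atom_ent m (x : K m) eps k : f k (atom_ent x eps k) = atom_ent (f m x) eps k.
Proof.
elim: m x => [|m IH] x /=; first exact: amap_dirac_fam.
by rewrite raddfD /= IH amap_dirac_fam amap_sgn_part amap_dif.
Qed.

Lemma rigid_of_basis_inj : rigid f.
Proof. by apply/rigidE => *; exact: amap_atom_ent. Qed.

End BasisMaps.

(** * Decomposition of the cells of [nu K] *)

(** Basis elements of all degrees share one type with decidable equality, so that multisets of atoms
    of mixed degrees are lists up to [perm_eq]. *)
Definition pt (K : adc) := {n : nat & K n}.
HB.instance Definition _ (K : adc) := gen_eqMixin (pt K).

Definition mkpt (K : adc) n (b : K n) : pt K := existT _ n b.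
Definition dim (K : adc) (e : pt K) : nat := projT1 e.
Definition pbasis (K : adc) (e : pt K) : Prop := basis K (dim e) (projT2 e).
Definition pent (K : adc) (e : pt K) (eps : bool) (k : nat) : K k :=
  atom_ent (projT2 e) eps k.

Lemma exists_max_nat (T : eqType) (h : T -> nat) (s : seq T) :
  s != [::] -> exists2 e, e \in s & forall a, a \in s -> (h a <= h e)%N.
Proof.
elim: s => // a s IH _; case: (eqVneq s [::]) => [->|/IH [e es eM]].
  by exists a => [|b]; rewrite inE // => /eqP ->.
case: (leqP (h a) (h e)) => [ae|ea].
  exists e => [|b]; first by rewrite inE es orbT.
  by rewrite inE => /orP[/eqP->|/eM].
exists a => [|b]; first by rewrite mem_head.
by rewrite inE => /orP[/eqP->|/eM be] //; apply: leq_trans be (ltnW ea).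
Qed.

Lemma exists_maximal (T : eqType) (le : T -> T -> Prop) (s : seq T) :
  (forall a b c, le a b -> le b c -> le a c) ->
  (forall a b, a \in s -> b \in s -> le a b -> le b a -> a = b) ->
  s != [::] -> exists2 e, e \in s & forall a, a \in s -> le e a -> a = e.
Proof.
move=> tr; elim: s => // a s IH anti _.
case: (eqVneq s [::]) => [->|].
  by exists a => [|b]; rewrite inE // => /eqP ->.
case/IH => [b c bs cs|e es eM].
  by apply: anti; rewrite inE ?bs ?cs orbT.
have es' : e \in a :: s by rewrite inE es orbT.
case: (pselect (le e a)) => [ea|nea].
  exists a => [|b bs ab]; first by rewrite mem_head.
  have eb := tr _ _ _ ea ab; move: bs; rewrite inE => /orP[/eqP //|bs].
  have be := eM _ bs eb; subst b.
  by apply: anti => //; exact: mem_head.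
exists e => // b; rewrite inE => /orP[/eqP->//|]; exact: eM.
Qed.

Section Cells.
Variable K : adc.

Lemma idt_of_zero j n (ji : (j < n)%N) eps (x : nu_cell K n) :
  (forall eps' k, (j < k)%N -> ent x eps' k = 0) ->
  nu_idt ji (nu_bd eps ji x) = x.
Proof.
move=> x0; apply: nu_cell_ext => eta k /=; rewrite /nu_bd_ent.
case: ltngtP => [//|jk|->]; first by rewrite x0.
have E : ent x true j = ent x false j.
  by apply/eqP; rewrite -subr_eq0 -(ent_dif x false) // x0 // raddf0.
by case: eps eta => -[]; rewrite ?E.
Qed.

Lemma nu_comp_eqP j n (jn : (j < n)%N) (x y : nu_cell K n) :
  (forall eps k, (k < j)%N -> ent x eps k = ent y eps k) ->
  ent x false j = ent y true j -> nu_bd false jn x = nu_bd true jn y.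
Proof.
move=> h1 h2; apply: nu_cell_ext => eta k /=; rewrite /nu_bd_ent.
by case: ltngtP => [/h1 //|//|->].
Qed.

(** Prescribing [y] above [j] is enough: [d] then determines its source in degree [j] from its
    target, the lower entries are those of the composite, and [z] follows by subtraction. This
    cancels a split-off atom when lifts are compared. *)
Lemma nu_comp_inj j n (jn : (j < n)%N) (y z y' z' : nu_cell K n)
    (H : nu_bd false jn y = nu_bd true jn z) (H' : nu_bd false jn y' = nu_bd true jn z') :
  nu_comp H = nu_comp H' ->
  (forall eps k, (j < k)%N -> ent y eps k = ent y' eps k) -> y = y' /\ z = z'.
Proof.
move=> E yy'.
have Ee eps k : nu_comp_ent j y z eps k = nu_comp_ent j y' z' eps k.
  exact: (congr1 (fun w => ent w eps k) E).
have yj : ent y true j = ent y' true j.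
  by have := Ee true j; rewrite /nu_comp_ent leqnn.
have yj0 : ent y false j = ent y' false j.
  have := ent_dif y true jn; rewrite yy' // (ent_dif y' true jn) yj.
  by move/addrI/oppr_inj.
split; apply: nu_cell_ext => eps k.
  case: (ltngtP k j) => [kj|/yy' //|->]; last by case: eps.
  have := Ee eps k; rewrite /nu_comp_ent (ltnW kj).
  by case: eps => //; rewrite -(nu_composable_lt H) // -(nu_composable_lt H').
case: (ltngtP k j) => [kj|jk|->].
- have := Ee eps k; rewrite /nu_comp_ent (ltnW kj).
  by case: eps => //; rewrite (nu_composable_lt H) // (nu_composable_lt H').
- have := Ee eps k; rewrite /nu_comp_ent leqNgt jk /= yy' //.
  exact: addrI.
- case: eps; first by rewrite -(nu_composable_eq H) -(nu_composable_eq H').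
  by have := Ee false j; rewrite /nu_comp_ent leqnn.
Qed.

(* Splitting [x] as [y *_p z] amounts to prescribing the entries [u] of [y] in
   degrees [> p]; everything else is then forced, and the only condition that is
   not about [u] alone is positivity of the intermediate [p]-cell, [mid_pos]. *)
Section Cut.
Variables (p n : nat) (pn : (p < n)%N) (x : nu_cell K n).
Variable u : bool -> forall k, K k.
Hypothesis u_pos : forall eps k, (p < k)%N -> kpos K (u eps k).
Hypothesis xu_pos : forall eps k, (p < k)%N -> kpos K (ent x eps k - u eps k).
Hypothesis u_gt : forall eps k, (n < k)%N -> u eps k = 0.
Hypothesis u_top : u false n = u true n.
Hypothesis u_dif : forall eps k, (p < k)%N -> (k < n)%N ->
  dif K (u eps k.+1) = u true k - u false k.
Hypothesis u_difp : dif K (u false p.+1) = dif K (u true p.+1).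
Hypothesis mid_pos : kpos K (ent x true p - dif K (u true p.+1)).

Definition cut_tgt_ent (eps : bool) (k : nat) : K k :=
  if (p < k)%N then u eps k
  else if (k == p) && ~~ eps then ent x true k - dif K (u true k.+1)
  else ent x eps k.

Definition cut_src_ent (eps : bool) (k : nat) : K k :=
  if (p < k)%N then ent x eps k - u eps k
  else if (k == p) && eps then ent x true k - dif K (u true k.+1)
  else ent x eps k.

Lemma cut : exists (y z : nu_cell K n) (H : nu_bd false pn y = nu_bd true pn z),
  [/\ x = nu_comp H, forall eps k, ent y eps k = cut_tgt_ent eps k &
      forall eps k, ent z eps k = cut_src_ent eps k].
Proof.
have up eps : dif K (u eps p.+1) = dif K (u true p.+1) by case: eps.
have dxp eps := ent_dif x eps pn.
have aug_mid : aug K (ent x true 0%N - dif K (u true 1%N)) = 1.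
  by rewrite raddfB aug_dif subr0 ent_aug.
have [y yE] : exists y : nu_cell K n, forall eps k, ent y eps k = cut_tgt_ent eps k.
  unshelve eexists (@NuCell K n cut_tgt_ent _ _ _ _ _); last by [].
  - by move=> eps k nk; rewrite /cut_tgt_ent (ltn_trans pn nk) u_gt.
  - move=> eps k; rewrite /cut_tgt_ent; case: (ltngtP k p) => [kp|pk|->] /=.
    + exact: ent_pos.
    + exact: u_pos.
    + by case: eps => //=; exact: ent_pos.
  - by rewrite /cut_tgt_ent pn u_top.
  - move=> eps k kn; rewrite /cut_tgt_ent ltnS.
    case: (ltngtP k p) => [kp|pk|->] /=.
    + case: (eqVneq k.+1 p) => [E|_] /=; last exact: ent_dif.
      case: eps => /=; first exact: ent_dif.
      by rewrite raddfB dif_dif subr0 ent_dif.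
    + by rewrite u_dif.
    + by rewrite up opprB addrC addrNK.
  - move=> eps; rewrite /cut_tgt_ent /=; case: ifP => //= _; last exact: ent_aug.
have [z zE] : exists z : nu_cell K n, forall eps k, ent z eps k = cut_src_ent eps k.
  unshelve eexists (@NuCell K n cut_src_ent _ _ _ _ _); last by [].
  - by move=> eps k nk; rewrite /cut_src_ent (ltn_trans pn nk) u_gt // ent_gt // subrr.
  - move=> eps k; rewrite /cut_src_ent; case: (ltngtP k p) => [kp|pk|->] /=.
    + exact: ent_pos.
    + exact: xu_pos.
    + by case: eps => //=; exact: ent_pos.
  - by rewrite /cut_src_ent pn u_top ent_top.
  - move=> eps k kn; rewrite /cut_src_ent ltnS.
    case: (ltngtP k p) => [kp|pk|->] /=.
    + case: (eqVneq k.+1 p) => [E|_] /=; last exact: ent_dif.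
      case: eps => /=; last exact: ent_dif.
      by rewrite raddfB dif_dif subr0 ent_dif.
    + by rewrite raddfB u_dif // ent_dif // !opprB addrACA [RHS]addrACA; congr (_ + _); rewrite addrC.
    + by rewrite raddfB up ent_dif // addrAC.
  - move=> eps; rewrite /cut_src_ent /=; case: ifP => //= _; last exact: ent_aug.
have H : nu_bd false pn y = nu_bd true pn z.
  apply: nu_comp_eqP => [eps k kp|]; rewrite yE zE /cut_tgt_ent /cut_src_ent.
    by rewrite ltnNge (ltnW kp) ltn_eqF.
  by rewrite ltnn eqxx.
exists y, z, H; split=> //; apply: nu_cell_ext => eps k /=; rewrite /nu_comp_ent.
rewrite !yE !zE /cut_tgt_ent /cut_src_ent ltnNge; case: leqP => pk /=.
  by rewrite !andbF; case: eps.
by rewrite addrC addrNK.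
Qed.

End Cut.

(* In degrees [>= P], [x] is the sum of the atoms of [E].  Every [n]-cell is such a
   sum for [P = n], and [P = 0] forces [x] to be an atom, by unitarity. *)
Definition psum (P : nat) (E : seq (pt K)) n (x : nu_cell K n) : Prop :=
  (forall e, e \in E -> pbasis e /\ (P <= dim e)%N) /\
  (forall eps k, (P <= k)%N -> ent x eps k = \sum_(e <- E) pent e eps k).

Lemma psum_perm P E E' n (x : nu_cell K n) : perm_eq E E' -> psum P E x -> psum P E' x.
Proof.
move=> EE' [h1 h2]; split=> [e|eps k Pk]; first by rewrite -(perm_mem EE'); exact: h1.
by rewrite h2 // (perm_big _ EE').
Qed.

Hypothesis hK : has_basis K.

Lemma pent_kpos e eps k : pbasis e -> kpos K (pent e eps k).
Proof. by move=> Be; apply: atom_ent_kpos => //; exact: kpos_basis. Qed.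

Lemma pent_ge0 e eps k (b : K k) : pbasis e -> 0 <= coef (pent e eps k) b.
Proof. by move=> Be; exact: (proj1 (kposE hK _) (pent_kpos _ _ Be)). Qed.

Lemma pent_sum_kpos (E : seq (pt K)) eps k : (forall e, e \in E -> pbasis e) ->
  kpos K (\sum_(e <- E) pent e eps k).
Proof. by move=> hE; apply: kpos_sum => e /hE; exact: pent_kpos. Qed.

(** In degree [dim e] the atoms of [E'] of smaller degree vanish and the others are basis elements,
    so a nonzero coefficient at [e] can only come from [e] itself. *)
Lemma mem_of_pent_sum (E E' : seq (pt K)) e :
  (forall a, a \in E -> pbasis a) -> (forall a, a \in E' -> pbasis a) ->
  \sum_(a <- E) pent a false (dim e) = \sum_(a <- E') pent a false (dim e) ->
  e \in E -> (forall a, a \in E' -> (dim a <= dim e)%N) -> e \in E'.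
Proof.
move=> hE hE' SE eE le_e; have Be := hE _ eE.
have : 0 < coef (\sum_(a <- E') pent a false (dim e)) (projT2 e).
  rewrite -SE (perm_big _ (perm_to_rem eE)) big_cons coefD // [pent e _ _]atom_ent_top.
  rewrite coef_basis // eqxx ltr_pwDl // coef_sum // big_seq; apply: sumr_ge0.
  by move=> a /mem_rem /hE Ba; exact: pent_ge0.
rewrite coef_sum // => pos; apply: contrapT => neE; move: pos.
rewrite ltNge => /negP; apply; rewrite big_seq; apply: sumr_le0 => a aE'.
have := le_e _ aE'; rewrite leq_eqVlt => /orP[/eqP|ae]; last first.
  by rewrite /pent atom_ent_gt // coef0.
have := hE' _ aE'; move: aE'; case: a => m a; case: e eE le_e SE Be neE => q e /=.
rewrite /pbasis /dim /= => eE le_e SE Be neE aE' Ba mq; subst m.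
rewrite /pent /= atom_ent_top coef_basis //.
by case: eqP => // ea; subst a; case: neE.
Qed.

(** An atom of maximal degree is visible in its own degree on both sides; it is removed from both
    lists, by induction on the total length. *)
Lemma pent_sum_uniq P (E E' : seq (pt K)) :
  (forall e, e \in E -> pbasis e /\ (P <= dim e)%N) ->
  (forall e, e \in E' -> pbasis e /\ (P <= dim e)%N) ->
  (forall k, (P <= k)%N ->
     \sum_(e <- E) pent e false k = \sum_(e <- E') pent e false k) ->
  perm_eq E E'.
Proof.
move: {2}(size _).+1 (ltnSn (size (E ++ E'))) => N.
elim: N E E' => // N IH E E' sz hE hE' SE.
case: (eqVneq (E ++ E') [::]) => [|ne]; first by case: E E' {sz hE hE' SE} => [[]|].
have [e eEE' eM] := exists_max_nat (@dim K) ne.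
have hEb a : a \in E -> pbasis a by move=> /hE[].
have hE'b a : a \in E' -> pbasis a by move=> /hE'[].
have Pe : (P <= dim e)%N.
  by move: eEE'; rewrite mem_cat => /orP[/hE[]|/hE'[]].
have [eE eE'] : e \in E /\ e \in E'.
  move: eEE'; rewrite mem_cat => /orP[eE|eE']; split=> //.
    apply: (mem_of_pent_sum hEb hE'b (SE _ Pe) eE) => a aE'.
    by apply: eM; rewrite mem_cat aE' orbT.
  apply: (mem_of_pent_sum hE'b hEb (esym (SE _ Pe)) eE') => a aE.
  by apply: eM; rewrite mem_cat aE.
rewrite (perm_trans (perm_to_rem eE)) // perm_sym (perm_trans (perm_to_rem eE')) //.
rewrite perm_cons perm_sym; apply: IH.
- rewrite size_cat !size_rem //; move: sz; rewrite size_cat.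
  by case: E eE {hE hEb SE ne eM eEE'} => // a E _ /=; case: E' eE' {hE' hE'b} => // b E' _ /=; lia.
- by move=> a /mem_rem /hE.
- by move=> a /mem_rem /hE'.
move=> k Pk; have := SE _ Pk.
rewrite (perm_big _ (perm_to_rem eE)) (perm_big _ (perm_to_rem eE')) /= !big_cons.
exact: addrI.
Qed.

Lemma psum_uniq P E E' n (x : nu_cell K n) : psum P E x -> psum P E' x -> perm_eq E E'.
Proof.
by move=> [h1 h2] [h1' h2']; apply: pent_sum_uniq h1 h1' _ => k Pk; rewrite -h2 // -h2'.
Qed.

Lemma psum_comp P E E' p n (pn : (p < n)%N) (y z : nu_cell K n)
    (H : nu_bd false pn y = nu_bd true pn z) :
  (p < P)%N -> psum P E y -> psum P E' z -> psum P (E ++ E') (nu_comp H).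
Proof.
move=> pP [h1 h2] [h1' h2']; split=> [e|eps k Pk].
  by rewrite mem_cat => /orP[/h1|/h1'].
by rewrite /= /nu_comp_ent leqNgt (leq_trans pP Pk) /= h2 // h2' // big_cat.
Qed.

Lemma kpos_pts k (x : K k) : kpos K x -> exists s : seq (pt K),
  [/\ forall e, e \in s -> pbasis e /\ dim e = k,
      forall eps, \sum_(e <- s) pent e eps k = x &
      forall eps k', (k < k')%N -> \sum_(e <- s) pent e eps k' = 0].
Proof.
move=> /kpos_decomp-/(_ hK)[t [tB ->]]; exists [seq mkpt b | b <- t]; split.
- by move=> e /mapP[b /tB Bb ->].
- by move=> eps; rewrite big_map; apply: eq_bigr => b _; rewrite /pent atom_ent_top.
- by move=> eps k' kk'; rewrite big_map big1 // => b _; rewrite /pent atom_ent_gt.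
Qed.

Lemma psum_top n (x : nu_cell K n) : exists E, psum n E x.
Proof.
have [s [sB s1 s2]] := kpos_pts (ent_pos x true n).
exists s; split=> [e /sB[Be ->] //|eps k].
rewrite leq_eqVlt => /orP[/eqP<-|nk]; last by rewrite s2 // ent_gt.
by rewrite s1; case: eps => //; exact: ent_top.
Qed.

Lemma pent_dif e eps k : (k < dim e)%N ->
  dif K (pent e eps k.+1) = pent e true k - pent e false k.
Proof. exact: atom_ent_dif. Qed.

Lemma psum_dif P E n (x : nu_cell K n) : psum P.+1 E x -> (P < n)%N ->
  ent x true P - ent x false P = \sum_(e <- E) (pent e true P - pent e false P).
Proof.
move=> [h1 h2] Pn; rewrite -(ent_dif x true) // h2 // raddf_sum /=.
rewrite big_seq [RHS]big_seq; apply: eq_bigr => e /h1[_ Pe]; exact: pent_dif.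
Qed.

(** By [psum_dif] the defect in degree [P] does not depend on the sign, so its positivity for one
    sign is enough; its basis elements are the atoms to be added. *)
Lemma psum_low eps P E n (x : nu_cell K n) : (P < n)%N -> psum P.+1 E x ->
  kpos K (ent x eps P - \sum_(e <- E) pent e eps P) ->
  exists2 E', psum P (E ++ E') x & forall e, e \in E' -> dim e = P.
Proof.
move=> Pn hx /kpos_pts[s [sB s1 s2]]; have dx := psum_dif hx Pn.
have [h1 h2] := hx.
exists s; last by move=> e /sB[].
split=> [e|eps' k].
  rewrite mem_cat => /orP[/h1[Be Pe]|/sB[Be ->]] //; split=> //; exact: ltnW.
rewrite big_cat leq_eqVlt => /orP[/eqP<-|Pk] /=; last by rewrite s2 // addr0 h2.
rewrite s1; case: (eqVneq eps' eps) => [->|ne]; first by rewrite addrC subrK.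
move: dx; rewrite sumrB => dx.
have {}dx : ent x true P - \sum_(e <- E) pent e true P =
            ent x false P - \sum_(e <- E) pent e false P.
  rewrite -[ent x true P](subrK (ent x false P)) dx.
  by rewrite addrAC [in LHS](addrC (\sum_(_ <- _) _)) addrK addrC.
have D e1 e2 : ent x e1 P - \sum_(e <- E) pent e e1 P =
    ent x e2 P - \sum_(e <- E) pent e e2 P by case: e1 e2 => -[].
by rewrite (D eps eps') addrC subrK.
Qed.

(** For one atom [e], [x^1_P - x^0_P = e^1_P - e^0_P] with disjoint supports on the right, so
    nonnegativity of [x] forces [x^1_P >= e^1_P]. With several atoms, targets may cancel against
    sources, which is why cells have to be split. *)
Lemma psum_small_pos P E n (x : nu_cell K n) : (P < n)%N -> psum P.+1 E x ->
  (size E <= 1)%N -> kpos K (ent x true P - \sum_(e <- E) pent e true P).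
Proof.
move=> Pn hx; have dx := psum_dif hx Pn; have [h1 h2] := hx.
case: E hx dx h1 h2 => [|e [|//]] hx dx h1 h2 _.
  by rewrite big_nil subr0; exact: ent_pos.
rewrite big_seq1; move: dx; rewrite big_seq1 => dx.
have [Be Pe] := h1 e (mem_head _ _).
apply/(kposE hK) => b; have := congr1 (fun z => coef z b) dx; rewrite /= !coefB //.
have := @atom_ent_disjoint K hK _ (projT2 e) P b Pe; rewrite -/(pent e true P) -/(pent e false P).
have /(kposE hK)/(_ b) := ent_pos x true P; have /(kposE hK)/(_ b) := ent_pos x false P.
lia.
Qed.

Lemma psum_small_low P E n (x : nu_cell K n) : (P < n)%N -> psum P.+1 E x ->
  (size E <= 1)%N -> exists E', psum P E' x.
Proof.
move=> Pn hx sE; have [E' hE' _] := psum_low Pn hx (psum_small_pos Pn hx sE).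
by exists (E ++ E').
Qed.

Lemma psum_nil P n (x : nu_cell K n) :
  (forall eps k, (P <= k)%N -> ent x eps k = 0) -> psum P [::] x.
Proof. by move=> x0; split=> // eps k Pk; rewrite big_nil x0. Qed.

Lemma psum_dim_le P E n (x : nu_cell K n) e : psum P E x -> e \in E -> (dim e <= n)%N.
Proof.
move=> [h1 h2] eE; rewrite leqNgt; apply/negP => ne; have := ent_gt x true ne.
have [Be Pe] := h1 _ eE.
rewrite h2 // (perm_big _ (perm_to_rem eE)) big_cons => /(congr1 (fun z => coef z (projT2 e))).
rewrite coefD // coef0 // [pent e _ _]atom_ent_top coef_basis // eqxx /=.
have hE a : a \in rem e E -> pbasis a by move=> /mem_rem /h1[].
have /(kposE hK)/(_ (projT2 e)) := pent_sum_kpos true (dim e) hE.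
by move=> S0 E0; suff : (0 : int) < 0 by []; rewrite -{2}E0 ltr_pwDl.
Qed.

Lemma pent_difT e eps k : dif K (pent e eps k.+1) = pent e true k - pent e false k.
Proof.
case: (ltngtP k (dim e)) => [/pent_dif //|ek|->].
- by rewrite /pent (atom_ent_gt _ _ (leqW ek)) !(atom_ent_gt _ _ ek) raddf0 subrr.
- by rewrite /pent !atom_ent_top atom_ent_gt ?raddf0 ?subrr.
Qed.

Lemma pent_top_eps (e : pt K) k : (dim e <= k)%N -> pent e false k = pent e true k.
Proof.
rewrite leq_eqVlt => /orP[/eqP <-|ek]; first by rewrite /pent !atom_ent_top.
by rewrite /pent !atom_ent_gt.
Qed.

Lemma psum_split_at P e E n (Pn : (P < n)%N) (x : nu_cell K n) :
  psum P.+1 (e :: E) x ->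
  kpos K (ent x true P - dif K (pent e true P.+1)) ->
  exists (y z : nu_cell K n) (H : nu_bd false Pn y = nu_bd true Pn z),
    [/\ x = nu_comp H, psum P.+1 [:: e] y & psum P.+1 E z].
Proof.
move=> hx mid; have [h1 h2] := hx; have [Be Pe] := h1 e (mem_head _ _).
have hE a : a \in E -> pbasis a /\ (P < dim a)%N by move=> aE; apply: h1; rewrite inE aE orbT.
have dn := psum_dim_le hx (mem_head _ _).
have [|||||||y [z [H [xE yE zE]]]] := @cut P n Pn x (pent e).
- by move=> eps k Pk; exact: pent_kpos.
- move=> eps k Pk; rewrite h2 // big_cons addrC addKr.
  by apply: pent_sum_kpos => a /hE[].
- by move=> eps k nk; rewrite /pent atom_ent_gt // (leq_ltn_trans dn).
- exact: pent_top_eps.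
- by move=> eps k _ _; exact: pent_difT.
- by rewrite !pent_difT.
- exact: mid.
exists y, z, H; split=> //.
  split=> [a|eps k Pk]; first by rewrite inE => /eqP ->.
  by rewrite yE /cut_tgt_ent Pk big_seq1.
by split=> // eps k Pk; rewrite zE /cut_src_ent Pk h2 // big_cons addrC addKr.
Qed.

(* No element of [E] has to be traversed after [e] at level [P], so that [e] can be
   split off at the target end; strong loop-freeness provides such an [e]. *)
Definition tgt_free (P : nat) (e : pt K) (E : seq (pt K)) : Prop :=
  forall a, a \in E -> forall g,
    coef (pent a false P) g = 0 \/ coef (pent e true P) g = 0.

(** The intermediate cell has [x^1 - e^1 + e^0] in degree [P]. Off the support of [e^1] this is
    visibly nonnegative; on that support no other atom has a source, and it equals [x^0] plus the
    targets of the other atoms. *)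
Lemma psum_split P e E n (Pn : (P < n)%N) (x : nu_cell K n) :
  psum P.+1 (e :: E) x -> tgt_free P e E ->
  exists (y z : nu_cell K n) (H : nu_bd false Pn y = nu_bd true Pn z),
    [/\ x = nu_comp H, psum P.+1 [:: e] y & psum P.+1 E z].
Proof.
move=> hx free; apply: psum_split_at => //; have dx := psum_dif hx Pn.
have [h1 h2] := hx; have [Be Pe] := h1 e (mem_head _ _).
have hE a : a \in E -> pbasis a /\ (P < dim a)%N by move=> aE; apply: h1; rewrite inE aE orbT.
rewrite pent_dif //; apply/(kposE hK) => g.
have := congr1 (fun z => coef z g) dx; rewrite /= big_cons [RHS]coefD // !coefB // coef_sum //.
have /(kposE hK)/(_ g) := ent_pos x true P; have /(kposE hK)/(_ g) := ent_pos x false P.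
have p0 := pent_ge0 true g Be; have p1 := pent_ge0 false g Be.
case: (eqVneq (coef (pent e true P) g) 0) => [->|ne]; first by move=> *; lia.
suff : 0 <= \sum_(a <- E) coef (pent a true P - pent a false P) g by lia.
rewrite big_seq; apply: sumr_ge0 => a aE; have [Ba Pa] := hE _ aE.
have := pent_ge0 true g Ba; rewrite coefB //.
by case: (free _ aE g) => [->|E0]; [lia | rewrite E0 eqxx in ne].
Qed.

Lemma exists_sgn_part_neq0 eps n (y : K n.+1) g : kpos K y ->
  coef (sgn_part eps (dif K y)) g != 0 ->
  exists2 h, 0 < coef y h & coef (sgn_part eps (dif K h)) g != 0.
Proof.
move=> y0; case: eps => /=; rewrite ?(coef_ppart hK) ?(coef_npart hK) => cg.
  have {}cg : 0 < coef (dif K y) g by lia.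
  have [u v|h hy hg] := kpos_posterm hK (psi := fun z => coef (dif K z) g) _ y0 cg.
    by rewrite raddfD /= coefD.
  by exists h => //; rewrite (coef_ppart hK); lia.
have {}cg : 0 < - coef (dif K y) g by lia.
have [u v|h hy hg] := kpos_posterm hK (psi := fun z => - coef (dif K z) g) _ y0 cg.
  by rewrite raddfD /= coefD // opprD.
by exists h => //; rewrite (coef_npart hK); lia.
Qed.

(** A basis element in the positive or negative part of a boundary already occurs in that part for a
    single basis element one degree up; these generating relations are chained from degree [k] to
    degree [m]. *)
Lemma atom_ent_le m (b : K m) eps k g : basis K m b -> coef (atom_ent b eps k) g != 0 ->
  basis K k g /\ if eps then steiner_le (mkpt b) (mkpt g) else steiner_le (mkpt g) (mkpt b).
Proof.
move=> Bb; case: (leqP k m) => [km|mk]; last by rewrite atom_ent_gt // coef0 // eqxx.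
have [p pE] : exists p, m = (p + k)%N by exists (m - k)%N; lia.
elim: p k g km pE => [|p IH] k g km pE.
  move: pE; rewrite add0n => E; subst m; rewrite atom_ent_top coef_basis //.
  case: (eqVneq g b) => [->|_]; last by rewrite eqxx.
  by split=> //; case: eps; exact: rt_refl.
have {}km : (k < m)%N by lia.
rewrite atom_ent_step //; set y := atom_ent b eps k.+1 => cg.
have Bg : basis K k g.
  by apply: contrapT => nB; rewrite (coef_notin hK) ?eqxx in cg.
have y0 : kpos K y by apply: atom_ent_kpos => //; exact: kpos_basis.
have [h hy hg] := exists_sgn_part_neq0 y0 cg.
have [||Bh le_h] := IH k.+1 h km; first by lia.
  by rewrite gt_eqF.
split=> //; move: (hg) (le_h); case: (eps) => /= {}hg {}le_h.
  by apply: rt_trans le_h _; apply: rt_step; exact: LeTarget.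
by apply: rt_trans le_h; apply: rt_step; exact: LeSource.
Qed.

Hypotheses (uK : unitary K) (lfK : strongly_loop_free K).

(** The augmentation counts atoms: it is 1 on each of them by unitarity, and 1 on every cell. *)
Lemma psum0_size E n (x : nu_cell K n) : psum 0 E x -> size E = 1%N.
Proof.
move=> [h1 h2]; have := ent_aug x true; rewrite h2 // raddf_sum /=.
suff -> : \sum_(e <- E) aug K (pent e true 0%N) = (size E)%:Z by lia.
transitivity (\sum_(e <- E) (1 : int)).
  rewrite big_seq [RHS]big_seq; apply: eq_bigr => e /h1[Be _].
  exact: (proj1 (unitaryE K) uK _ _ Be true).
by rewrite big_const_seq count_predT iter_addr_0 natz.
Qed.

(** Take [e] maximal. An element [g] shared by the target of [e] and the source of [a] gives
    [e <= g <= a], so [a = e], whose own source and target are disjoint. *)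
Lemma exists_tgt_free P E : E != [::] ->
  (forall e, e \in E -> pbasis e /\ (P < dim e)%N) ->
  exists e E', perm_eq E (e :: E') /\ tgt_free P e E'.
Proof.
move=> ne hE.
have [||e eE eM] := @exists_maximal (pt K) (@steiner_le K) E _ _ ne.
- by move=> a b c; exact: rt_trans.
- move=> [m a] [q b] /hE[Ba _] /hE[Bb _]; exact: lfK.
exists e, (rem e E); split; first exact: perm_to_rem.
move=> a /mem_rem aE g; have [Ba Pa] := hE _ aE; have [Be Pe] := hE _ eE.
apply: contrapT => /not_orP[/eqP a0 /eqP e0].
have [_ /= le1] := atom_ent_le Ba a0; have [_ /= le2] := atom_ent_le Be e0.
have ae : a = e.
  apply: eM => //; move: le1 le2; rewrite /mkpt; case: a {a0 Ba Pa aE} => ? ?.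
  by case: e {e0 Be Pe eE} => ? ? /=; move=> h1 h2; exact: rt_trans h2 h1.
subst a; have := atom_ent_disjoint hK (projT2 e) g Pe.
by move: a0 e0; rewrite /pent; case=> + + []; move=> /eqP h1 /eqP h2 h; rewrite h in h1 h2.
Qed.

(** At level [P+1] atoms are split off until none is left; a cell with at most one atom there is a
    sum of atoms at level [P], where the argument repeats. At level 0 unitarity leaves a single
    atom. *)
Lemma psum_ind n (Q : nat -> nu_cell K n -> Prop) :
  (forall e x, psum 0 [:: e] x -> Q 0%N x) ->
  (forall P x E, (P < n)%N -> (size E <= 1)%N -> psum P.+1 E x -> Q P x -> Q P.+1 x) ->
  (forall P (Pn : (P < n)%N) e E (y z : nu_cell K n)
     (H : nu_bd false Pn y = nu_bd true Pn z), psum P.+1 [:: e] y -> psum P.+1 E z ->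
     Q P y -> Q P.+1 z -> Q P.+1 (nu_comp H)) ->
  forall P E x, (P <= n)%N -> psum P E x -> Q P x.
Proof.
move=> Q0 Q1 Q2; elim=> [|P IHP] E x Pn hx.
  have := psum0_size hx; case: E hx => [|e [|]] // hx _; exact: Q0 hx.
move: {2}(size E) (erefl (size E)) => N; elim: N E x hx => [|N IH] E x hx sE.
  have sE1 : (size E <= 1)%N by rewrite sE.
  have [E' hE'] := psum_small_low Pn hx sE1.
  by apply: Q1 hx _ => //; apply: IHP hE'; exact: ltnW.
have ne : E != [::] by case: E sE {hx}.
have [e [E' [EE' free]]] := exists_tgt_free ne hx.1.
have [y [z [H [-> hy hz]]]] := psum_split Pn (psum_perm EE' hx) free.
have Qz : Q P.+1 z by apply: IH hz _; have := perm_size EE'; rewrite sE => -[].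
apply: (Q2 _ _ _ _ _ _ _ hy hz) => //.
have [E1 hE1] := psum_small_low Pn hy isT.
by apply: IHP hE1; exact: ltnW.
Qed.

End Cells.

(** * Composites carrying at most one atom *)

Section TrivialComp.
Variable K : adc.
Hypothesis hK : has_basis K.

(** Descent from the degree of the only atom: once [u] vanishes in degree [k+1], its two entries in
    degree [k] coincide and are bounded by both the source and the target of the atom, which are
    disjoint. *)
Lemma small_cell_zero r E n (u : nu_cell K n) :
  (size E <= 1)%N -> (forall e, e \in E -> pbasis e) ->
  (forall eps k b, (r < k)%N -> coef (ent u eps k) b <= coef (\sum_(e <- E) pent e eps k) b) ->
  (forall e, e \in E -> (r < dim e)%N -> coef (ent u false (dim e)) (projT2 e) = 0) ->
  forall eps k, (r < k)%N -> ent u eps k = 0.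
Proof.
move=> sE hE ule u0.
have ge0 eps k b : 0 <= coef (ent u eps k) b by apply: (proj1 (kposE hK _)); exact: ent_pos.
have zero eps k : (r < k)%N -> \sum_(e <- E) pent e eps k = 0 -> ent u eps k = 0.
  move=> rk S0; apply: (coef_ext hK) => b; rewrite coef0 //.
  by have := ule eps k b rk; have := ge0 eps k b; rewrite S0 coef0 //; lia.
case: E sE hE ule u0 zero => [|e [|//]] _ hE ule u0 zero.
  by move=> eps k rk; rewrite zero ?big_nil.
have Be := hE e (mem_head _ _).
have big eps k : (r < k)%N -> (dim e < k)%N -> ent u eps k = 0.
  by move=> rk ek; rewrite zero // big_seq1 /pent atom_ent_gt.
have top eps : (r < dim e)%N -> ent u eps (dim e) = 0.
  move=> re; have E0 : ent u false (dim e) = 0.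
    apply: (coef_ext hK) => b; rewrite coef0 //.
    have := ule false _ b re; have := ge0 false (dim e) b.
    rewrite big_seq1 [pent e _ _]atom_ent_top (coef_basis hK b Be).
    by case: eqP => [->|_] /=; [rewrite u0 ?mem_head | lia].
  case: eps => //; case: (ltngtP (dim e) n) => [en|ne|E].
  - by move: (ent_dif u true en); rewrite E0 subr0 big ?raddf0 ?ltnS // ltnW.
  - by rewrite ent_gt.
  - by move: E0; rewrite E ent_top.
have low d : forall eps k, (r < k)%N -> dim e = (d + k)%N -> ent u eps k = 0.
  elim: d => [|d IH] eps k rk; first by rewrite add0n => E; move: rk; rewrite -E; exact: top.
  move=> E; have kn : (k < n)%N \/ (n <= k)%N by lia.
  case: kn => kn; last first.
    have kd : (k < dim e)%N by lia.
    have E0 : ent u false k = ent u true k.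
      by case: (ltngtP n k) kn => // [nk|nk] _; [rewrite !ent_gt | rewrite -nk ent_top].
    apply: (coef_ext hK) => b; rewrite coef0 //.
    have := ule true _ b rk; have := ule false _ b rk; rewrite !big_seq1 E0.
    have := ge0 true k b; have := @atom_ent_disjoint K hK _ (projT2 e) k b kd.
    rewrite -/(pent e true k) -/(pent e false k).
    by case: eps; rewrite ?E0; lia.
  have kd : (k < dim e)%N by lia.
  have E0 : ent u true k = ent u false k.
    by apply/eqP; rewrite -subr_eq0 -(ent_dif u true) // IH ?raddf0 //; lia.
  apply: (coef_ext hK) => b; rewrite coef0 //.
  have := ule true _ b rk; have := ule false _ b rk; rewrite !big_seq1 E0.
  have := ge0 false k b; have := @atom_ent_disjoint K hK _ (projT2 e) k b kd.
  rewrite -/(pent e true k) -/(pent e false k).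
  by case: eps; rewrite ?E0; lia.
move=> eps k rk; case: (ltnP (dim e) k) => [ek|ke]; first exact: big.
by apply: (low (dim e - k)%N) => //; lia.
Qed.

(** An atom of degree above [r] has coefficient 1 at its own basis element, so one of the two
    factors has coefficient 0 there, and that factor vanishes above [r]. *)
Lemma nu_comp_small r E n (rn : (r < n)%N) (y z : nu_cell K n)
    (H : nu_bd false rn y = nu_bd true rn z) :
  psum r E (nu_comp H) -> (size E <= 1)%N ->
  (forall eps k, (r < k)%N -> ent y eps k = 0) \/
  (forall eps k, (r < k)%N -> ent z eps k = 0).
Proof.
move=> [h1 h2] sE.
have hE e : e \in E -> pbasis e by move=> /h1[].
have sumE eps k b : (r < k)%N ->
    coef (ent y eps k) b + coef (ent z eps k) b = coef (\sum_(e <- E) pent e eps k) b.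
  by move=> rk; rewrite -h2 ?(ltnW rk) //= /nu_comp_ent leqNgt rk /= coefD.
have yge0 eps k b : 0 <= coef (ent y eps k) b by apply: (proj1 (kposE hK _)); exact: ent_pos.
have zge0 eps k b : 0 <= coef (ent z eps k) b by apply: (proj1 (kposE hK _)); exact: ent_pos.
have yle eps k b : (r < k)%N -> coef (ent y eps k) b <= coef (\sum_(e <- E) pent e eps k) b.
  by move=> /(sumE eps _ b); have := zge0 eps k b; lia.
have zle eps k b : (r < k)%N -> coef (ent z eps k) b <= coef (\sum_(e <- E) pent e eps k) b.
  by move=> /(sumE eps _ b); have := yge0 eps k b; lia.
have /orP[y0|z0] : [|| all (fun e : pt K => (r < dim e)%N ==>
      (coef (ent y false (dim e)) (projT2 e) == 0)) E |
    all (fun e : pt K => (r < dim e)%N ==>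
      (coef (ent z false (dim e)) (projT2 e) == 0)) E].
- case: E sE h1 h2 hE sumE {yle zle} => [|e [|//]] _ h1 h2 hE sumE //=; rewrite !andbT.
  case: ltnP => //= re; have := sumE false _ (projT2 e) re.
  rewrite big_seq1 [pent e _ _]atom_ent_top (coef_basis hK _ (hE _ (mem_head _ _))) eqxx /= -/(dim e).
  have := yge0 false (dim e) (projT2 e); have := zge0 false (dim e) (projT2 e); lia.
- left; apply: small_cell_zero sE hE yle _ => e /(allP y0) /implyP h re.
  by apply/eqP/h.
- right; apply: small_cell_zero sE hE zle _ => e /(allP z0) /implyP h re.
  by apply/eqP/h.
Qed.

End TrivialComp.

(* Let [r = p + 1].  If [y *_r z] is a sum of atoms in degrees [>= r], with atoms [a]
   coming from [y], [b] from [z] and common atoms [g] of degree [r], then [y] consists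
   of [a], [g] and the degree [r] targets of [b], whereas [z] consists of [b], [g] and
   the degree [r] sources of [a].  [whisk] describes both.  Splitting one atom off
   [y *_r z] at level [p] therefore splits [y] and [z] compatibly. *)
Section CutComp.
Variable K : adc.
Hypothesis hK : has_basis K.
Variables (p n : nat) (rn : (p.+1 < n)%N).
Let r := p.+1.
Let pn : (p < n)%N := ltnW rn.

Definition whisk_ent (eta : bool) (A B : seq (pt K)) (eps : bool) (k : nat) : K k :=
  \sum_(e <- A) pent e eps k + \sum_(e <- B) (if k == r then pent e eta k else 0).

Definition whisk (eta : bool) (A B : seq (pt K)) (x : nu_cell K n) : Prop :=
  forall eps k, (r <= k)%N -> ent x eps k = whisk_ent eta A B eps k.

Lemma whisk_ent_cat eta A0 A1 B0 B1 eps k :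
  whisk_ent eta (A0 ++ A1) (B0 ++ B1) eps k =
  whisk_ent eta A0 B0 eps k + whisk_ent eta A1 B1 eps k.
Proof. by rewrite /whisk_ent !big_cat addrACA. Qed.

Lemma whisk_ent_gt eta A B eps k : (r < k)%N ->
  whisk_ent eta A B eps k = \sum_(e <- A) pent e eps k.
Proof.
by move=> rk; rewrite /whisk_ent [X in _ + X]big1 ?addr0 // => e _; rewrite gtn_eqF.
Qed.

Lemma whisk_ent_eq eta A B eps :
  whisk_ent eta A B eps r = \sum_(e <- A) pent e eps r + \sum_(e <- B) pent e eta r.
Proof. by rewrite /whisk_ent; congr (_ + _); apply: eq_bigr => e _; rewrite eqxx. Qed.

Lemma whisk_ent_kpos eta A B eps k : (forall e, e \in A ++ B -> pbasis e) ->
  kpos K (whisk_ent eta A B eps k).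
Proof.
move=> h; apply: kposD; apply: kpos_sum => e ein.
  by apply: pent_kpos => //; apply: h; rewrite mem_cat ein.
case: ifP => _; last exact: kpos0.
by apply: pent_kpos => //; apply: h; rewrite mem_cat ein orbT.
Qed.

Lemma whisk_psum eta A B x : whisk eta A B x ->
  (forall e, e \in A ++ B -> pbasis e /\ (r <= dim e)%N) -> exists E, psum r E x.
Proof.
move=> hx hAB.
have Bpos : kpos K (\sum_(e <- B) pent e eta r).
  by apply: pent_sum_kpos => // e eB; apply: (hAB e _).1; rewrite mem_cat eB orbT.
have [s [sB s1 s2]] := kpos_pts hK Bpos.
exists (A ++ s); split=> [e|eps k].
  rewrite mem_cat => /orP[eA|/sB[Be ->] //].
  by apply: hAB; rewrite mem_cat eA.
rewrite leq_eqVlt => /orP[/eqP<-|rk]; first by rewrite hx // whisk_ent_eq big_cat s1.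
by rewrite hx ?whisk_ent_gt ?(ltnW rk) // big_cat /= s2 // addr0.
Qed.

Lemma whisk_cut eta A0 A1 B0 B1 (x : nu_cell K n) :
  whisk eta (A0 ++ A1) (B0 ++ B1) x ->
  (forall e, e \in (A0 ++ A1) ++ (B0 ++ B1) -> pbasis e /\ (dim e <= n)%N) ->
  kpos K (ent x true p - \sum_(e <- A0 ++ B0) dif K (pent e true r)) ->
  (forall e, e \in B0 -> (r < dim e)%N) ->
  exists (y z : nu_cell K n) (H : nu_bd false pn y = nu_bd true pn z),
    [/\ x = nu_comp H, whisk eta A0 B0 y, whisk eta A1 B1 z,
        (forall eps k, (k < p)%N -> ent y eps k = ent x eps k /\ ent z eps k = ent x eps k) &
        [/\ ent y true p = ent x true p, ent z false p = ent x false p,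
         ent y false p = ent x true p - \sum_(e <- A0 ++ B0) dif K (pent e true r) &
         ent z true p = ent x true p - \sum_(e <- A0 ++ B0) dif K (pent e true r)]].
Proof.
move=> hx hAB mid hB0.
have difr eps : dif K (whisk_ent eta A0 B0 eps r) =
    \sum_(e <- A0 ++ B0) dif K (pent e true r).
  rewrite whisk_ent_eq raddfD !raddf_sum big_cat /=; congr (_ + _).
    by apply: eq_bigr => e _; rewrite !pent_difT.
  by apply: eq_bigr => e _; rewrite !pent_difT.
have inA0 e : e \in A0 -> pbasis e /\ (dim e <= n)%N.
  by move=> eA; apply: hAB; rewrite !mem_cat eA.
have inB0 e : e \in B0 -> pbasis e /\ (dim e <= n)%N.
  by move=> eA; apply: hAB; rewrite !mem_cat eA !orbT.
have hAB0 e : e \in A0 ++ B0 -> pbasis e.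
  by rewrite mem_cat => /orP[/inA0[]|/inB0[]].
have hAB1 e : e \in A1 ++ B1 -> pbasis e.
  by move=> h; apply: (hAB e _).1; move: h; rewrite !mem_cat => /orP[->|->]; rewrite !orbT.
have [|||||||y [z [H [xE yE zE]]]] := @cut K p n pn x (whisk_ent eta A0 B0).
- by move=> eps k _; exact: whisk_ent_kpos.
- by move=> eps k pk; rewrite hx // whisk_ent_cat addrC addKr; exact: whisk_ent_kpos.
- move=> eps k nk; rewrite whisk_ent_gt ?(ltn_trans rn) // big_seq big1 // => e /inA0[_ en].
  by rewrite /pent atom_ent_gt // (leq_ltn_trans en).
- rewrite /whisk_ent; congr (_ + _); rewrite big_seq [RHS]big_seq.
  by apply: eq_bigr => e /inA0[_ en]; exact: pent_top_eps.
- move=> eps k pk kn; rewrite whisk_ent_gt // raddf_sum /=.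
  rewrite /whisk_ent opprD addrACA subrr addr0 -sumrB.
  by apply: eq_bigr => e _; rewrite pent_difT.
- by rewrite -/r !difr.
- by rewrite -/r difr.
exists y, z, H; split=> //.
- by move=> eps k rk; rewrite yE /cut_tgt_ent rk.
- by move=> eps k rk; rewrite zE /cut_src_ent rk hx // whisk_ent_cat addrC addKr.
- by move=> eps k kp; rewrite yE zE /cut_tgt_ent /cut_src_ent ltnNge (ltnW kp) /= (ltn_eqF kp).
- by rewrite !yE !zE /cut_tgt_ent /cut_src_ent ltnn eqxx /= -/r difr.
Qed.

Lemma whisk_comp a b g (y z : nu_cell K n) (H : nu_bd false rn y = nu_bd true rn z) :
  (forall e, e \in a ++ b ++ g -> pbasis e /\ (r <= dim e)%N) ->
  (forall e, e \in g -> dim e = r) ->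
  whisk true (a ++ g) b y -> whisk false (b ++ g) a z ->
  psum r (a ++ b ++ g) (nu_comp H).
Proof.
move=> h hg hy hz; split=> // eps k; rewrite leq_eqVlt => /orP[/eqP<-|rk] /=.
  rewrite /nu_comp_ent leqnn; case: eps.
    by rewrite hy // whisk_ent_eq !big_cat /= addrAC addrA.
  rewrite hz // whisk_ent_eq !big_cat /=.
  by rewrite [LHS]addrC.
rewrite /nu_comp_ent leqNgt rk /= hy ?(ltnW rk) // hz ?(ltnW rk) // !whisk_ent_gt // !big_cat /=.
have -> : \sum_(e <- g) pent e eps k = 0.
  by rewrite big_seq big1 // => e /hg eg; rewrite /pent atom_ent_gt // -/(dim e) eg.
by rewrite !addr0.
Qed.

Lemma whisk_composable a b g (y z : nu_cell K n) :
  (forall e, e \in g -> dim e = r) ->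
  whisk true (a ++ g) b y -> whisk false (b ++ g) a z ->
  (forall eps k, (k < r)%N -> ent y eps k = ent z eps k) ->
  nu_bd false rn y = nu_bd true rn z.
Proof.
move=> hg hy hz yz; apply: nu_comp_eqP => //.
rewrite hy // hz // !whisk_ent_eq !big_cat /=.
have -> : \sum_(e <- g) pent e false r = \sum_(e <- g) pent e true r.
  by rewrite big_seq [RHS]big_seq; apply: eq_bigr => e /hg eg; rewrite pent_top_eps ?eg.
by rewrite [LHS]addrC addrA [RHS]addrAC.
Qed.

Definition hi (E : seq (pt K)) := [seq e <- E | (r < dim e)%N].

Lemma hi_sum E eps k : (r < k)%N ->
  \sum_(e <- hi E) pent e eps k = \sum_(e <- E) pent e eps k.
Proof.
move=> rk; rewrite big_filter [RHS](bigID (fun e : pt K => (r < dim e)%N)) /=.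
rewrite [X in _ + X]big1 ?addr0 // => e; rewrite -leqNgt => er.
by rewrite /pent atom_ent_gt // (leq_ltn_trans er).
Qed.

(** Entries above [r] determine the atoms of degree above [r]; what the composite has in addition is
    [g]. In degree [r] the target of [y] and the source of [z] are read off the composite, and [d]
    gives the other two entries. *)
Lemma nu_comp_whisk Ey Ez E (y z : nu_cell K n) (H : nu_bd false rn y = nu_bd true rn z) :
  psum r Ey y -> psum r Ez z -> psum r E (nu_comp H) -> exists g,
  [/\ perm_eq E (hi Ey ++ hi Ez ++ g), forall e, e \in g -> dim e = r,
      whisk true (hi Ey ++ g) (hi Ez) y & whisk false (hi Ez ++ g) (hi Ey) z].
Proof.
move=> hy hz hw; have [y1 y2] := hy; have [z1 z2] := hz; have [w1 w2] := hw.
set g := [seq e <- E | ~~ (r < dim e)%N].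
have hg e : e \in g -> dim e = r.
  by rewrite mem_filter -leqNgt => /andP[er /w1[_ re]]; apply/eqP; rewrite eqn_leq er.
have hEg : perm_eq (hi Ey ++ hi Ez) (hi E).
  apply: (@pent_sum_uniq K hK r.+1).
  - by move=> e; rewrite mem_cat !mem_filter => /orP[/andP[re /y1[]]|/andP[re /z1[]]].
  - by move=> e; rewrite mem_filter => /andP[re /w1[]].
  - move=> k rk; rewrite big_cat /= !hi_sum // -w2 ?(ltnW rk) //= /nu_comp_ent leqNgt rk /=.
    by rewrite y2 ?z2 // ltnW.
have permE : perm_eq E (hi Ey ++ hi Ez ++ g).
  by rewrite catA perm_sym (perm_trans (perm_cat hEg (perm_refl g))) // perm_filterC.
have dr (x : nu_cell K n) Ex : psum r Ex x ->
    ent x true r - ent x false r = \sum_(e <- hi Ex) (pent e true r - pent e false r).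
  move=> [_ x2]; rewrite -(ent_dif x true) // x2 // -hi_sum // raddf_sum /=.
  by apply: eq_bigr => e _; rewrite pent_difT.
have g0 eps k : (r < k)%N -> \sum_(e <- g) pent e eps k = 0.
  by move=> rk; rewrite big_seq big1 // => e /hg eg; rewrite /pent atom_ent_gt // -/(dim e) eg.
have geps : \sum_(e <- g) pent e false r = \sum_(e <- g) pent e true r.
  by rewrite big_seq [RHS]big_seq; apply: eq_bigr => e /hg eg; rewrite pent_top_eps ?eg.
have yt : ent y true r = whisk_ent true (hi Ey ++ g) (hi Ez) true r.
  have := w2 true r (leqnn r); rewrite /= /nu_comp_ent leqnn => ->.
  by rewrite (perm_big _ permE) whisk_ent_eq !big_cat /= addrAC addrA.
have zs : ent z false r = whisk_ent false (hi Ez ++ g) (hi Ey) false r.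
  have := w2 false r (leqnn r); rewrite /= /nu_comp_ent leqnn => ->.
  by rewrite (perm_big _ permE) whisk_ent_eq !big_cat /= addrC.
exists g; split=> // eps k; rewrite leq_eqVlt => /orP[/eqP<-|rk].
- case: eps; first exact: yt.
  have := dr _ _ hy; rewrite yt !whisk_ent_eq !big_cat /= sumrB geps => dy.
  rewrite -[ent y false r]opprK -[- ent y false r](addKr (ent y true r)) opprD opprK.
  rewrite yt whisk_ent_eq !big_cat /= dy.
  set s1 := \sum_(e <- hi Ey) _; set s2 := \sum_(e <- hi Ey) _.
  by rewrite opprB [LHS]addrC !addrA subrK.
- by rewrite y2 ?(ltnW rk) // whisk_ent_gt // big_cat /= g0 // addr0 hi_sum.
- case: eps; last exact: zs.
  have := dr _ _ hz; rewrite zs !whisk_ent_eq !big_cat /= sumrB => dz.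
  rewrite -[ent z true r](subrK (ent z false r)) zs whisk_ent_eq !big_cat /= dz geps.
  by rewrite !addrA subrK.
- by rewrite z2 ?(ltnW rk) // whisk_ent_gt // big_cat /= g0 // addr0 hi_sum.
Qed.

(** [y] and [z] agree in degree [p], and both cuts remove the same boundary [d (e^1_r)] there, so
    the pieces have matching intermediate cells and compose along [r] again. *)
Lemma nu_comp_cut Ey Ez e E (y z : nu_cell K n) (H : nu_bd false rn y = nu_bd true rn z) :
  psum r Ey y -> psum r Ez z -> psum r (e :: E) (nu_comp H) ->
  kpos K (ent (nu_comp H) true p - dif K (pent e true r)) ->
  exists (u1 u2 v1 v2 : nu_cell K n)
    (Hu : nu_bd false pn u1 = nu_bd true pn u2)
    (Hv : nu_bd false pn v1 = nu_bd true pn v2)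
    (H1 : nu_bd false rn u1 = nu_bd true rn v1)
    (H2 : nu_bd false rn u2 = nu_bd true rn v2),
  [/\ y = nu_comp Hu, z = nu_comp Hv,
      psum r [:: e] (nu_comp H1), psum r E (nu_comp H2) &
      [/\ exists E, psum r E u1, exists E, psum r E u2,
          exists E, psum r E v1 & exists E, psum r E v2]].
Proof.
move=> hy hz hw mid.
have [g [permE hg yw zw]] := nu_comp_whisk hy hz hw.
have [w1 w2] := hw.
(* [e] is an atom of [y], an atom of [z], or a common one of degree [r]; it alone forms the first
   half of its group, and the other two first halves are empty. *)
have [a0 [a1 [b0 [b1 [g0 [g1 [pa pb pg pe pE]]]]]]] : exists a0 a1 b0 b1 g0 g1,
  [/\ perm_eq (hi Ey) (a0 ++ a1), perm_eq (hi Ez) (b0 ++ b1), perm_eq g (g0 ++ g1),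
      perm_eq [:: e] (a0 ++ b0 ++ g0) & perm_eq E (a1 ++ b1 ++ g1)].
  have : e \in hi Ey ++ hi Ez ++ g by rewrite -(perm_mem permE) mem_head.
  rewrite !mem_cat => /or3P[ei|ei|ei].
  - exists [:: e], (rem e (hi Ey)), [::], (hi Ez), [::], g; split=> //.
      exact: perm_to_rem.
    rewrite -(perm_cons e) (perm_trans permE) //.
    by rewrite -!cat_cons perm_cat2r perm_to_rem.
  - exists [::], (hi Ey), [:: e], (rem e (hi Ez)), [::], g; split=> //.
      exact: perm_to_rem.
    rewrite -(perm_cons e) (perm_trans permE) //.
    rewrite -(cat1s e (_ ++ _)) perm_sym perm_catCA perm_cat2l.
    by rewrite catA perm_cat2r perm_sym perm_to_rem.
  - exists [::], (hi Ey), [::], (hi Ez), [:: e], (rem e g); split=> //.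
      exact: perm_to_rem.
    rewrite -(perm_cons e) (perm_trans permE) //.
    rewrite -(cat1s e (_ ++ _)) perm_sym perm_catCA perm_cat2l.
    by rewrite perm_catCA perm_cat2l perm_sym perm_to_rem.
have allP e' : e' \in hi Ey ++ hi Ez ++ g -> [/\ pbasis e', (r <= dim e')%N & (dim e' <= n)%N].
  rewrite -(perm_mem permE) => h; have [? ?] := w1 _ h; split=> //.
  exact: (psum_dim_le hK hw h).
have hhi E' e' : e' \in hi E' -> (r < dim e')%N by rewrite mem_filter => /andP[].
have whisk_perm eta A B A' B' x : perm_eq A A' -> perm_eq B B' ->
    whisk eta A B x -> whisk eta A' B' x.
  move=> pA pB h eps k rk; rewrite h //.
  by rewrite /whisk_ent (perm_big _ pA) (perm_big _ pB).
have {yw}yw : whisk true ((a0 ++ g0) ++ (a1 ++ g1)) (b0 ++ b1) y.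
  apply: whisk_perm yw => //; apply: perm_trans (perm_cat pa pg) _.
  by rewrite -!catA perm_cat2l perm_catCA.
have {zw}zw : whisk false ((b0 ++ g0) ++ (b1 ++ g1)) (a0 ++ a1) z.
  apply: whisk_perm zw => //; apply: perm_trans (perm_cat pb pg) _.
  by rewrite -!catA perm_cat2l perm_catCA.
have memab e' : [|| e' \in a0, e' \in a1, e' \in b0, e' \in b1, e' \in g0 | e' \in g1] ->
    [/\ pbasis e', (r <= dim e')%N & (dim e' <= n)%N].
  move=> h; apply: allP; move: h.
  by rewrite !mem_cat (perm_mem pa) (perm_mem pb) (perm_mem pg) !mem_cat -!orbA.
have dife A B : perm_eq [:: e] (A ++ B) ->
    \sum_(e0 <- A ++ B) dif K (pent e0 true r) = dif K (pent e true r).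
  by move=> pAB; rewrite -(perm_big _ pAB) big_seq1.
have py : perm_eq [:: e] ((a0 ++ g0) ++ b0).
  by rewrite (perm_trans pe) // -catA perm_cat2l perm_catC.
have pz : perm_eq [:: e] ((b0 ++ g0) ++ a0).
  by rewrite (perm_trans pe) // perm_catC.
have wt : ent (nu_comp H) true p = ent y true p by rewrite /= /nu_comp_ent ltnW.
have yz eps : ent y eps p = ent z eps p := nu_composable_lt H eps (ltnSn p).
have [|||u1 [u2 [Hu [yE u1w u2w ulow [ut us um1 um2]]]]] := whisk_cut yw.
- move=> e' h; have [] // := memab e'.
  by move: h; rewrite !mem_cat => /orP[/orP[]/orP[]|/orP[]] ->; rewrite ?orbT.
- by rewrite dife // -wt.
- by move=> e' h; apply: (hhi Ez); rewrite (perm_mem pb) mem_cat h.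
have [|||v1 [v2 [Hv [zE v1w v2w vlow [vt vs vm1 vm2]]]]] := whisk_cut zw.
- move=> e' h; have [] // := memab e'.
  by move: h; rewrite !mem_cat => /orP[/orP[]/orP[]|/orP[]] ->; rewrite ?orbT.
- by rewrite dife // -yz -wt.
- by move=> e' h; apply: (hhi Ey); rewrite (perm_mem pa) mem_cat h.
have hg0 e' : e' \in g0 -> dim e' = r by move=> h; apply: hg; rewrite (perm_mem pg) mem_cat h.
have hg1 e' : e' \in g1 -> dim e' = r by move=> h; apply: hg; rewrite (perm_mem pg) mem_cat h orbT.
have H1 : nu_bd false rn u1 = nu_bd true rn v1.
  apply: whisk_composable hg0 u1w v1w _ => eps k.
  rewrite ltnS leq_eqVlt => /orP[/eqP->|kp].
    by case: eps; rewrite ?ut ?vt ?um1 ?vm1 ?dife ?yz.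
  by rewrite (ulow eps k kp).1 (vlow eps k kp).1 (nu_composable_lt H) // ltnW.
have H2 : nu_bd false rn u2 = nu_bd true rn v2.
  apply: whisk_composable hg1 u2w v2w _ => eps k.
  rewrite ltnS leq_eqVlt => /orP[/eqP->|kp].
    by case: eps; rewrite ?us ?vs ?um2 ?vm2 ?dife ?yz.
  by rewrite (ulow eps k kp).2 (vlow eps k kp).2 (nu_composable_lt H) // ltnW.
exists u1, u2, v1, v2, Hu, Hv, H1, H2; split=> //.
- apply: psum_perm (whisk_comp H1 _ hg0 u1w v1w); first by rewrite perm_sym.
  move=> e' h; have [] // := memab e'.
  by move: h; rewrite !mem_cat => /or3P[] ->; rewrite ?orbT.
- apply: psum_perm (whisk_comp H2 _ hg1 u2w v2w); first by rewrite perm_sym.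
  move=> e' h; have [] // := memab e'.
  by move: h; rewrite !mem_cat => /or3P[] ->; rewrite ?orbT.
split.
- apply: whisk_psum u1w _ => e' h; have [] // := memab e'.
  by move: h; rewrite !mem_cat => /orP[/orP[]|] ->; rewrite ?orbT.
- apply: whisk_psum u2w _ => e' h; have [] // := memab e'.
  by move: h; rewrite !mem_cat => /orP[/orP[]|] ->; rewrite ?orbT.
- apply: whisk_psum v1w _ => e' h; have [] // := memab e'.
  by move: h; rewrite !mem_cat => /orP[/orP[]|] ->; rewrite ?orbT.
- apply: whisk_psum v2w _ => e' h; have [] // := memab e'.
  by move: h; rewrite !mem_cat => /orP[/orP[]|] ->; rewrite ?orbT.
Qed.

End CutComp.

(** * Cells of [nu M] are freely generated by the atoms *)

Section InfCatTheory.
Variable D : infcat.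

Lemma icomp_congr j n (jn : (j < n)%N) (x x' y y' : D n) H H' :
  x = x' -> y = y' -> icomp jn x y H = icomp jn x' y' H'.
Proof. by move=> xx' yy'; subst x' y'; congr icomp; exact: Prop_irrelevance. Qed.

Lemma bd_icomp_lt k j n (kn : (k < n)%N) (jn : (j < n)%N) eps (x y : D n) H :
  (k < j)%N -> bd eps kn (icomp jn x y H) = bd eps kn x /\
               bd eps kn (icomp jn x y H) = bd eps kn y.
Proof.
move=> kj; rewrite -!(bd_bd kj jn kn eps true) tgt_comp; split=> //.
by rewrite -H !(bd_bd kj jn kn).
Qed.

Lemma bd_idt_lt k j n (kj : (k < j)%N) (jn : (j < n)%N) (kn : (k < n)%N) eps (x : D j) :
  bd eps kn (idt jn x) = bd eps kj x.
Proof. by rewrite -(bd_bd kj jn kn eps eps) bd_idt. Qed.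

Lemma icompA_ex j n (jn : (j < n)%N) (x y z : D n) Hxy H' :
  exists Hyz H, icomp jn (icomp jn x y Hxy) z H' = icomp jn x (icomp jn y z Hyz) H.
Proof.
have Hyz : bd false jn y = bd true jn z by rewrite -H' src_comp.
have H : bd false jn x = bd true jn (icomp jn y z Hyz) by rewrite tgt_comp.
by exists Hyz, H; exact/esym/icompA.
Qed.

Lemma icompA_ex' j n (jn : (j < n)%N) (x y z : D n) Hyz H :
  exists Hxy H', icomp jn x (icomp jn y z Hyz) H = icomp jn (icomp jn x y Hxy) z H'.
Proof.
have Hxy : bd false jn x = bd true jn y by rewrite H tgt_comp.
have H' : bd false jn (icomp jn x y Hxy) = bd true jn z by rewrite src_comp.
by exists Hxy, H'; exact: icompA.
Qed.

(** Since [k < j], a [k]-boundary of a [j]-composite is that of either factor, so the composability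
    conditions on the right follow from those on the left. *)
Lemma exchange_ex k j n (kj : (k < j)%N) (jn : (j < n)%N) (kn : (k < n)%N)
    (x y z w : D n) Hxy Hzw H :
  exists Hxz Hyw H',
    icomp kn (icomp jn x y Hxy) (icomp jn z w Hzw) H =
    icomp jn (icomp kn x z Hxz) (icomp kn y w Hyw) H'.
Proof.
have [X1 X2] := bd_icomp_lt kn false Hxy kj.
have [Z1 Z2] := bd_icomp_lt kn true Hzw kj.
have Hxz : bd false kn x = bd true kn z by rewrite -X1 H.
have Hyw : bd false kn y = bd true kn w by rewrite -X2 H.
have B1 : bd false kj (bd false jn x) = bd true kj (bd false jn z) by rewrite !bd_bd.
have B2 : bd false kj (bd true jn y) = bd true kj (bd true jn w) by rewrite !bd_bd.
have H' : bd false jn (icomp kn x z Hxz) = bd true jn (icomp kn y w Hyw).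
  rewrite (@bd_comp D k j n kj jn kn false x z Hxz B1).
  by rewrite (@bd_comp D k j n kj jn kn true y w Hyw B2); exact: icomp_congr.
by exists Hxz, Hyw, H'; exact: exchange.
Qed.

Lemma exchange_ex' k j n (kj : (k < j)%N) (jn : (j < n)%N) (kn : (k < n)%N)
    (x y z w : D n) Hxz Hyw H' (Hxy : bd false jn x = bd true jn y)
    (Hzw : bd false jn z = bd true jn w) :
  exists H,
    icomp jn (icomp kn x z Hxz) (icomp kn y w Hyw) H' =
    icomp kn (icomp jn x y Hxy) (icomp jn z w Hzw) H.
Proof.
have [X1 X2] := bd_icomp_lt kn false Hxy kj.
have [Z1 Z2] := bd_icomp_lt kn true Hzw kj.
have H : bd false kn (icomp jn x y Hxy) = bd true kn (icomp jn z w Hzw).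
  by rewrite X1 Hxz Z1.
by exists H; exact/esym/exchange.
Qed.

End InfCatTheory.

(* Given [pr : D -> nu M] and cells [Base] of [D] lying bijectively over the atoms, the
   cells generated by [Base] lie bijectively over all cells of [nu M].  This is Steiner's
   theorem that [nu M] is freely generated by its atoms: taking [D = nu M * C], such
   a section is an oo-functor [nu M -> C] with prescribed values on the atoms. *)
Section Lift.
Variables (M : adc) (D : infcat) (pr : inffun D (nu_ob M)).
Hypotheses (hM : has_basis M) (uM : unitary M) (lfM : strongly_loop_free M).
Variable Base : forall n, D n -> Prop.

Definition ps (P : nat) (E : seq (pt M)) n (x : D n) : Prop :=
  @psum M P E n (pr n x : nu_cell M n).

Lemma pr_composable j n (jn : (j < n)%N) (x y : D n) :
  bd false jn x = bd true jn y -> nu_bd false jn (pr _ x) = nu_bd true jn (pr _ y).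
Proof. by move=> H; rewrite -[LHS](cmap_bd pr) -[RHS](cmap_bd pr) H. Qed.

Lemma pr_icomp j n (jn : (j < n)%N) (x y : D n) H :
  pr n (icomp jn x y H) = nu_comp (pr_composable H).
Proof. exact: cmap_comp. Qed.

Lemma pr_icompE j n (jn : (j < n)%N) (x y : D n) H
    (H' : nu_bd false jn (pr _ x) = nu_bd true jn (pr _ y)) :
  pr n (icomp jn x y H) = nu_comp H'.
Proof. exact: cmap_comp. Qed.

(* [Val P] consists of the composites of base cells in which the operations [*_j] with
   [j < P] occur in order of increasing [j], each composite for [*_j] being a list of
   factors with at most one atom of degree [> j]. *)
Inductive vstep (P n : nat) (R : D n -> Prop) : D n -> Prop :=
| VSmall x E : (size E <= 1)%N -> ps P.+1 E x -> R x -> vstep P R x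
| VCons (Pn : (P < n)%N) e y z H :
    ps P.+1 [:: e] y -> R y -> vstep P R z -> vstep P R (icomp Pn y z H).

Fixpoint Val (P n : nat) : D n -> Prop :=
  match P with
  | 0 => @Base n
  | P'.+1 => vstep P' (@Val P' n)
  end.
Arguments Val P {n} x.

Hypothesis Base_tot : forall n e (u : nu_cell M n), psum 0 [:: e] u ->
  exists x : D n, Base x /\ pr n x = u.
Hypothesis Base_fun : forall n (x x' : D n), Base x -> Base x' -> pr n x = pr n x' -> x = x'.
Hypothesis Base_idt : forall j n (jn : (j < n)%N) (x : D j), Base x -> Base (idt jn x).
(** A boundary of an atom is in general a composite of atoms, hence [Val j] and not [Base]. *)
Hypothesis Base_bd : forall n (x : D n), Base x ->
  forall j (jn : (j < n)%N) eps, Val j (bd eps jn x).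

Lemma ps_comp P E E' p n (pn : (p < n)%N) (y z : D n) H :
  (p < P)%N -> ps P E y -> ps P E' z -> ps P (E ++ E') (icomp pn y z H).
Proof. by move=> pP hy hz; rewrite /ps pr_icomp; exact: psum_comp. Qed.

Lemma ps_idt P E j n (jn : (j < n)%N) (x : D j) : ps P E x -> ps P E (idt jn x).
Proof. by rewrite /ps (cmap_idt pr). Qed.

Lemma ps_idt_nil j n (jn : (j < n)%N) (x : D j) : ps j.+1 [::] (idt jn x).
Proof.
by rewrite /ps (cmap_idt pr); apply: psum_nil => eps k jk; rewrite /= ent_gt.
Qed.

Lemma vstep_psum P n (R : D n -> Prop) x : vstep P R x -> exists E, ps P.+1 E x.
Proof.
elim=> [{}x E _ hx _|Pn e y z H hy _ _ [E hz]]; first by exists E.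
by exists ([:: e] ++ E); exact: ps_comp.
Qed.

Lemma Val_idt P j n (jn : (j < n)%N) (x : D j) : (P <= j)%N -> Val P x -> Val P (idt jn x).
Proof.
elim: P x => [|P IH] x Pj; first exact: Base_idt.
elim=> [{}x E sE hx Rx|Pj' e y z H hy Ry _ Vz].
  by apply: VSmall sE (ps_idt _ hx) _; apply: IH Rx; exact: ltnW.
have Pn := ltn_trans Pj' jn.
have H' : bd false Pn (idt jn y) = bd true Pn (idt jn z).
  by rewrite (bd_idt_lt Pj' jn Pn) (bd_idt_lt Pj' jn Pn).
rewrite (@idt_comp D P j n Pj' jn Pn y z H H').
apply: (VCons (e := e)) => //; first exact: ps_idt.
by apply: IH Ry; exact: ltnW.
Qed.

Definition Val_inj_at (P n : nat) : Prop := forall x x' : D n,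
  Val P x -> Val P x' -> pr n x = pr n x' -> x = x'.

(** A composite of cells of level [P] can fail to be of level [P]: at level 0 two atoms usually
    compose to something that is not an atom. [ps P E] selects the good composites; for [P = n] it
    holds for all. *)
Definition Val_comp_at (P n : nat) : Prop := forall r (rn : (r < n)%N) (y z : D n) H E,
  (r <= P)%N -> Val P y -> Val P z -> ps P E (icomp rn y z H) -> Val P (icomp rn y z H).

Section Level.
Variable n : nat.
Hypothesis IHn : forall j, (j < n)%N -> Val_inj_at j j /\ Val_comp_at j j.

(** For a composite along [P], a boundary of dimension at most [P] is one of a factor; one of higher
    dimension [j] is again a composite, covered by closure in dimension [j < n]. *)
Lemma Val_bd P (x : D n) : (P <= n)%N -> Val P x ->
  forall j (jn : (j < n)%N) eps, Val j (bd eps jn x).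
Proof.
elim: P x => [|P IH] x Pn; first by move=> hx j jn eps; exact: Base_bd.
elim=> [{}x E sE hx Rx|Pn' e y z H hy Ry hz Vz] j jn eps.
  by apply: IH => //; exact: ltnW.
case: (ltngtP j P) => [jP|Pj|E].
- by rewrite (bd_icomp_lt jn eps H jP).2.
- have H' : bd false Pj (bd eps jn y) = bd true Pj (bd eps jn z) by rewrite !bd_bd H.
  rewrite (@bd_comp D P j n Pj jn Pn' eps y z H H').
  have [_ hC] := IHn jn.
  have [E hE] := psum_top hM (pr j (icomp Pj (bd eps jn y) (bd eps jn z) H') : nu_cell M j).
  apply: (hC _ _ _ _ _ E) => //; first exact: ltnW.
  by apply: IH => //; exact: ltnW.
- subst j; rewrite (eq_irrelevance Pn' jn) in H *; case: eps.
    by rewrite tgt_comp; apply: IH => //; exact: ltnW.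
  by rewrite src_comp.
Qed.

(** Boundaries of lifts are lifts in a smaller dimension, where uniqueness is known; composability
    can therefore be tested in [nu M]. *)
Lemma Val_compat P P' r (rn : (r < n)%N) (y z : D n) :
  (P <= n)%N -> (P' <= n)%N -> Val P y -> Val P' z ->
  nu_bd false rn (pr _ y) = nu_bd true rn (pr _ z) -> bd false rn y = bd true rn z.
Proof.
move=> Pn P'n hy hz H; have [F _] := IHn rn.
by apply: F; [exact: Val_bd hy _ _ _ | exact: Val_bd hz _ _ _ | rewrite !(cmap_bd pr)].
Qed.

Lemma Val_tot P E (u : nu_cell M n) : (P <= n)%N -> psum P E u ->
  exists x : D n, Val P x /\ pr n x = u.
Proof.
move=> Pn hu.
have ind := @psum_ind M hM uM lfM n
  (fun P u => (P <= n)%N -> exists x : D n, Val P x /\ pr n x = u).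
apply: (ind _ _ _ P E u Pn hu Pn).
- by move=> e x hx _; exact: Base_tot hx.
- move=> {Pn P E u hu ind} P u E Pn sE hu IH _; have [x [Vx xE]] := IH (ltnW Pn).
  by exists x; split=> //; apply: VSmall sE _ Vx; rewrite /ps xE.
- move=> {Pn P E u hu ind} P Pn e E u v H hu hv IHu IHv _.
  have [y [Vy yE]] := IHu (ltnW Pn); have [z [Vz zE]] := IHv Pn.
  have H' : bd false Pn y = bd true Pn z.
    by apply: (Val_compat (P := P) (P' := P.+1)) => //; [exact: ltnW | rewrite yE zE].
  exists (icomp Pn y z H'); split.
    by apply: (VCons (e := e)) => //; rewrite /ps yE.
  by subst u v; exact: pr_icompE.
Qed.

Lemma idt_cell P (Pn : (P < n)%N) eps (y : D n) : Val_inj_at P n -> Val P y ->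
  (forall eps k, (P < k)%N -> ent (pr n y : nu_cell M n) eps k = 0) ->
  y = idt Pn (bd eps Pn y).
Proof.
move=> F Vy y0; apply: F => //.
  by apply: Val_idt => //; apply: Val_bd Vy _ _ _; exact: ltnW.
by rewrite (cmap_idt pr) (cmap_bd pr); apply/esym/idt_of_zero.
Qed.

Lemma icomp_idl_of j (jn : (j < n)%N) (y z : D n) H :
  y = idt jn (bd true jn z) -> icomp jn y z H = z.
Proof. by move=> E; move: H; rewrite E => H; exact: icomp_idl. Qed.

Lemma icomp_idr_of j (jn : (j < n)%N) (y z : D n) H :
  z = idt jn (bd false jn y) -> icomp jn y z H = y.
Proof. by move=> E; move: H; rewrite E => H; exact: icomp_idr. Qed.

(** One factor vanishes above [r], so it lies over an identity; uniqueness at level [r] makes it an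
    identity in [D], and a unit law removes it. *)
Lemma Comp_small r (rn : (r < n)%N) (y z : D n) H E : Val_inj_at r n ->
  (size E <= 1)%N -> Val r y -> Val r z -> ps r E (icomp rn y z H) -> Val r (icomp rn y z H).
Proof.
move=> F sE Vy Vz; rewrite /ps pr_icomp => hw.
have [y0|z0] := nu_comp_small hM hw sE.
  by rewrite icomp_idl_of // -H; exact: idt_cell.
by rewrite icomp_idr_of // H; exact: idt_cell.
Qed.

Section Step.
Variable P : nat.
Hypothesis Pn : (P < n)%N.
Hypotheses (FP : Val_inj_at P n) (CP : Val_comp_at P n).
Let R := @Val P n.
Let V := vstep P R.

Lemma nil_zero (y : D n) eps k : ps P.+1 [::] y -> (P < k)%N ->
  ent (pr n y : nu_cell M n) eps k = 0.
Proof. by move=> [_ h] Pk; rewrite h // big_nil. Qed.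

Lemma V_bd (x : D n) j (jn : (j < n)%N) eps : V x -> Val j (bd eps jn x).
Proof. by move=> Vx; apply: (@Val_bd P.+1). Qed.

Lemma V_small E x : ps P.+1 E x -> (size E <= 1)%N -> V x -> R x.
Proof.
move=> hx sE Vx; elim: Vx E hx sE => [//|Pn' e y z H hy Ry hz IH] E hx sE.
have [E' hE'] := vstep_psum hz.
have pE := psum_uniq hM hx (ps_comp H (ltnSn P) hy hE').
have E'0 : E' = [::] by have := perm_size pE; rewrite /=; case: E' {hE' pE} => //= a l; lia.
have Rz : R z by apply: IH hE' _; rewrite E'0.
have [E1 hE1] := psum_small_low hM Pn hx sE.
by apply: CP hE1.
Qed.

(** Concatenation of lists of factors. A last entry with one atom becomes a factor in front of [z];
    one with no atom is an identity. *)
Lemma V_comp (y z : D n) H : V y -> V z -> V (icomp Pn y z H).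
Proof.
move=> Vy; elim: Vy z H => [{}y [|e [|//]] _ hy Ry|Pn' e y1 y2 H' hy1 Ry1 hy2 IH] z H Vz.
- rewrite icomp_idl_of // -H; apply: idt_cell => //.
  by move=> eps k; exact: nil_zero.
- exact: (VCons (e := e)).
- move: H' H; rewrite (eq_irrelevance Pn' Pn) => H' H.
  have [H2 [H3 ->]] := icompA_ex H.
  by apply: (VCons (e := e)) => //; exact: IH.
Qed.

(* If [e] can be split off [pr x], then it can be moved to the front of any expression of
   [x]: two consecutive factors [f], [e] whose order is immaterial form a cell [w] that
   is already a sum of atoms in degrees [>= P], so that both orders give the unique
   lift of [w] at level [P]. *)
Lemma V_front x : V x -> forall e E, ps P.+1 (e :: E) x -> tgt_free P e E ->
  exists y z H, [/\ x = icomp Pn y z H, R y, V z, ps P.+1 [:: e] y & ps P.+1 E z].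
Proof.
elim=> [{}x E0 sE0 hx0 Rx|Pn' f y1 z1 H0 hy1 Ry1 Vz1 IH] e E hx free.
  have pE := psum_uniq hM hx0 hx.
  have E0' : E = [::] by have := perm_size pE; move: sE0; case: (E) => //= a l; lia.
  have H : bd false Pn x = bd true Pn (idt Pn (bd false Pn x)) by rewrite bd_idt.
  exists x, (idt Pn (bd false Pn x)), H; split=> //.
  - by rewrite icomp_idr.
  - apply: (@VSmall _ _ _ _ [::]) => //; first exact: ps_idt_nil.
    by apply: Val_idt => //; apply: (Val_bd _ Rx); exact: ltnW.
  - by move: hx; rewrite E0'.
  - by rewrite E0'; exact: ps_idt_nil.
move: H0 hx; rewrite (eq_irrelevance Pn' Pn) => H0 hx {Pn'}.
have [E1 hE1] := vstep_psum Vz1.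
have pE : perm_eq (f :: E1) (e :: E) := psum_uniq hM (ps_comp H0 (ltnSn P) hy1 hE1) hx.
case: (eqVneq f e) => [fe|fe].
  subst f; exists y1, z1, H0; split=> //.
  by move: pE; rewrite perm_cons => pE; exact: psum_perm pE hE1.
have eE1 : e \in E1.
  by have := perm_mem pE e; rewrite !inE eqxx eq_sym (negbTE fe) /= => ->.
set E2 := rem e E1.
have pE1 : perm_eq E1 (e :: E2) by exact: perm_to_rem.
have pE2 : perm_eq (f :: E2) E.
  rewrite -(perm_cons e) perm_sym.
  have : perm_eq (f :: E1) (e :: f :: E2).
    apply: (@perm_trans _ (f :: e :: E2)); first by rewrite perm_cons.
    by apply/permPl; exact: (perm_catCA [:: f] [:: e] E2).
  by apply: perm_trans; rewrite perm_sym.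
have free2 : tgt_free P e E2.
  by move=> a aE2; apply: free; rewrite -(perm_mem pE2) inE aE2 orbT.
have [y2 [z2 [H1 [z1E Ry2 Vz2 hy2 hz2]]]] := IH e E2 (psum_perm pE1 hE1) free2.
subst z1.
have [Hw [H2 xE]] := icompA_ex' H0.
rewrite xE.
have hw : ps P.+1 ([:: f] ++ [:: e]) (icomp Pn y1 y2 Hw) by exact: ps_comp.
have [Bf Pf] := hw.1 f (mem_head _ _).
have [Be Pe] := hw.1 e (mem_last f [:: e]).
have fe_free g : coef (pent f false P) g = 0 \/ coef (pent e true P) g = 0.
  by apply: free; rewrite -(perm_mem pE2) mem_head.
(* No cancellation occurs between [f] and [e] in degree [P]: where the source of [f] vanishes,
   positivity for [y2] suffices, and where the target of [e] vanishes, positivity for [y1] does. *)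
have [Ew hEw] : exists Ew, ps P Ew (icomp Pn y1 y2 Hw).
  suff pos : kpos M (ent (pr n (icomp Pn y1 y2 Hw) : nu_cell M n) true P -
      \sum_(a <- [:: f] ++ [:: e]) pent a true P).
    by have [E' hE' _] := psum_low hM Pn hw pos; exists ([:: f; e] ++ E').
  have py1 := psum_small_pos hM Pn hy1 isT; have py2 := psum_small_pos hM Pn hy2 isT.
  move: py1 py2; rewrite !big_seq1 big_cat !big_seq1 /= => py1 py2.
  have mid := nu_composable_eq (pr_composable Hw).
  have dy1 := psum_dif hM hy1 Pn; rewrite big_seq1 in dy1.
  rewrite pr_icomp /= /nu_comp_ent leqnn; apply/(kposE hM) => g.
  have := proj1 (kposE hM _) py1 g; have := proj1 (kposE hM _) py2 g.
  rewrite -mid; have := congr1 (fun u => coef u g) dy1; rewrite /= !coefB ?coefD //.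
  have := pent_ge0 hM false g Bf; have := fe_free g; lia.
have hw' : ps P.+1 [:: e; f] (icomp Pn y1 y2 Hw).
  by apply: psum_perm hw; apply/permPl; exact: (perm_catC [:: f] [:: e]).
have [|u [v [Huv [wE hu hv]]]] := psum_split hM Pn hw'.
  by move=> a; rewrite inE => /eqP -> g; exact: fe_free.
have [Eu hEu] := psum_small_low hM Pn hu isT; have [Ev hEv] := psum_small_low hM Pn hv isT.
have [y' [Vy' y'E]] := Val_tot (ltnW Pn) hEu; have [v' [Vv' v'E]] := Val_tot (ltnW Pn) hEv.
have H' : bd false Pn y' = bd true Pn v'.
  by apply: Val_compat Vy' Vv' _; rewrite ?y'E ?v'E // ltnW.
have prE : pr n (icomp Pn y1 y2 Hw) = pr n (icomp Pn y' v' H').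
  by rewrite wE; subst u v; rewrite (pr_icompE _ Huv).
have E12 : icomp Pn y1 y2 Hw = icomp Pn y' v' H'.
  apply: FP => //; first by apply: CP hEw.
  by apply: (CP (E := Ew)) => //; rewrite /ps -prE.
move: H2 xE; rewrite E12 => H2 _.
have [H3 [H4 ->]] := icompA_ex H2.
exists y', (icomp Pn v' z2 H3), H4; split=> //.
- by apply: (VCons (e := f)) => //; rewrite /ps v'E.
- by rewrite /ps y'E.
- apply: psum_perm pE2 _; apply: (@ps_comp _ [:: f]) => //; by rewrite /ps v'E.
Qed.

(** The same atom is moved to the front of both cells. Its entries above [P] are known, so
    [nu_comp_inj] cancels it in [nu M], and induction on the number of atoms compares the tails. *)
Lemma Fun_step : Val_inj_at P.+1 n.
Proof.
move=> x x' Vx Vx' xx'; have [E hx] := vstep_psum Vx.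
move: {2}(size E) (erefl (size E)) => N; elim: N E x x' Vx Vx' xx' hx => [|N IH] E x x' Vx Vx' xx' hx sE.
  by apply: FP => //; apply: (V_small (E := E)); rewrite ?sE // /ps -xx'.
have hx' : ps P.+1 E x' by rewrite /ps -xx'.
have ne : E != [::] by case: E sE {hx hx'}.
have [e [E' [EE' free]]] := exists_tgt_free hM lfM ne hx.1.
have [y [z [H [xE Ry Vz hy hz]]]] := V_front Vx (psum_perm EE' hx) free.
have [y' [z' [H' [x'E Ry' Vz' hy' hz']]]] := V_front Vx' (psum_perm EE' hx') free.
subst x x'; move: xx'; rewrite !pr_icomp => /nu_comp_inj[].
  by move=> eps k Pk; rewrite hy.2 // hy'.2.
move=> yy' zz'; apply: icomp_congr; first exact: FP.
by apply: (IH E') => //; have := perm_size EE'; rewrite sE => -[].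
Qed.

Lemma R_idt (x : D P) : Val P x -> R (idt Pn x).
Proof. exact: Val_idt. Qed.

Lemma nil_idt eps (z : D n) : R z -> ps P.+1 [::] z -> z = idt Pn (bd eps Pn z).
Proof. by move=> Rz hz; apply: idt_cell => // eps' k; exact: nil_zero. Qed.

(** [z] is an identity on a [P]-cell, so [z = z *_P z], and exchange distributes the whiskering over
    the factors of [y]. *)
Lemma V_whiskr r (rn : (r < n)%N) (y z : D n) H : (r < P)%N ->
  V y -> R z -> ps P.+1 [::] z -> V (icomp rn y z H).
Proof.
move=> rP Vy Rz hz; elim: Vy H => [{}y E sE hy Ry|Pn' e y1 y2 H' hy1 Ry1 hy2 IH] H.
  have hw : ps P.+1 (E ++ [::]) (icomp rn y z H) by apply: ps_comp => //; exact: leqW.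
  rewrite cats0 in hw; have [E1 hE1] := psum_small_low hM Pn hw sE.
  by apply: VSmall sE hw _; apply: CP hE1 => //; exact: ltnW.
move: H' H; rewrite (eq_irrelevance Pn' Pn) => H' H.
have Hzz : bd false Pn z = bd true Pn z.
  by rewrite (nil_idt true Rz hz) !bd_idt.
have zz : icomp Pn z z Hzz = z by rewrite icomp_idl_of //; exact: nil_idt.
have Hq : bd false rn (icomp Pn y1 y2 H') = bd true rn (icomp Pn z z Hzz) by rewrite zz.
have [H1 [H2 [H3 E]]] := exchange_ex rP Hq.
have -> : icomp rn (icomp Pn y1 y2 H') z H = icomp rn _ _ Hq by exact: icomp_congr.
rewrite E; have hw : ps P.+1 ([:: e] ++ [::]) (icomp rn y1 z H1) by apply: ps_comp => //; exact: leqW.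
have [E1 hE1] := psum_small_low hM Pn hw isT.
by apply: (VCons (e := e)); [exact: hw | apply: CP hE1 => //; exact: ltnW | exact: IH].
Qed.

Lemma V_whiskl r (rn : (r < n)%N) (y z : D n) H : (r < P)%N ->
  R y -> ps P.+1 [::] y -> V z -> V (icomp rn y z H).
Proof.
move=> rP Ry hy Vz; elim: Vz H => [{}z E sE hz Rz|Pn' e z1 z2 H' hz1 Rz1 hz2 IH] H.
  have hw : ps P.+1 ([::] ++ E) (icomp rn y z H) by apply: ps_comp => //; exact: leqW.
  have [E1 hE1] := psum_small_low hM Pn hw sE.
  by apply: VSmall sE hw _; apply: CP hE1 => //; exact: ltnW.
move: H' H; rewrite (eq_irrelevance Pn' Pn) => H' H.
have Hyy : bd false Pn y = bd true Pn y.
  by rewrite (nil_idt true Ry hy) !bd_idt.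
have yy : icomp Pn y y Hyy = y by rewrite icomp_idl_of //; exact: nil_idt.
have Hq : bd false rn (icomp Pn y y Hyy) = bd true rn (icomp Pn z1 z2 H') by rewrite yy.
have [H1 [H2 [H3 E]]] := exchange_ex rP Hq.
have -> : icomp rn y (icomp Pn z1 z2 H') H = icomp rn _ _ Hq by exact: icomp_congr.
rewrite E; have hw : ps P.+1 ([::] ++ [:: e]) (icomp rn y z1 H1) by apply: ps_comp => //; exact: leqW.
have [E1 hE1] := psum_small_low hM Pn hw isT.
by apply: (VCons (e := e)); [exact: hw | apply: CP hE1 => //; exact: ltnW | exact: IH].
Qed.

(** As in the Eckmann-Hilton argument, [y] is written as [y *_P 1] and [z] as [1 *_P z]; exchange
    turns their composite into a [P]-composite of two whiskerings. *)
Lemma V_comp_lt r (rn : (r < n)%N) (y z : D n) H : (r < P)%N ->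
  V y -> V z -> V (icomp rn y z H).
Proof.
move=> rP Vy Vz.
have Hy : bd false Pn y = bd true Pn (idt Pn (bd false Pn y)) by rewrite bd_idt.
have Hz : bd false Pn (idt Pn (bd true Pn z)) = bd true Pn z by rewrite bd_idt.
have yE : icomp Pn _ _ Hy = y by exact: icomp_idr.
have zE : icomp Pn _ _ Hz = z by exact: icomp_idl.
have Hq : bd false rn (icomp Pn _ _ Hy) = bd true rn (icomp Pn _ _ Hz) by rewrite yE zE.
have [H1 [H2 [H3 E]]] := exchange_ex rP Hq.
have -> : icomp rn y z H = icomp rn _ _ Hq by exact: icomp_congr.
rewrite E; apply: V_comp.
  by apply: V_whiskr => //; [apply: R_idt; exact: V_bd | exact: ps_idt_nil].
by apply: V_whiskl => //; [apply: R_idt; exact: V_bd | exact: ps_idt_nil].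
Qed.

(* Split one atom off [y *_(P+1) z] at level [P], hence off [y] and [z], and exchange. *)
Lemma V_comp_succ (rn : (P.+1 < n)%N) (y z : D n) H E :
  V y -> V z -> ps P.+1 E (icomp rn y z H) -> V (icomp rn y z H).
Proof.
move=> Vy Vz hw; move: {2}(size E) (leqnn (size E)) => N.
elim: N E y z H Vy Vz hw => [|N IH] E y z H Vy Vz hw sE.
  by apply: (Comp_small (r := P.+1) Fun_step _ Vy Vz hw); lia.
case: (leqP (size E) 1) => [sE1|sE1].
  exact: (Comp_small (r := P.+1) Fun_step sE1 Vy Vz hw).
have ne : E != [::] by case: E sE1 {hw sE}.
have [e [E' [EE' free]]] := exists_tgt_free hM lfM ne hw.1.
have sE' := perm_size EE'.
have hw' := psum_perm EE' hw.
(* Splitting the composite itself exhibits the intermediate [P]-cell as the source of [u], which is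
   positive. *)
have mid : kpos M (ent (pr n (icomp rn y z H) : nu_cell M n) true P - dif M (pent e true P.+1)).
  have [u [v [Huv [wE hu hv]]]] := psum_split hM Pn hw' free.
  have := ent_pos u false P.
  rewrite -[ent u false P](subKr (ent u true P)) -(ent_dif u true) // (hu.2 true P.+1 (leqnn _)) big_seq1.
  by rewrite wE /= /nu_comp_ent leqnn.
have [Ey hy] := vstep_psum Vy; have [Ez hz] := vstep_psum Vz.
rewrite /ps pr_icomp in hw' mid.
have [u1 [u2 [v1 [v2 [Hu [Hv [H1 [H2 [yE zE h1 h2 [[e1 g1] [e2 g2] [e3 g3] [e4 g4]]]]]]]]]]] :=
  nu_comp_cut hM hy hz hw' mid.
have [y1 [Vy1 y1E]] := Val_tot Pn g1; have [y2 [Vy2 y2E]] := Val_tot Pn g2.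
have [z1 [Vz1 z1E]] := Val_tot Pn g3; have [z2 [Vz2 z2E]] := Val_tot Pn g4.
rewrite (Prop_irrelevance (ltnW rn) Pn) in Hu Hv yE zE.
have compat p (pn : (p < n)%N) (a b : D n) : V a -> V b ->
    nu_bd false pn (pr _ a) = nu_bd true pn (pr _ b) -> bd false pn a = bd true pn b.
  by move=> Va Vb; apply: (@Val_compat P.+1 P.+1).
subst u1 u2 v1 v2.
have Ky := compat _ _ _ _ Vy1 Vy2 Hu; have Kz := compat _ _ _ _ Vz1 Vz2 Hv.
have K1 := compat _ _ _ _ Vy1 Vz1 H1; have K2 := compat _ _ _ _ Vy2 Vz2 H2.
(* The pieces were cut in [nu M] and lifted separately; uniqueness at level [P+1] identifies [y]
   with the composite of its lifted pieces. *)
have yy : y = icomp Pn y1 y2 Ky.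
  by apply: Fun_step => //; [exact: V_comp | rewrite yE (pr_icompE _ Hu)].
have zz : z = icomp Pn z1 z2 Kz.
  by apply: Fun_step => //; [exact: V_comp | rewrite zE (pr_icompE _ Hv)].
subst y z.
have [K3 ->] := exchange_ex' (ltnSn P) H K1 K2.
apply: V_comp.
  apply: (IH [:: e]) => //; first by rewrite /ps (pr_icompE _ H1).
  exact: (leq_trans sE1 sE).
apply: (IH E') => //; first by rewrite /ps (pr_icompE _ H2).
by move: sE sE' => /=; lia.
Qed.

Lemma Comp_step : Val_comp_at P.+1 n.
Proof.
move=> r rn y z H E; rewrite leq_eqVlt => /orP[/eqP rE|rP] Vy Vz hw.
  by subst r; exact: V_comp_succ hw.
move: rP; rewrite ltnS leq_eqVlt => /orP[/eqP rE|rP].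
  by subst r; move: H hw; rewrite (eq_irrelevance rn Pn) => H _; exact: V_comp.
exact: V_comp_lt.
Qed.

End Step.

Lemma Fun_Comp_level P : (P <= n)%N -> Val_inj_at P n /\ Val_comp_at P n.
Proof.
elim: P => [|P IH] Pn; last first.
  by have [F C] := IH (ltnW Pn); split; [exact: Fun_step | exact: Comp_step].
have F0 : Val_inj_at 0 n by move=> x x'; exact: Base_fun.
split=> // r rn y z H E; rewrite leqn0 => /eqP r0; subst r => Vy Vz hw.
by apply: (Comp_small F0 _ Vy Vz hw); rewrite (psum0_size uM hw).
Qed.

End Level.

(** Outer induction on the dimension; [Fun_Comp_level] is the inner induction on the level and meets
    smaller dimensions through boundaries. *)
Lemma Fun_Comp n : forall j, (j < n)%N -> Val_inj_at j j /\ Val_comp_at j j.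
Proof.
elim: n => // n IH j; rewrite ltnS leq_eqVlt => /orP[/eqP->|]; last exact: IH.
exact: Fun_Comp_level.
Qed.

Theorem lift_ex n (u : nu_cell M n) : exists x : D n, Val n x /\ pr n x = u.
Proof. by have [E hE] := psum_top hM u; exact: (Val_tot (@Fun_Comp n) (leqnn n) hE). Qed.

Theorem lift_uniq n (x x' : D n) : Val n x -> Val n x' -> pr n x = pr n x' -> x = x'.
Proof. exact: (Fun_Comp (ltnSn n)).1. Qed.

Theorem lift_comp j n (jn : (j < n)%N) (y z : D n) H :
  Val n y -> Val n z -> Val n (icomp jn y z H).
Proof.
move=> Vy Vz; have [_ C] := Fun_Comp (ltnSn n).
have [E hE] := psum_top hM (pr n (icomp jn y z H) : nu_cell M n).
by apply: (C j jn y z H E) => //; exact: ltnW.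
Qed.

Theorem lift_bd j n (jn : (j < n)%N) eps (x : D n) : Val n x -> Val j (bd eps jn x).
Proof. by move=> Vx; exact: (Val_bd (@Fun_Comp n) (leqnn n) Vx). Qed.

Lemma lift_ind n (Q : D n -> Prop) :
  (forall x, Base x -> Q x) ->
  (forall j (jn : (j < n)%N) y z H, Q y -> Q z -> Q (icomp jn y z H)) ->
  forall P x, Val P x -> Q x.
Proof.
move=> Q0 Q1; elim=> [|P IH] x; first exact: Q0.
elim=> [{}x E _ _ /IH //|Pn e y z H _ /IH Qy _ Qz]; exact: Q1.
Qed.

End Lift.

(** * Products of oo-categories *)

Section ProdInfCat.
Variables A B : infcat.

Let pcell (n : nat) : Type := (A n * B n)%type.
Let pbd (eps : bool) (j i : nat) (ji : (j < i)%N) (x : pcell i) : pcell j :=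
  (bd eps ji x.1, bd eps ji x.2).
Let pidt (j i : nat) (ji : (j < i)%N) (x : pcell j) : pcell i :=
  (idt ji x.1, idt ji x.2).
Let picomp (j i : nat) (ji : (j < i)%N) (x y : pcell i)
    (H : pbd false ji x = pbd true ji y) : pcell i :=
  (icomp ji x.1 y.1 (congr1 fst H), icomp ji x.2 y.2 (congr1 snd H)).

Definition prod_infcat : infcat.
Proof.
refine (@InfCat pcell pbd pidt picomp _ _ _ _ _ _ _ _ _ _ _).
- by move=> *; rewrite /pbd /= !bd_bd.
- by move=> k j i kj ji ki x; rewrite /pidt /= !(idt_idt kj ji ki).
- by move=> j i ji eps [x y]; rewrite /pbd /pidt /= !bd_idt.
- by move=> *; rewrite /pbd /picomp /= !src_comp.
- by move=> *; rewrite /pbd /picomp /= !tgt_comp.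
- move=> k j i kj ji ki eps x y H H'; rewrite /pbd /picomp /=.
  by congr pair; exact: bd_comp.
- move=> j i ji [x1 x2] H; rewrite /pidt /pbd /picomp /=.
  by congr pair; exact: icomp_idr.
- move=> j i ji [x1 x2] H; rewrite /pidt /pbd /picomp /=.
  by congr pair; exact: icomp_idl.
- by move=> j i ji x y z Hxy Hyz H H'; congr pair; exact: icompA.
- by move=> k j i kj ji ki x y H H'; congr pair; exact: idt_comp.
- by move=> k j i kj ji ki x y z w Hxy Hzw H Hxz Hyw H'; congr pair; exact: exchange.
Defined.

Definition prod_fst : inffun prod_infcat A.
Proof.
refine (@InfFun prod_infcat A (fun _ x => x.1) _ _ _) => //.
by move=> j i ji x y H H'; exact: icomp_congr.
Defined.

End ProdInfCat.

(** * Colimits and comparison morphisms *)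

Section CategoryTheory.

Definition map_cocone (I C D : category) (G : functor C D) (F : functor I C)
  (c : cocone F) : cocone (functor_comp G F).
Proof.
refine (@Cocone I D (functor_comp G F) (G (apex c)) (fun i => fmor G (leg c i)) _).
by move=> i j u; rewrite -(legE c u) fmorM.
Defined.

Lemma colimit_iso (I C : category) (F : functor I C) (c c' : cocone F) :
  is_colimit c -> is_colimit c' ->
  forall h : hom (apex c) (apex c'), (forall i, cmp h (leg c i) = leg c' i) -> is_iso h.
Proof.
move=> hc hc' h hE; have [k [kE _]] := hc' c.
exists k; split.
- have [m [_ mU]] := hc c; rewrite -(mU (idm _)); last by move=> i; rewrite cmp1m.
  by apply/esym/mU => i; rewrite -cmpA hE kE.
- have [m [_ mU]] := hc' c'; rewrite -(mU (idm _)); last by move=> i; rewrite cmp1m.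
  by apply/esym/mU => i; rewrite -cmpA kE hE.
Qed.

Lemma is_iso_cmp (C : category) (x y z : C) (g : hom y z) (f : hom x y) :
  is_iso g -> is_iso f -> is_iso (cmp g f).
Proof.
move=> [g' [g1 g2]] [f' [f1 f2]]; exists (cmp f' g'); split.
- by rewrite cmpA -(cmpA f' g' g) g1 cmpm1.
- by rewrite cmpA -(cmpA g f f') f2 cmpm1.
Qed.

Lemma fmor_iso (C D : category) (G : functor C D) (x y : C) (f : hom x y) :
  is_iso f -> is_iso (fmor G f).
Proof.
by move=> [g [g1 g2]]; exists (fmor G g); rewrite -!fmorM g1 g2 !fmor1.
Qed.

(** The definition ranges over all colimiting cocones, but these differ by isomorphisms: the
    comparison is [fmor G m] after [k], and both are isomorphisms. *)
Lemma commutes_with_colimit_of (I C D : category) (G : functor C D) (F : functor I C)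
    (c0 : cocone F) :
  is_colimit c0 -> is_colimit (map_cocone G c0) -> commutes_with_colimit G F.
Proof.
move=> hc0 hGc0; split; first by exists (map_cocone G c0).
move=> c hc c' hc' h hE.
have [k [kE _]] := hc' (map_cocone G c0).
have [m [mE _]] := hc0 c.
have -> : h = cmp (fmor G m) k.
  have [q [_ qU]] := hc' (map_cocone G c); rewrite -(qU h) //.
  apply: qU => i; rewrite -cmpA kE /=.
  by rewrite -(fmorM G) mE.
by apply: is_iso_cmp; [apply: fmor_iso; exact: colimit_iso mE | exact: colimit_iso kE].
Qed.

End CategoryTheory.

Section PsumMap.

Definition fpt (K L : adc) (f : adcmor K L) (e : pt K) : pt L := mkpt (f _ (projT2 e)).

(** Evaluating [dirac_fam] in degree [n] reads [b] off the dependent pair, so no transport along an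
    equality of degrees appears. *)
Lemma mkpt_inj (K : adc) n (b b' : K n) : mkpt b = mkpt b' -> b = b'.
Proof.
by move=> /(congr1 (fun e : pt K => dirac_fam (projT2 e) n)) /=; rewrite !dirac_fam_diag.
Qed.

Lemma psum_map (K L : adc) (f : adcmor K L) P E n (x : nu_cell K n) :
  rigid f -> psum P E x -> psum P [seq fpt f e | e <- E] (nu_map f x).
Proof.
move=> rf [h1 h2]; have [hK hL fB _] := rf; split.
  by move=> e /mapP[a aE ->]; have [Ba Pa] := h1 _ aE; split=> //; exact: fB.
move=> eps k Pk /=; rewrite h2 // big_map raddf_sum /=.
rewrite big_seq [RHS]big_seq; apply: eq_bigr => a /h1[Ba _].
exact: (proj2 (rigidE hK hL fB) rf).
Qed.

Lemma psum0_inj (K : adc) E n (x x' : nu_cell K n) : psum 0 E x -> psum 0 E x' -> x = x'.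
Proof.
by move=> [_ h] [_ h']; apply: nu_cell_ext => eps k; rewrite h ?h'.
Qed.

Variable K : adc.
Hypotheses (hK : has_basis K) (uK : unitary K).

Lemma atom_cell m (b : K m) n : basis K m b -> (m <= n)%N ->
  exists x : nu_cell K n, psum 0 [:: mkpt b] x.
Proof.
move=> Bb mn; unshelve eexists (@NuCell K n (atom_ent b) _ _ _ _ _).
- by move=> eps k nk; rewrite atom_ent_gt // (leq_ltn_trans mn).
- by move=> eps k; apply: atom_ent_kpos => //; exact: kpos_basis.
- exact: (@pent_top_eps K (mkpt b)).
- by move=> eps k _; exact: (@pent_difT K hK (mkpt b)).
- exact: (proj1 (unitaryE K) uK _ _ Bb).
- split=> [e|eps k _]; first by rewrite inE => /eqP ->.
  by rewrite big_seq1.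
Qed.

End PsumMap.

(** * [nu] and colimits of rigid diagrams *)

Section NuColimit.
Variables (I : category) (F : functor I Cda) (c : cocone F).
Hypothesis hF : forall i, strong_steiner (F i).
Hypothesis rF : forall (i j : I) (u : hom i j), rigid (fmor F u).
Hypothesis hc : strong_steiner (apex c).
Hypothesis rc : forall i, rigid (leg c i).

Definition dpt (n : nat) : Type := {i : I & (F i : adc) n}.
Definition mkdpt n (i : I) (b : (F i : adc) n) : dpt n := existT _ i b.

Inductive glue (n : nat) : dpt n -> dpt n -> Prop :=
| Glue (i j : I) (u : hom i j) (b : (F i : adc) n) :
    basis (F i) n b -> glue (mkdpt b) (mkdpt ((fmor F u : adcmor _ _) n b)).

Definition glued n := clos_refl_sym_trans (dpt n) (@glue n).

(** With [leg_glued], this says that the basis of the apex is the union of the bases modulo the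
    glueing generated by the diagram; the two take the place of the universal property of [c]. *)
Hypothesis surj : forall n (b : (apex c : adc) n), basis (apex c) n b ->
  exists (i : I) (b' : (F i : adc) n), basis (F i) n b' /\ b = (leg c i : adcmor _ _) n b'.
Hypothesis leg_glued : forall n (i j : I) (b : (F i : adc) n) (b' : (F j : adc) n),
  basis (F i) n b -> basis (F j) n b' ->
  (leg c i : adcmor _ _) n b = (leg c j : adcmor _ _) n b' -> glued (mkdpt b) (mkdpt b').

Variable c' : cocone (functor_comp nu F).
Let C : infcat := apex c'.
Let M : adc := apex c.
Let lg i : adcmor (F i) M := leg c i.
Let phi i : inffun (nu_ob (F i)) C := leg c' i.
Let D := prod_infcat (nu_ob M) C.

Let hM : has_basis M. Proof. by have [] := hc. Qed.
Let uM : unitary M. Proof. by have [] := hc. Qed.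
Let lfM : strongly_loop_free M. Proof. by have [] := hc. Qed.

Definition leg_pair i n (y : nu_cell (F i) n) : D n := (nu_map (lg i) y, phi i n y).

(** The graph of the desired oo-functor over the atoms. [e] may have degree below [n], so iterated
    identities of atoms are included. *)
Definition Base n (x : D n) : Prop :=
  exists i (y : nu_cell (F i) n) e, psum 0 [:: e] y /\ x = leg_pair y.

Let pr : inffun D (nu_ob M) := prod_fst (nu_ob M) C.
Let Val_ := Val pr Base.

Lemma leg_pair_bd i n j (jn : (j < n)%N) eps (y : nu_cell (F i) n) :
  bd eps jn (leg_pair y) = leg_pair (nu_bd eps jn y).
Proof.
exact: (esym (f_equal2 pair (cmap_bd (nu_mor (lg i)) jn eps y) (cmap_bd (phi i) jn eps y))).
Qed.

Lemma leg_pair_idt i n j (jn : (j < n)%N) (y : nu_cell (F i) j) :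
  idt jn (leg_pair y) = leg_pair (nu_idt jn y).
Proof.
exact: (esym (f_equal2 pair (cmap_idt (nu_mor (lg i)) jn y) (cmap_idt (phi i) jn y))).
Qed.

Lemma leg_pair_comp i n j (jn : (j < n)%N) (y z : nu_cell (F i) n)
    (H : nu_bd false jn y = nu_bd true jn z) :
  exists H', leg_pair (nu_comp H) = icomp jn (leg_pair y) (leg_pair z) H'.
Proof.
have H' : bd false jn (leg_pair y) = bd true jn (leg_pair z).
  by rewrite !leg_pair_bd H.
exists H'; apply: (f_equal2 pair).
  exact: (cmap_comp (i0 := nu_mor (lg i)) H (congr1 fst H')).
exact: (cmap_comp (i0 := phi i) H (congr1 snd H')).
Qed.

(** Rigid legs carry atoms to atoms, so a decomposition of [y] inside [nu (F i)] maps to one in [D].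
    This puts the graph of every leg among the lifts. *)
Lemma leg_pair_Val i n P E (y : nu_cell (F i) n) : (P <= n)%N -> psum P E y ->
  Val_ P (leg_pair y).
Proof.
have [hFi uFi lFi] := hF i; move=> Pn hy.
apply: (@psum_ind _ hFi uFi lFi n (fun P y => Val_ P (leg_pair y)) _ _ _ P E y Pn hy).
- by move=> e x hx; exists i, x, e.
- move=> {Pn E y hy} {}P y E Pn sE hy Vy; apply: (@VSmall _ _ _ _ _ _ _ [seq fpt (lg i) e | e <- E]) => //.
    by rewrite size_map.
  exact: (psum_map (rc i) hy).
- move=> {Pn E y hy} {}P Pn e E y z H hy hz Vy Vz.
  have [H' ->] := leg_pair_comp H.
  apply: (VCons (e := fpt (lg i) e)) => //; exact: (psum_map (rc i) hy).
Qed.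

Lemma glued_basis n (t t' : dpt n) : glued t t' ->
  basis (F (projT1 t)) n (projT2 t) <-> basis (F (projT1 t')) n (projT2 t').
Proof.
elim=> [x y [i j u b Bb]|x|x y _ ->|x y z _ -> _ ->] //; split=> // _ /=.
by have [_ _ fB _] := rF u; exact: fB.
Qed.

(** Each elementary glueing is a transition map, along which the legs of [c'] agree. *)
Lemma glued_phi n (t t' : dpt n) : glued t t' ->
  forall N (y : nu_cell (F (projT1 t)) N) (y' : nu_cell (F (projT1 t')) N),
    psum 0 [:: mkpt (projT2 t)] y -> psum 0 [:: mkpt (projT2 t')] y' ->
    phi _ N y = phi _ N y'.
Proof.
elim=> [x y [i j u b Bb]|x|x y _ IH|x y z gxy IH1 gyz IH2] N w w' /= hw hw'.
- have -> : w' = nu_map (fmor F u) w by exact: psum0_inj hw' (psum_map (rF u) hw).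
  have E : inffun_cmp (phi j) (nu_mor (fmor F u)) = phi i := legE c' u.
  by rewrite -E.
- by rewrite (psum0_inj hw hw').
- by rewrite (IH N w' w).
have [hFx _ _] := hF (projT1 x); have [hFy uFy _] := hF (projT1 y).
have nN := psum_dim_le hFx hw (mem_head _ _).
have By : basis (F (projT1 y)) n (projT2 y).
  by apply: (proj1 (glued_basis gxy)); have [] := hw.1 _ (mem_head _ _).
(* A chain of glueings passes through basis elements of other objects; their atoms are realised as
   [N]-cells so that both induction hypotheses apply. *)
have [w1 hw1] := atom_cell hFy uFy By nN.
by rewrite (IH1 N w w1) // (IH2 N w1 w').
Qed.

Lemma Base_tot n e (u : nu_cell M n) : psum 0 [:: e] u ->
  exists x : D n, Base x /\ pr n x = u.
Proof.
case: e => m b hu; have mn := psum_dim_le hM hu (mem_head _ _).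
have [Bb _] := hu.1 _ (mem_head _ _).
have [i [b' [Bb' bE]]] := surj Bb; have [hFi uFi _] := hF i.
have [y hy] := atom_cell hFi uFi Bb' mn.
exists (leg_pair y); split; first by exists i, y, (mkpt b').
apply: psum0_inj hu => /=; rewrite /= in bE; rewrite bE.
exact: (psum_map (rc i) hy).
Qed.

Lemma Base_fun n (x x' : D n) : Base x -> Base x' -> pr n x = pr n x' -> x = x'.
Proof.
move=> [i [y [e [hy ->]]]] [j [y' [e' [hy' ->]]]] /= E.
suff : phi i n y = phi j n y' by rewrite /leg_pair E => ->.
have h1 : psum 0 [:: fpt (lg i) e] (nu_map (lg i) y) := psum_map (rc i) hy.
have h2 : psum 0 [:: fpt (lg j) e'] (nu_map (lg i) y) by rewrite E; exact: (psum_map (rc j) hy').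
have ee : fpt (lg i) e = fpt (lg j) e'.
  by have := perm_mem (psum_uniq hM h1 h2) (fpt (lg i) e); rewrite !inE eqxx => /esym/eqP.
move: hy hy' ee; case: e e' {h1 h2} => [m b] [m' b'] /= hy hy' ee.
have mm : m = m' by exact: (congr1 (@dim M) ee).
subst m'; have bb : (lg i) m b = (lg j) m b' := mkpt_inj ee.
have [Bb _] := hy.1 _ (mem_head _ _); have [Bb' _] := hy'.1 _ (mem_head _ _).
exact: (glued_phi (leg_glued Bb Bb' bb) hy hy').
Qed.

Lemma Base_idt j n (jn : (j < n)%N) (x : D j) : Base x -> Base (idt jn x).
Proof.
by move=> [i [y [e [hy ->]]]]; exists i, (nu_idt jn y), e; split=> //; exact: leg_pair_idt.
Qed.

Lemma Base_bd n (x : D n) : Base x -> forall j (jn : (j < n)%N) eps, Val_ j (bd eps jn x).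
Proof.
move=> [i [y [e [hy ->]]]] j jn eps; rewrite leg_pair_bd.
have [hFi _ _] := hF i; have [E hE] := psum_top hFi (nu_bd eps jn y).
exact: (leg_pair_Val (leqnn j) hE).
Qed.

(** The identity has no atoms above degree [j], so each step from level [j] to level [n] is the case
    of [vstep] with an empty list. *)
Lemma Val_idt_top j n (jn : (j < n)%N) (x : D j) : Val_ j x -> Val_ n (idt jn x).
Proof.
move=> Vx; have up d : Val_ (j + d)%N (idt jn x).
  elim: d => [|d IH]; first by rewrite addn0; apply: (Val_idt Base_idt) => //.
  rewrite addnS; apply: (@VSmall _ _ _ _ _ _ _ [::]) => //.
  by apply: psum_nil => eps k jk; rewrite /= ent_gt //; lia.
by have := up (n - j)%N; rewrite subnKC // ltnW.
Qed.

Let lift_sig n (u : nu_cell M n) : {x : D n | Val_ n x /\ pr n x = u}.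
Proof.
by apply: cid; exact: (lift_ex hM uM lfM Base_tot Base_fun Base_idt Base_bd).
Qed.

Let sec n (u : nu_cell M n) : D n := sval (lift_sig u).

Lemma sec_Val n (u : nu_cell M n) : Val_ n (sec u).
Proof. by rewrite /sec; case: (lift_sig u) => x []. Qed.

Lemma secK n (u : nu_cell M n) : (sec u).1 = u.
Proof. by rewrite /sec; case: (lift_sig u) => x []. Qed.

Lemma sec_uniq n (x : D n) : Val_ n x -> sec x.1 = x.
Proof.
move=> Vx; apply: (lift_uniq hM uM lfM Base_tot Base_fun Base_idt Base_bd) => //.
  exact: sec_Val.
exact: secK.
Qed.

(** The second component of the section of [pr] through [Val_]. Lifts are closed under boundaries,
    identities and composites, so their uniqueness gives compatibility with each operation. *)
Definition nu_fact : inffun (nu_ob M) C.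
Proof.
refine (@InfFun (nu_ob M) C (fun n u => (sec u).2) _ _ _).
- move=> j n jn eps u.
  have V := lift_bd hM uM lfM Base_tot Base_fun Base_idt Base_bd jn eps (sec_Val u).
  by have := sec_uniq V; rewrite /= secK => ->.
- move=> j n jn u; have V := Val_idt_top jn (sec_Val u).
  by have := sec_uniq V; rewrite /= secK => ->.
- move=> j n jn u v H H'.
  have Hs : bd false jn (sec u) = bd true jn (sec v).
    by rewrite /= /prod_infcat /= !secK H' [X in (X, _)]H.
  have V := lift_comp hM uM lfM Base_tot Base_fun Base_idt Base_bd Hs (sec_Val u) (sec_Val v).
  have := sec_uniq V => /(congr1 snd) /=.
  have -> : nu_comp (congr1 fst Hs) = nu_comp H by apply: (@icomp_congr (nu_ob M)); exact: secK.
  by move=> ->; exact: icomp_congr.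
Defined.

Lemma nu_fact_leg i n (y : nu_cell (F i) n) : nu_fact n (nu_map (lg i) y) = phi i n y.
Proof.
have [hFi _ _] := hF i; have [E hE] := psum_top hFi y.
have V := leg_pair_Val (leqnn n) hE.
by have := sec_uniq V => /(congr1 snd).
Qed.

Lemma nu_fact_unique (h : inffun (nu_ob M) C) :
  (forall i n (y : nu_cell (F i) n), h n (nu_map (lg i) y) = phi i n y) -> h = nu_fact.
Proof.
move=> hE; apply: inffun_ext => n u /=; rewrite -{1}(secK u).
apply: (@lift_ind M D pr Base n (fun x => h n x.1 = x.2)) (sec_Val u).
- by move=> x [i [y [e [hy ->]]]] /=.
- move=> j jn y z H yE zE /=.
  have H' : bd false jn (h n y.1) = bd true jn (h n z.1).
    by rewrite yE zE; exact: (congr1 snd H).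
  by rewrite (cmap_comp _ H'); exact: icomp_congr.
Qed.

Lemma nu_colimit_at : exists! h : hom (apex (map_cocone nu c)) (apex c'),
  forall i, cmp h (leg (map_cocone nu c) i) = leg c' i.
Proof.
exists nu_fact; split=> [i|h hE].
  by apply: inffun_ext => n y /=; exact: nu_fact_leg.
apply/esym/nu_fact_unique => i n y.
have E : inffun_cmp h (nu_mor (lg i)) = phi i := hE i.
by rewrite -E.
Qed.

End NuColimit.

(** * Colimits of augmented directed complexes with basis *)

Section FreeZmod.
Variable T : choiceType.

Definition fin_supp : {pred T -> int} := fun c => `[< finite_set [set t | c t != 0] >].

Record fz := FZ { fzval :> T -> int; _ : fzval \in fin_supp }.

HB.instance Definition _ := [isSub for fzval].
HB.instance Definition _ := [Choice of fz by <:].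

Lemma fin_supp_zmod : zmod_closed fin_supp.
Proof.
split; first by apply/asboolP; apply: sub_finite_set (finite_set0 T) => t /= /eqP.
move=> x y /asboolP fx /asboolP fy; apply/asboolP.
apply: sub_finite_set (_ : finite_set ([set t | x t != 0] `|` [set t | y t != 0])).
  move=> t /=; case: (eqVneq (x t) 0) => [xt|xt]; last by left.
  by move=> h; right; apply: contra_neq h => yt; rewrite /GRing.add /= /GRing.opp /= xt yt.
by rewrite finite_setU.
Qed.

HB.instance Definition _ := GRing.isZmodClosed.Build (T -> int) fin_supp fin_supp_zmod.
HB.instance Definition _ := [SubChoice_isSubZmodule of fz by <:].

Lemma fzD (x y : fz) t : (x + y) t = x t + y t.
Proof. by []. Qed.

Lemma fz_inj (x y : fz) : (forall t, x t = y t) -> x = y.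
Proof. by move=> h; apply/val_inj/funext. Qed.

Lemma delta_fin t : (fun u => (u == t)%:R : int) \in fin_supp.
Proof.
apply/asboolP; apply: sub_finite_set (finite_set1 t) => u /=.
by case: (eqVneq u t) => // _; rewrite eqxx.
Qed.

Definition delta (t : T) : fz := FZ (delta_fin t).

Lemma delta_inj : injective delta.
Proof.
move=> t u /(congr1 (fun x : fz => x t)) /=; rewrite eqxx.
by case: eqP.
Qed.

Lemma fz_sum (I : Type) (s : seq I) (G : I -> fz) t :
  (\sum_(i <- s) G i) t = \sum_(i <- s) G i t.
Proof. by apply: (big_morph (fun x : fz => x t)). Qed.

Lemma fzMz (x : fz) (n : int) t : (x *~ n) t = x t * n.
Proof.
have MN (y : fz) m : (y *+ m) t = y t *+ m.
  by elim: m => [|m IH]; rewrite ?mulr0n // !mulrS fzD IH.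
case: n => n; first by rewrite -pmulrn MN -mulr_natr natz.
rewrite NegzE mulrNz -pmulrn mulrN.
have -> : (- (x *+ n.+1)) t = - (x *+ n.+1) t by [].
by rewrite MN -mulr_natr natz.
Qed.

Lemma fz_is_coord (x : fz) (c : fz -> int) :
  is_coord (range delta) x c <->
  (forall t, c (delta t) = x t) /\ (forall b, ~ range delta b -> c b = 0).
Proof.
split.
  case/is_coordP => s [us sB c0 ->]; split; last first.
    by move=> b nB; apply: c0; apply/negP => /sB.
  move=> t; rewrite fz_sum; under eq_bigr do rewrite fzMz.
  case: (boolP (delta t \in s)) => [ts|ts]; last first.
    rewrite c0 // big_seq big1 // => b bs; have [u _ ub] := sB _ bs; subst b.
    rewrite /=; case: eqP => [tu|_]; last by rewrite mul0r.
    by rewrite tu bs in ts.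
  rewrite (perm_big _ (perm_to_rem ts)) big_cons /= eqxx mul1r big_seq big1 ?addr0 //.
  move=> b; rewrite mem_rem_uniq // inE => /andP[bt /sB[u _ ub]]; subst b.
  rewrite /=; case: eqP => [tu|_]; last by rewrite mul0r.
  by rewrite tu eqxx in bt.
case=> c1 c0; have /asboolP/finite_seqP[s sE] := valP x.
apply/is_coordP; exists [seq delta t | t <- undup s]; split.
- by rewrite map_inj_uniq ?undup_uniq //; exact: delta_inj.
- by move=> b /mapP[t _ ->]; exists t.
- move=> b bs; case: (pselect (range delta b)) => [[t _ tb]|]; last exact: c0.
  subst b; rewrite c1; apply: contraNeq bs => xt; apply: map_f; rewrite mem_undup.
  have : [set t | (\val x) t != 0] t by [].
  by rewrite sE.
- apply: fz_inj => t; rewrite fz_sum big_map.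
  under eq_bigr do rewrite fzMz c1 /=.
  case: (boolP (t \in undup s)) => [ts|ts].
    rewrite (perm_big _ (perm_to_rem ts)) big_cons /= eqxx mul1r big_seq big1 ?addr0 //.
    move=> u; rewrite mem_rem_uniq ?undup_uniq // inE => /andP[/negbTE ut _].
    by rewrite eq_sym ut mul0r.
  rewrite big_seq big1.
    apply/eqP; apply: contraNT ts => xt; rewrite mem_undup.
    have : [set t | (\val x) t != 0] t by [].
    by rewrite sE.
  move=> u us; case: eqP => [tu|_]; last by rewrite mul0r.
  by rewrite tu us in ts.
Qed.

Lemma fz_zbasis : is_zbasis (range delta).
Proof.
move=> x; pose c b := if pselect (exists t, delta t = b) is left h
  then x (sval (cid h)) else 0.
have cP : (forall t, c (delta t) = x t) /\ (forall b, ~ range delta b -> c b = 0).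
  split=> [t|b nB]; rewrite /c; case: pselect => [h|h] //.
  - by congr (x _); apply: delta_inj; case: (cid h).
  - by case: h; exists t.
  - by case: nB; case: h => t tb; exists t.
exists c; split=> [|c' /fz_is_coord[c1 c0]]; first exact/fz_is_coord.
apply/funext => b; case: (pselect (range delta b)) => [[t _ <-]|nB].
  by rewrite c1 cP.1.
by rewrite c0 // cP.2.
Qed.

End FreeZmod.

(** * Additive extension of functions given on a basis *)

Section Linear.
Variables (V W : zmodType) (B : set V).
Hypothesis zB : is_zbasis B.
Variable v : V -> W.

Definition lin_fun (x : V) : W := \sum_(b \in B) v b *~ zcoef B x b.

Lemma lin_funE x (s : seq V) : uniq s -> (forall b, b \in s -> B b) ->
  (forall b, b \notin s -> zcoef B x b = 0) ->
  lin_fun x = \sum_(b <- s) v b *~ zcoef B x b.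
Proof.
move=> us sB s0; rewrite /lin_fun (fsbigE s) //; last first.
  by move=> b _ /s0 ->; rewrite mulr0z.
rewrite big_seq_cond [RHS]big_seq; apply: eq_bigl => b; apply: andb_idr.
by move=> bs; apply: mem_set; exact: sB.
Qed.

Lemma lin_fun_zmod_morphism : zmod_morphism lin_fun.
Proof.
have linD x y : lin_fun (x + y) = lin_fun x + lin_fun y.
  have [s [us sB s0 _]] := zcoef_sum zB x; have [t [ut tB t0 _]] := zcoef_sum zB y.
  have uu := undup_uniq (s ++ t).
  have uB b : b \in undup (s ++ t) -> B b.
    by rewrite mem_undup mem_cat => /orP[/sB|/tB].
  have u0 b : b \notin undup (s ++ t) -> zcoef B x b = 0 /\ zcoef B y b = 0.
    by rewrite mem_undup mem_cat negb_or => /andP[/s0 -> /t0 ->].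
  rewrite !(lin_funE uu uB); try by move=> b /u0[].
  - by rewrite -big_split; apply: eq_bigr => b _; rewrite zcoefD // mulrzDr.
  - by move=> b /u0[h1 h2]; rewrite zcoefD // h1 h2.
have lin0 : lin_fun 0 = 0.
  by have := linD 0 0; rewrite addr0 => /eqP; rewrite -subr_eq0 opprD addrA subrr sub0r oppr_eq0 => /eqP.
move=> x y; rewrite linD; congr (_ + _).
by apply/eqP; rewrite -addr_eq0 -linD addNr lin0.
Qed.

HB.instance Definition _ := GRing.isZmodMorphism.Build V W lin_fun lin_fun_zmod_morphism.

Definition lin : {additive V -> W} := lin_fun.

Lemma lin_basis b : B b -> lin b = v b.
Proof.
move=> Bb; rewrite /= (@lin_funE _ [:: b]) //.
- by rewrite big_seq1 zcoef_basis // eqxx.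
- by move=> a; rewrite inE => /eqP ->.
- by move=> a; rewrite inE zcoef_basis // => /negbTE ->.
Qed.

Lemma zbasis_ext (f g : {additive V -> W}) : (forall b, B b -> f b = g b) -> forall x, f x = g x.
Proof.
move=> fg x; have [s [_ sB _ ->]] := zcoef_sum zB x.
rewrite !raddf_sum big_seq [RHS]big_seq; apply: eq_bigr => b /sB /fg E.
by rewrite !raddfMz E.
Qed.

End Linear.

(* The diagram is indexed by a quiver rather than a category because the generators
   of the colimit are sets of pairs (index, element), and the objects of a [category]
   live in a universe too large for a [zmodType]. *)
Section Colimit.
Variables (Q : quiver) (K : vertex Q -> adc).
Variable fe : forall i j : vertex Q, edge i j -> adcmor (K i) (K j).
Hypothesis hK : forall i, has_basis (K i).
Hypothesis fB : forall (i j : vertex Q) (u : edge i j) n (b : K i n),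
  basis (K i) n b -> basis (K j) n (fe u n b).

Definition qpt (n : nat) : Type := {i : vertex Q & K i n}.
Definition mkqpt n i (b : K i n) : qpt n := existT _ i b.

Inductive qglue (n : nat) : qpt n -> qpt n -> Prop :=
| QGlue i j (u : edge i j) (b : K i n) :
    basis (K i) n b -> qglue (mkqpt b) (mkqpt (fe u n b)).

Definition qglued n := clos_refl_sym_trans (qpt n) (@qglue n).

Definition qbasis n (t : qpt n) : Prop := basis (K (projT1 t)) n (projT2 t).

Definition cls n (t : qpt n) : set (qpt n) := [set t' | qglued t t'].

Lemma cls_eq n (t t' : qpt n) : cls t = cls t' <-> qglued t t'.
Proof.
split=> [E|tt']; first by have : cls t' t' by [exact: rst_refl]; rewrite -E.
apply/seteqP; split=> u /= h; first exact: rst_trans (rst_sym _ _ _ _ tt') h.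
exact: rst_trans tt' h.
Qed.

(** The quotient by glueing is represented by its classes as subsets, so that equality of generators
    amounts to [qglued]. *)
Definition cgen (n : nat) : Type :=
  {X : set (qpt n) | `[< exists2 t, qbasis t & X = cls t >]}.

Definition mkcgen n (t : qpt n) (h : qbasis t) : cgen n :=
  exist _ (cls t) (asboolT (ex_intro2 _ _ t h erefl)).

Lemma cgen_rep_subproof n (X : cgen n) : {t : qpt n | exists h : qbasis t, X = mkcgen h}.
Proof.
apply: cid; case: X => X XP; have [t ht E] := asboolW XP.
by exists t, ht; apply: eq_exist.
Qed.

Definition cgen_rep n (X : cgen n) : qpt n := sval (cgen_rep_subproof X).

Lemma cgen_repP n (X : cgen n) : exists h : qbasis (cgen_rep X), X = mkcgen h.
Proof. by rewrite /cgen_rep; case: (cgen_rep_subproof X). Qed.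

Lemma mkcgen_eq n (t t' : qpt n) (h : qbasis t) (h' : qbasis t') :
  mkcgen h = mkcgen h' <-> qglued t t'.
Proof.
rewrite -cls_eq; split=> [/(congr1 sval) //|E].
exact: eq_exist.
Qed.

Definition col (n : nat) : zmodType := fz (cgen n).
Definition cbasis (n : nat) : set (col n) := range (@delta (cgen n)).

Lemma col_zbasis n : is_zbasis (@cbasis n).
Proof. exact: fz_zbasis. Qed.

Definition gen n (t : qpt n) : col n :=
  if pselect (qbasis t) is left h then delta (mkcgen h) else 0.

Lemma genE n (t : qpt n) (h : qbasis t) : gen t = delta (mkcgen h).
Proof.
by rewrite /gen; case: pselect => // h'; rewrite (Prop_irrelevance h h').
Qed.

Lemma gen_rep n (X : cgen n) : gen (cgen_rep X) = delta X.
Proof. by have [h E] := cgen_repP X; rewrite (genE h) -E. Qed.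

Definition cleg i n : {additive K i n -> col n} :=
  lin (basis_zbasis (hK i) (n := n)) (fun b => gen (mkqpt b)).

Lemma cleg_basis i n (b : K i n) : basis (K i) n b -> cleg i n b = gen (mkqpt b).
Proof. exact: lin_basis. Qed.

Lemma qglued_gen n (t t' : qpt n) : qbasis t -> qbasis t' -> gen t = gen t' <-> qglued t t'.
Proof.
move=> h h'; rewrite (genE h) (genE h') -(mkcgen_eq h h'); split=> [|-> //].
exact: delta_inj.
Qed.

Lemma cleg_fe i j (u : edge i j) n (x : K i n) : cleg j n (fe u n x) = cleg i n x.
Proof.
apply: (zbasis_ext (basis_zbasis (hK i) (n := n)) (f := cleg j n \o fe u n) (g := cleg i n)).
move=> b Bb /=; rewrite [LHS](cleg_basis (fB u Bb)) [RHS](cleg_basis Bb).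
apply/esym/qglued_gen => //; first exact: fB.
exact/rst_step/QGlue.
Qed.

Lemma delta_cleg n (X : cgen n) : exists i (b : K i n), basis (K i) n b /\ delta X = cleg i n b.
Proof.
have [h _] := cgen_repP X; exists (projT1 (cgen_rep X)), (projT2 (cgen_rep X)); split=> //.
by rewrite cleg_basis // -gen_rep; case: (cgen_rep X).
Qed.

Lemma col_ext n (W : zmodType) (f g : {additive col n -> W}) :
  (forall i (x : K i n), f (cleg i n x) = g (cleg i n x)) -> forall x, f x = g x.
Proof.
move=> fg; apply: (zbasis_ext (@col_zbasis n)) => b [X _ <-].
by have [i [c [_ ->]]] := delta_cleg X.
Qed.

Section Fact.
Variables (n : nat) (W : zmodType) (w : forall i, {additive K i n -> W}).
Hypothesis w_fe : forall i j (u : edge i j) x, w j (fe u n x) = w i x.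

(** Evaluates on a chosen representative of the class; [w_glued] makes the result independent of the
    choice. *)
Definition cfact : {additive col n -> W} :=
  lin (@col_zbasis n) (fun b =>
    if pselect (exists X, delta X = b) is left h
    then w (projT1 (cgen_rep (sval (cid h)))) (projT2 (cgen_rep (sval (cid h)))) else 0).

Lemma w_glued (t t' : qpt n) : qglued t t' -> w (projT1 t) (projT2 t) = w (projT1 t') (projT2 t').
Proof. by elim=> [x y [i j u b _]|//|x y _ ->|x y z _ -> _ ->] //=; rewrite w_fe. Qed.

Lemma cfactE i x : cfact (cleg i n x) = w i x.
Proof.
apply: (zbasis_ext (basis_zbasis (hK i) (n := n)) (f := cfact \o cleg i n) (g := w i)).
move=> b Bb /=; have hb : qbasis (mkqpt b) by [].
rewrite [cleg i n b]cleg_basis // (genE hb) [LHS]lin_basis; last by exists (mkcgen hb).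
case: pselect => [h|[]]; last by exists (mkcgen hb).
have E : sval (cid h) = mkcgen hb by apply: delta_inj; case: (cid h).
have [h' E'] := cgen_repP (sval (cid h)).
  apply: (w_glued (t' := mkqpt b)); apply/(mkcgen_eq h' hb).
  by rewrite -E'.
exact: col_zbasis.
Qed.

End Fact.

Definition cdif n : {additive col n.+1 -> col n} :=
  cfact (fun i => cleg i n \o @dif (K i) n).

Lemma cdifE i n x : cdif n (cleg i n.+1 x) = cleg i n (dif (K i) x).
Proof.
by rewrite cfactE // => {}i j u {}x /=; rewrite -amap_dif cleg_fe.
Qed.

Definition caug : {additive col 0 -> int} := cfact (fun i => aug (K i)).

Lemma caugE i x : caug (cleg i 0%N x) = aug (K i) x.
Proof. by rewrite cfactE // => {}i j u {}x; rewrite amap_aug. Qed.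

Lemma cdif_cdif n (x : col n.+2) : cdif n (cdif n.+1 x) = 0.
Proof.
apply: (@col_ext _ _ (cdif n \o cdif n.+1) \0) => i {}x /=.
by rewrite !cdifE dif_dif raddf0.
Qed.

Lemma caug_cdif (x : col 1) : caug (cdif 0 x) = 0.
Proof.
apply: (@col_ext _ _ (caug \o cdif 0%N) \0) => i {}x /=.
by rewrite cdifE caugE aug_dif.
Qed.

Lemma submonoid_smallest (V : zmodType) (B : set V) : submonoid (smallest (@submonoid V) B).
Proof.
split; first by move=> M [[]].
by move=> x y hx hy M hM; have [[_ MD] _] := hM; apply: MD; [exact: hx | exact: hy].
Qed.

Definition colim_adc : adc :=
  ADC cdif_cdif caug_cdif (fun n => submonoid_smallest (@cbasis n)).

Lemma colim_is_basis : is_basis (K := colim_adc) cbasis.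
Proof. by move=> n; split=> //; exact: col_zbasis. Qed.

Lemma colim_has_basis : has_basis colim_adc.
Proof. by exists cbasis; exact: colim_is_basis. Qed.

Lemma colim_basisE n : basis colim_adc n = cbasis (n := n).
Proof. exact: basisE colim_is_basis. Qed.

Lemma cleg_colim_basis i n (b : K i n) : basis (K i) n b -> basis colim_adc n (cleg i n b).
Proof.
move=> Bb; have hb : qbasis (mkqpt b) by [].
by rewrite colim_basisE cleg_basis // (genE hb); exists (mkcgen hb).
Qed.

Lemma cleg_pos i n (x : K i n) : kpos (K i) x -> kpos colim_adc (cleg i n x : colim_adc n).
Proof.
move=> /(kpos_decomp (hK i))[s [sB ->]]; rewrite raddf_sum.
apply: (@kpos_sum colim_adc n _ s (fun b => cleg i n b)) => b /sB Bb; apply: (kpos_basis colim_has_basis).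
exact: cleg_colim_basis.
Qed.

Definition colim_leg i : adcmor (K i) colim_adc :=
  AdcMor (K := K i) (L := colim_adc) (fun n x => esym (cdifE x)) (@caugE i) (@cleg_pos i).

Lemma colim_surj n (b : colim_adc n) : basis colim_adc n b ->
  exists i (b' : K i n), basis (K i) n b' /\ b = colim_leg i n b'.
Proof. by rewrite colim_basisE => -[X _ <-]; exact: delta_cleg. Qed.

Lemma colim_glued n i j (b : K i n) (b' : K j n) : basis (K i) n b -> basis (K j) n b' ->
  colim_leg i n b = colim_leg j n b' <-> qglued (mkqpt b) (mkqpt b').
Proof. by move=> Bb Bb'; rewrite /= !cleg_basis //; exact: qglued_gen. Qed.

Section ColimFact.
Variables (N : adc) (w : forall i, adcmor (K i) N).
Hypothesis w_fe : forall i j (u : edge i j) n x, w j n (fe u n x) = w i n x.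

Let h n : {additive colim_adc n -> N n} := cfact (fun i => w i n).

Lemma colim_fact_leg i n x : h n (colim_leg i n x) = w i n x.
Proof. by rewrite /h [LHS]cfactE // => *; exact: w_fe. Qed.

Lemma colim_fact_dif n (x : colim_adc n.+1) : h n (dif colim_adc x) = dif N (h n.+1 x).
Proof.
apply: (@col_ext _ _ (h n \o cdif n) (@dif N n \o h n.+1)) => i {}x /=.
by rewrite cdifE [LHS]colim_fact_leg [X in dif N X]colim_fact_leg amap_dif.
Qed.

Lemma colim_fact_aug (x : colim_adc 0%N) : aug N (h 0%N x) = aug colim_adc x.
Proof.
apply: (@col_ext _ _ (aug N \o h 0%N) caug) => i {}x /=.
by rewrite caugE [X in aug N X]colim_fact_leg amap_aug.
Qed.

Lemma colim_fact_pos n (x : colim_adc n) : kpos colim_adc x -> kpos N (h n x).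
Proof.
move=> hx; apply: (hx (fun x => kpos N (h n x))); split.
  split; first by rewrite raddf0; exact: kpos0.
  by move=> y z hy hz; rewrite raddfD; exact: kposD.
move=> b [X _ <-]; have [i [c [Bc ->]]] := delta_cleg X.
by rewrite [h n _]colim_fact_leg; apply: amap_pos; exact: kpos_basis.
Qed.

Definition colim_fact : adcmor colim_adc N :=
  AdcMor colim_fact_dif colim_fact_aug colim_fact_pos.

Lemma colim_fact_unique (k : adcmor colim_adc N) :
  (forall i n x, k n (colim_leg i n x) = w i n x) -> k = colim_fact.
Proof.
move=> kE; apply: adcmor_ext => n; apply: col_ext => i x.
by rewrite [RHS]colim_fact_leg; exact: kE.
Qed.

End ColimFact.

Let Kob (i : vertex Q) : Cda := K i.
Let Kmor (i j : vertex Q) (u : edge i j) : hom (Kob i) (Kob j) := fe u.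
Let FF : functor (free_category Q) Cda := free_functor Kmor.

Lemma qpath_leg i j (p : qpath i j) : 
  adcmor_cmp (colim_leg j) (qpath_mor Kmor p) = colim_leg i.
Proof.
elim: p => [a|a b c u p IH] /=; first by apply: adcmor_ext.
have E : adcmor_cmp (colim_leg b) (fe u) = colim_leg a.
  by apply: adcmor_ext => n x; exact: (cleg_fe u x).
by rewrite -E -IH; exact: adcmor_ext.
Qed.

Definition colim_cocone : cocone FF :=
  @Cocone (free_category Q) Cda FF colim_adc colim_leg qpath_leg.

Lemma colim_is_colimit : is_colimit colim_cocone.
Proof.
move=> c'; pose w i : adcmor (K i) (apex c') := leg c' i.
have w_fe i j (u : edge i j) n x : w j n (fe u n x) = w i n x.
  have /= E := legE c' (qcons u (qnil j) : @hom (free_category Q) i j).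
  by rewrite /w -E.
exists (colim_fact w_fe); split=> [i|k kE].
  by apply: adcmor_ext => n x; exact: (colim_fact_leg w_fe).
apply/esym/colim_fact_unique => i n x.
have E : adcmor_cmp k (colim_leg i) = w i := kE i.
by rewrite -E.
Qed.

Lemma qglued_glued n (t t' : qpt n) : qglued t t' ->
  @glued _ FF n (existT _ (projT1 t) (projT2 t)) (existT _ (projT1 t') (projT2 t')).
Proof.
elim=> [x y [i j u b Bb]|x|x y _ IH|x y z _ IH1 _ IH2].
- exact: (rst_step _ _ _ _ (@Glue _ FF n i j (qcons u (qnil j)) b Bb)).
- exact: rst_refl.
- exact: rst_sym.
- exact: rst_trans IH1 IH2.
Qed.

End Colimit.

(** * Zigzags of ordered rigid inclusions *)

Section BasisEmbedding.
Variables (K L : adc) (f : adcmor K L).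
Hypotheses (hK : has_basis K) (hL : has_basis L).
Hypothesis fB : forall n (b : K n), basis K n b -> basis L n (f n b).
Hypothesis finj : forall n (b b' : K n), basis K n b -> basis K n b' ->
  f n b = f n b' -> b = b'.

Lemma supp_amap n (z : K n) (x : L n) : coef (f n z) x != 0 ->
  exists x', [/\ basis K n x', f n x' = x & coef z x' != 0].
Proof.
move=> cx; have [x' Bx' fx'] : exists2 x', basis K n x' & f n x' = x.
  apply: contrapT => H; move: cx; rewrite coef_amap_notin ?eqxx // => b' Bb' E.
  by apply: H; exists b'.
exists x'; split=> //; move: cx; rewrite -fx' coef_amap // => b Bb; exact: finj.
Qed.

Lemma amap_supp n (z : K n) (x : K n) : basis K n x -> coef z x != 0 ->
  coef (f n z) (f n x) != 0.
Proof. by move=> Bx cx; rewrite coef_amap // => b Bb; exact: finj. Qed.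

Lemma steiner_le_fpt (a b : pt K) : steiner_le a b -> steiner_le (fpt f a) (fpt f b).
Proof.
elim=> [x y [n s t Bs Bt st|n s t Bs Bt st]|x|x y z _ IH1 _ IH2].
- apply: rt_step; apply: LeSource; [exact: fB | exact: fB |].
  change (coef (sgn_part false (dif L (f n.+1 t))) (f n s) != 0).
  rewrite -amap_dif -(amap_sgn_part hK hL fB finj false).
  exact: amap_supp.
- apply: rt_step; apply: LeTarget; [exact: fB | exact: fB |].
  change (coef (sgn_part true (dif L (f n.+1 s))) (f n t) != 0).
  rewrite -amap_dif -(amap_sgn_part hK hL fB finj true).
  exact: amap_supp.
- exact: rt_refl.
- exact: rt_trans IH1 IH2.
Qed.

Hypothesis fsurj : forall n (b : L n), basis L n b ->
  exists2 b', basis K n b' & f n b' = b.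

Lemma unitary_of_surj : unitary K -> unitary L.
Proof.
move=> /unitaryE uK; apply/unitaryE => m b /fsurj[b' Bb' <-] eps.
by rewrite -(amap_atom_ent hK hL fB finj) amap_aug uK.
Qed.

End BasisEmbedding.

Lemma zbasis_image (V W : zmodType) (phi : {additive V -> W}) (psi : {additive W -> V})
    (B : set V) : cancel phi psi -> cancel psi phi -> is_zbasis B ->
  is_zbasis (phi @` B).
Proof.
move=> phiK psiK zB x.
have im b : (phi @` B) b <-> B (psi b).
  by split=> [[a Ba <-]|Bb]; [rewrite phiK | exists (psi b)].
exists (fun b => zcoef B (psi x) (psi b)); split.
  have [s [us sB s0 xE]] := zcoef_sum zB (psi x).
  apply/is_coordP; exists [seq phi b | b <- s]; split.
  - by rewrite map_inj_uniq //; exact: can_inj phiK.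
  - by move=> b /mapP[a /sB Ba ->]; exists a.
  - move=> b bs; apply: s0; apply: contra bs => h; apply/mapP; by exists (psi b).
  - rewrite -[LHS]psiK {1}xE raddf_sum big_map; apply: eq_bigr => b _.
    by rewrite raddfMz phiK.
move=> c /is_coordP[s [us sB s0 xE]]; apply/funext => b.
have /(zcoef_unique zB) -> : is_coord B (psi x) (c \o phi); last by rewrite /= psiK.
apply/is_coordP; exists [seq psi b | b <- s]; split.
- by rewrite map_inj_uniq //; exact: can_inj psiK.
- by move=> a /mapP[d /sB /im Bd ->].
- by move=> a ns; apply: s0; apply: contra ns => h; apply/mapP; exists (phi a).
- by rewrite xE raddf_sum big_map; apply: eq_bigr => a _; rewrite raddfMz /= psiK.
Qed.

(** * Transport of strong Steiner complexes along isomorphisms *)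

Section IsoTransport.
Variables (M N : adc) (phi : adcmor M N) (psi : adcmor N M).
Hypothesis phiK : forall n (x : M n), psi n (phi n x) = x.
Hypothesis psiK : forall n (x : N n), phi n (psi n x) = x.
Hypothesis sM : strong_steiner M.

Let hM : has_basis M. Proof. by have [] := sM. Qed.

Lemma iso_is_basis : is_basis (K := N) (fun n => phi n @` basis M n).
Proof.
move=> n; split; first exact: (zbasis_image (phi := phi n) (psi := psi n)) (basis_zbasis hM (n := n)).
have kM : kpos M = smallest (@submonoid (M n)) (basis M n).
  by case: hM => B hB; rewrite (basisE _ hB); have [] := hB n.
apply/seteqP; split=> x.
  move=> /(amap_pos psi); rewrite kM => hx S [[S0 SD] BS].
  rewrite -(psiK x); apply: (hx (fun y => S (phi n y))); split.
    split; first by rewrite raddf0.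
    by move=> y z hy hz; rewrite raddfD; exact: SD.
  by move=> b Bb; apply: BS; exists b.
apply; split; first exact: submonoid_kpos.
by move=> b [a Ba <-]; apply: amap_pos; exact: kpos_basis.
Qed.

Lemma iso_has_basis : has_basis N.
Proof. by eexists; exact: iso_is_basis. Qed.

Lemma iso_basis n (b : M n) : basis M n b -> basis N n (phi n b).
Proof. by move=> Bb; rewrite (basisE _ iso_is_basis); exists b. Qed.

Lemma iso_basis' n (b : N n) : basis N n b -> exists2 b', basis M n b' & phi n b' = b.
Proof. by rewrite (basisE _ iso_is_basis) => -[a Ba <-]; exists a. Qed.

Lemma iso_inj n (b b' : M n) : basis M n b -> basis M n b' -> phi n b = phi n b' -> b = b'.
Proof. by move=> _ _ E; rewrite -(phiK b) E phiK. Qed.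

Lemma iso_rigid : rigid phi.
Proof. exact: rigid_of_basis_inj hM iso_has_basis iso_basis iso_inj. Qed.

Lemma iso_strong_steiner : strong_steiner N.
Proof.
have [_ uM lM] := sM; split; first exact: iso_has_basis.
  exact: (unitary_of_surj hM iso_has_basis iso_basis iso_inj iso_basis').
have pB n (b : N n) : basis N n b -> basis M n (psi n b).
  by move=> /iso_basis'[b' Bb' <-]; rewrite phiK.
have pinj n (b b' : N n) : basis N n b -> basis N n b' -> psi n b = psi n b' -> b = b'.
  by move=> _ _ E; rewrite -(psiK b) E psiK.
move=> n m x y Bx By xy yx.
have := lM _ _ _ _ (pB _ _ Bx) (pB _ _ By)
  (steiner_le_fpt iso_has_basis hM pB pinj xy) (steiner_le_fpt iso_has_basis hM pB pinj yx).
by move=> /(congr1 (fpt phi)); rewrite /fpt /mkpt /= !psiK.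
Qed.

End IsoTransport.

Lemma rigid_id (K : adc) : has_basis K -> rigid (adcmor_id K).
Proof. by []. Qed.

Lemma rigid_cmp (K L M : adc) (g : adcmor L M) (f : adcmor K L) :
  rigid g -> rigid f -> rigid (adcmor_cmp g f).
Proof.
move=> [hL hM gB gA] [hK _ fB fA]; split=> //.
  by move=> n b Bb; exact/gB/fB.
by move=> eps n k b Bb /=; rewrite fA // gA //; exact: fB.
Qed.

Lemma rigid_qpath (Q : quiver) (X : vertex Q -> Cda)
    (Xe : forall i j : vertex Q, edge i j -> hom (X i) (X j)) :
  (forall i, has_basis (X i)) -> (forall i j (u : edge i j), rigid (Xe i j u)) ->
  forall i j (p : qpath i j), rigid (qpath_mor Xe p).
Proof.
move=> hX rX i j; elim=> [a|a b c u p IH] /=; first exact: rigid_id.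
exact: rigid_cmp.
Qed.

Section Zigzag.
Variables (l : nat) (K : 'I_l.+1 -> adc) (L : 'I_l -> adc).
Variable f : forall i : 'I_l, adcmor (L i) (K (widen_ord (leqnSn l) i)).
Variable g : forall i : 'I_l, adcmor (L i) (K (lift ord0 i)).
Hypothesis sK : forall k, strong_steiner (K k).
Hypothesis sL : forall i, strong_steiner (L i).
Hypothesis ordf : forall i, ordered_rigid_inclusion (f i).
Hypothesis ordg : forall i, ordered_rigid_inclusion (g i).

Let wd (i : 'I_l) : 'I_l.+1 := widen_ord (leqnSn l) i.
Let lf (i : 'I_l) : 'I_l.+1 := lift ord0 i.

Lemma ordered_le (A B : adc) (h : adcmor A B) (a b : pt A) : ordered_rigid_inclusion h ->
  pbasis a -> pbasis b -> steiner_le a b <-> steiner_le (fpt h a) (fpt h b).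
Proof. by case: a b => [n a] [m b] [_ _ H]; exact: H. Qed.

Lemma ordered_basis (A B : adc) (h : adcmor A B) (a : pt A) : ordered_rigid_inclusion h ->
  pbasis a -> pbasis (fpt h a).
Proof. by move=> [[_ _ hB _] _ _]; exact: hB. Qed.

Lemma strong_steiner_anti (A : adc) (a b : pt A) : strong_steiner A ->
  pbasis a -> pbasis b -> steiner_le a b -> steiner_le b a -> a = b.
Proof. by case: a b => [n a] [m b] [_ _ lA]; exact: lA. Qed.

(** If [h b = h b'], order reflection gives [b <= b'] and [b' <= b], and loop-freeness of [A]
    concludes. *)
Lemma ordered_inj (A B : adc) (h : adcmor A B) : ordered_rigid_inclusion h ->
  strong_steiner A -> forall n (b b' : A n), basis A n b -> basis A n b' ->
  h n b = h n b' -> b = b'.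
Proof.
move=> oh sA n b b' Bb Bb' E; apply: mkpt_inj; apply: strong_steiner_anti => //.
  by apply/(ordered_le oh) => //; rewrite /fpt /= E; exact: rt_refl.
by apply/(ordered_le oh) => //; rewrite /fpt /= E; exact: rt_refl.
Qed.

(** * Up-sets propagated along the zigzag *)

Section UpSet.
Variables (i0 : 'I_l.+1) (p0 : pt (K i0)).

(* The trace on each [K k] of the up-set generated by [p0] in the colimit.  It is
   propagated away from [i0] only, so that its trace on [K i0] is principal; that it is
   compatible with the glueing, [up_glue], is where order reflection is used. *)
Inductive up : forall k, pt (K k) -> Prop :=
| Up0 p : steiner_le p0 p -> up p
| UpR (i : 'I_l) s (p : pt (K (lf i))) : (i0 <= i)%N -> pbasis s ->
    up (fpt (f i) s) -> steiner_le (fpt (g i) s) p -> up p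
| UpL (i : 'I_l) s (p : pt (K (wd i))) : (i < i0)%N -> pbasis s ->
    up (fpt (g i) s) -> steiner_le (fpt (f i) s) p -> up p.

Lemma up_closed k (p q : pt (K k)) : up p -> steiner_le p q -> up q.
Proof.
move=> h; case: h q => {k p} [p h|i s p h1 h2 h3 h4|i s p h1 h2 h3 h4] q pq.
- by apply: Up0; exact: rt_trans h pq.
- by apply: UpR h1 h2 h3 _; exact: rt_trans h4 pq.
- by apply: UpL h1 h2 h3 _; exact: rt_trans h4 pq.
Qed.

Lemma val_wd i : val (wd i) = i. Proof. by []. Qed.
Lemma val_lf i : val (lf i) = i.+1. Proof. by []. Qed.

(** [UpR] reaches only indices above [i0] and [UpL] only indices below, so an element over [i0]
    comes from [Up0]. The equation [e] keeps the index [k] free for the case analysis on [up]. *)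
Lemma up_base_inv k (p : pt (K k)) : up p -> forall e : k = i0,
  steiner_le p0 (ecast k (pt (K k)) e p).
Proof.
case=> {k p} [p h|i s p h1 _ _ _|i s p h1 _ _ _] e.
- by rewrite (eq_irrelevance e erefl).
- by exfalso; have := congr1 val e; rewrite val_lf; move: h1 => /=; lia.
- by exfalso; have := congr1 val e; rewrite val_wd; move: h1 => /=; lia.
Qed.

(** Strictly to the right of [i0] the last step must be [UpR] from [L j]: whatever lies above [p0]
    there does so through the neighbouring glued part. *)
Lemma up_right_inv k (p : pt (K k)) : up p -> forall j (e : k = lf j), (i0 <= j)%N ->
  exists s, [/\ pbasis s, up (fpt (f j) s) &
    steiner_le (fpt (g j) s) (ecast k (pt (K k)) e p)].
Proof.
case=> {k p} [p h|i s p h1 h2 h3 h4|i s p h1 _ _ _] j e i0j.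
- by exfalso; have := congr1 val e; rewrite val_lf; move: i0j => /=; lia.
- have ij : i = j by exact: lift_inj e.
  by subst j; rewrite (eq_irrelevance e erefl); exists s.
- by exfalso; have := congr1 val e; rewrite val_lf val_wd; move: h1 i0j => /=; lia.
Qed.

Lemma up_left_inv k (p : pt (K k)) : up p -> forall j (e : k = wd j), (j < i0)%N ->
  exists s, [/\ pbasis s, up (fpt (g j) s) &
    steiner_le (fpt (f j) s) (ecast k (pt (K k)) e p)].
Proof.
case=> {k p} [p h|i s p h1 _ _ _|i s p h1 h2 h3 h4] j e ji0.
- by exfalso; have := congr1 val e; rewrite val_wd; move: ji0 => /=; lia.
- by exfalso; have := congr1 val e; rewrite val_lf val_wd; move: h1 ji0 => /=; lia.
- have ij : i = j by apply: val_inj; exact: (congr1 val e).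
  by subst j; rewrite (eq_irrelevance e erefl); exists s.
Qed.

Lemma up_glue j (s : pt (L j)) : pbasis s -> up (fpt (f j) s) <-> up (fpt (g j) s).
Proof.
move=> Bs; case: (leqP i0 j) => [ij|ji].
- split=> [h|h]; first by apply: UpR ij Bs h _; exact: rt_refl.
  (* Crossing back from [g s] to [f s]: [g j] reflects [g s' <= g s] to [s' <= s], which [f j]
     preserves. *)
  have [s' [Bs' us' le_s']] := up_right_inv h erefl ij.
  apply: up_closed us' _; apply/(ordered_le (ordf j)) => //.
  by apply/(ordered_le (ordg j)).
- split=> [h|h]; last by apply: UpL ji Bs h _; exact: rt_refl.
  have [s' [Bs' us' le_s']] := up_left_inv h erefl ji.
  apply: up_closed us' _; apply/(ordered_le (ordg j)) => //.
  by apply/(ordered_le (ordf j)).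
Qed.

End UpSet.

(** * The order on the colimit of the zigzag *)

Let Q := zz_quiver l.
Let X (v : vertex Q) : adc := @zz_ob Cda l K L v.
Let Xe (v w : vertex Q) (e : edge v w) : adcmor (X v) (X w) := @zz_mor Cda l K L f g v w e.

Lemma zz_strong v : strong_steiner (X v).
Proof. by case: v. Qed.

Lemma zz_hasB v : has_basis (X v).
Proof. by have [] := zz_strong v. Qed.

Lemma zz_rigid v w (e : edge v w) : rigid (Xe e).
Proof. by case: e => i /=; [have [] := ordf i | have [] := ordg i]. Qed.

Lemma zz_edge_basis v w (e : edge v w) n (b : X v n) : basis (X v) n b -> basis (X w) n (Xe e n b).
Proof. by have [_ _ eB _] := zz_rigid e; exact: eB. Qed.

Let M : adc := colim_adc zz_hasB zz_edge_basis.
Let lg v : adcmor (X v) M := colim_leg zz_hasB zz_edge_basis v.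
Let lgK k : adcmor (K k) M := lg (inl k).
Let hM : has_basis M := colim_has_basis zz_hasB zz_edge_basis.

Lemma lgB v n (b : X v n) : basis (X v) n b -> basis M n (lg v n b).
Proof. exact: cleg_colim_basis. Qed.

Lemma lg_edge v w (e : edge v w) n (x : X v n) : lg w n (Xe e n x) = lg v n x.
Proof. exact: (cleg_fe zz_hasB zz_edge_basis e x). Qed.

Lemma lg_f i n (x : L i n) : lgK (wd i) n (f i n x) = lg (inr i) n x.
Proof. exact: (lg_edge (ZZl i)). Qed.

Lemma lg_g i n (x : L i n) : lgK (lf i) n (g i n x) = lg (inr i) n x.
Proof. exact: (lg_edge (ZZr i)). Qed.

(** Over [L i] the up-set is read through [f i]; by [up_glue], reading it through [g i] gives the
    same. *)
Definition up_vertex i0 (p0 : pt (K i0)) n (t : qpt X n) : Prop :=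
  match t with
  | existT (inl k) b => up p0 (mkpt (b : K k n))
  | existT (inr i) b => up p0 (fpt (f i) (mkpt (b : L i n)))
  end.

Lemma up_qglued i0 (p0 : pt (K i0)) n (t t' : qpt X n) :
  qglued Xe t t' -> up_vertex p0 t <-> up_vertex p0 t'.
Proof.
elim=> [x y [v w u b Bb]|//|x y _ -> //|x y z _ -> _ -> //].
case: u b Bb => i b Bb //=.
exact: (@up_glue i0 p0 i (mkpt b)).
Qed.

Lemma up_lgK i0 (p0 : pt (K i0)) k k' (a : pt (K k)) (a' : pt (K k')) :
  pbasis a -> pbasis a' -> fpt (lgK k) a = fpt (lgK k') a' -> up p0 a -> up p0 a'.
Proof.
case: a a' => [n a] [n' a'] Ba Ba' E.
have nn : n = n' by exact: (congr1 (@dim M) E).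
subst n'; have aa' : lgK k n a = lgK k' n a' := mkpt_inj E.
have := proj1 (colim_glued zz_hasB zz_edge_basis (i := inl k) (j := inl k') Ba Ba') aa'.
by move=> /(up_qglued p0) /=; case.
Qed.

(** Glued elements lie in the same sets [up p0]. Taking [p0] to be [b] and then [b'] gives both
    inequalities in [K k]. *)
Lemma lgK_inj k n (b b' : K k n) : basis (K k) n b -> basis (K k) n b' ->
  lgK k n b = lgK k n b' -> b = b'.
Proof.
move=> Bb Bb' E; apply: mkpt_inj; apply: (strong_steiner_anti (sK k)) => //.
  have u : up (mkpt b) (mkpt b) by apply: Up0; exact: rt_refl.
  have u' := @up_lgK k (mkpt b) k k (mkpt b) (mkpt b') Bb Bb' (congr1 (@mkpt M n) E) u.
  exact: (up_base_inv u' erefl).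
have u : up (mkpt b') (mkpt b') by apply: Up0; exact: rt_refl.
have u' := @up_lgK k (mkpt b') k k (mkpt b') (mkpt b) Bb' Bb (congr1 (@mkpt M n) (esym E)) u.
exact: (up_base_inv u' erefl).
Qed.

Lemma lg_inj v n (b b' : X v n) : basis (X v) n b -> basis (X v) n b' ->
  lg v n b = lg v n b' -> b = b'.
Proof.
case: v b b' => [k|i] b b' Bb Bb'; first exact: lgK_inj.
rewrite -!lg_f => E; apply: (ordered_inj (ordf i) (sL i)) => //.
by apply: lgK_inj E; have [[_ _ fB _] _ _] := ordf i; exact: fB.
Qed.

Lemma lg_rigid v : rigid (lg v).
Proof. exact: rigid_of_basis_inj (zz_hasB v) hM (@lgB v) (@lg_inj v). Qed.

Lemma lgK_surj n (b : M n) : basis M n b ->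
  exists k (b' : K k n), basis (K k) n b' /\ b = lgK k n b'.
Proof.
move=> /colim_surj[[k|i] [b' [Bb' ->]]]; first by exists k, b'.
exists (wd i), (f i n b'); split; last exact: esym (lg_f b').
by have [[_ _ fB _] _ _] := ordf i; exact: fB.
Qed.

Lemma colim_unitary : unitary M.
Proof.
apply/unitaryE => m b /lgK_surj[k [b' [Bb' ->]]] eps.
have hKk : has_basis (K k) by have [] := sK k.
rewrite -(amap_atom_ent hKk hM (@lgB (inl k)) (@lgK_inj k)) amap_aug.
by have [_ /unitaryE uK _] := sK k; exact: uK.
Qed.

Lemma lgK_le k (a b : pt (K k)) : steiner_le a b -> steiner_le (fpt (lgK k) a) (fpt (lgK k) b).
Proof.
have hKk : has_basis (K k) by have [] := sK k.
exact: (steiner_le_fpt hKk hM (@lgB (inl k)) (@lgK_inj k)).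
Qed.

(** A generating relation is witnessed by the boundary of one basis element; lifting that element to
    some [K k] lifts the other one with it. *)
Lemma colim_le_gen (p q : pt M) : steiner_le_gen p q -> exists k (a b : pt (K k)),
  [/\ pbasis a, pbasis b, p = fpt (lgK k) a, q = fpt (lgK k) b & steiner_le a b].
Proof.
have main eps n (x : M n) (y : M n.+1) : basis M n.+1 y ->
    supp (sgn_part eps (dif M y)) x -> exists k (x' : K k n) (y' : K k n.+1),
    [/\ basis (K k) n x', basis (K k) n.+1 y', x = lgK k n x', y = lgK k n.+1 y' &
        supp (sgn_part eps (dif (K k) y')) x'].
  move=> /lgK_surj[k [y' [By' ->]]]; have hKk : has_basis (K k) by have [] := sK k.
  change (coef (sgn_part eps (dif M (lgK k n.+1 y'))) x != 0 -> exists k0 (x' : K k0 n)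
    (y0 : K k0 n.+1), [/\ basis (K k0) n x', basis (K k0) n.+1 y0, x = lgK k0 n x',
      lgK k n.+1 y' = lgK k0 n.+1 y0 & supp (sgn_part eps (dif (K k0) y0)) x']).
  rewrite -amap_dif -(amap_sgn_part hKk hM (@lgB (inl k)) (@lgK_inj k)).
  move=> /(supp_amap hKk hM (@lgB (inl k)) (@lgK_inj k))[x' [Bx' <- cx']].
  by exists k, x', y'.
case=> n x y Bx By h.
  have [k [x' [y' [Bx' By' -> -> h']]]] := main false _ _ _ By h.
  by exists k, (mkpt x'), (mkpt y'); split=> //; apply: rt_step; exact: LeSource.
have [k [y' [x' [By' Bx' -> -> h']]]] := main true _ _ _ Bx h.
by exists k, (mkpt x'), (mkpt y'); split=> //; apply: rt_step; exact: LeTarget.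
Qed.

Lemma up_le i0 (p0 : pt (K i0)) (p q : pt M) : steiner_le p q ->
  forall k (a : pt (K k)), pbasis a -> p = fpt (lgK k) a -> up p0 a ->
  exists k' (b : pt (K k')), [/\ pbasis b, q = fpt (lgK k') b & up p0 b].
Proof.
elim=> [x y /colim_le_gen[k' [a' [b' [Ba' Bb' -> -> ab]]]]|x|x y z _ IH1 _ IH2] k a Ba E ua.
- exists k', b'; split=> //; apply: up_closed ab.
  exact: up_lgK Ba Ba' (esym E) ua.
- by exists k, a.
- by have [k1 [b [Bb yE ub]]] := IH1 _ _ Ba E ua; exact: IH2 Bb yE ub.
Qed.

Lemma colim_le_up i0 (p0 : pt (K i0)) k (b : pt (K k)) : pbasis p0 -> pbasis b ->
  steiner_le (fpt (lgK i0) p0) (fpt (lgK k) b) -> up p0 b.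
Proof.
move=> Bp Bb h; have u0 : up p0 p0 by apply: Up0; exact: rt_refl.
have [k' [b' [Bb' E ub']]] := up_le h Bp erefl u0.
exact: up_lgK Bb' Bb (esym E) ub'.
Qed.

Lemma colim_le_reflect k (a b : pt (K k)) : pbasis a -> pbasis b ->
  steiner_le (fpt (lgK k) a) (fpt (lgK k) b) -> steiner_le a b.
Proof. by move=> Ba Bb h; exact: (up_base_inv (colim_le_up Ba Bb h) erefl). Qed.

Lemma fpt_lg_f i (s : pt (L i)) : fpt (lgK (wd i)) (fpt (f i) s) = fpt (lg (inr i)) s.
Proof. by case: s => n s; congr mkpt; exact: lg_f. Qed.

Lemma fpt_lg_g i (s : pt (L i)) : fpt (lgK (lf i)) (fpt (g i) s) = fpt (lg (inr i)) s.
Proof. by case: s => n s; congr mkpt; exact: lg_g. Qed.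

Lemma up_colim_le i0 (p0 : pt (K i0)) k (b : pt (K k)) : up p0 b ->
  steiner_le (fpt (lgK i0) p0) (fpt (lgK k) b).
Proof.
elim=> {k b} [p h|i s p _ _ _ IH h|i s p _ _ _ IH h]; first exact: lgK_le.
  by apply: rt_trans IH _; rewrite fpt_lg_f -fpt_lg_g; exact: lgK_le.
by apply: rt_trans IH _; rewrite fpt_lg_g -fpt_lg_f; exact: lgK_le.
Qed.

(** Induction on [j - k]. The inequality from [a] to [b] factors through some [s] in the [L i] next
    to [K j]; with [b <= a] this gives [b <= s <= b] in the colimit. Reflection in [K j] shows that
    [b] is the image of [s], so it can be moved to the previous complex, one index closer to [k]. *)
Lemma colim_anti k j (a : pt (K k)) (b : pt (K j)) : (k <= j)%N -> pbasis a -> pbasis b ->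
  steiner_le (fpt (lgK k) a) (fpt (lgK j) b) -> steiner_le (fpt (lgK j) b) (fpt (lgK k) a) ->
  fpt (lgK k) a = fpt (lgK j) b.
Proof.
move: {2}(j - k)%N (leqnn (j - k)%N) => d; elim: d j b => [|d IH] j b jk kj Ba Bb ab ba.
  have E : j = k by apply: val_inj => /=; lia.
  subst j; congr fpt; apply: (strong_steiner_anti (sK k)) => //; exact: colim_le_reflect.
case: (eqVneq (j : nat) k) => [E|ne].
  have {}E : j = k by exact: val_inj.
  subst j; congr fpt; apply: (strong_steiner_anti (sK k)) => //; exact: colim_le_reflect.
have [i jE] : exists i, j = lf i.
  have jl : (j.-1 < l)%N by have := ltn_ord j; move: ne kj; lia.
  exists (Ordinal jl); apply: val_inj; rewrite val_lf /=; move: ne kj; lia.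
subst j.
have ki : (k <= i)%N by move: ne kj; rewrite /= /bump /=; lia.
have [s [Bs us le_s]] := up_right_inv (colim_le_up Ba Bb ab) erefl ki.
have a_s := up_colim_le us.
have s_b : steiner_le (fpt (lgK (wd i)) (fpt (f i) s)) (fpt (lgK (lf i)) b).
  by rewrite fpt_lg_f -fpt_lg_g; exact: lgK_le.
have bs : b = fpt (g i) s.
  apply: (strong_steiner_anti (sK _)) => //; first exact: (ordered_basis (ordg i)).
  apply: colim_le_reflect => //; first exact: (ordered_basis (ordg i)).
  by rewrite fpt_lg_g -fpt_lg_f; exact: rt_trans ba a_s.
rewrite bs fpt_lg_g -fpt_lg_f; apply: IH => //.
- by move: jk; rewrite /= /bump /=; lia.
- exact: (ordered_basis (ordf i)).
- exact: rt_trans s_b ba.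
Qed.

Lemma colim_strong_steiner : strong_steiner M.
Proof.
split; [exact: hM | exact: colim_unitary |] => n m x y.
move=> /lgK_surj[k [x' [Bx' ->]]] /lgK_surj[j [y' [By' ->]]] xy yx.
case: (leqP k j) => kj.
  exact: (@colim_anti k j (mkpt x') (mkpt y')).
by apply/esym/(@colim_anti j k (mkpt y') (mkpt x')) => //; exact: ltnW.
Qed.

Let F := @zigzag Cda l K L f g.

Definition zz_cocone : cocone F := colim_cocone zz_hasB zz_edge_basis.

Lemma zz_is_colimit : is_colimit zz_cocone.
Proof. exact: colim_is_colimit. Qed.

Lemma zz_path_rigid (v w : free_category Q) (p : hom v w) : rigid (fmor F p).
Proof. exact: (rigid_qpath zz_hasB zz_rigid). Qed.

Lemma zz_nu_colimit : is_colimit (map_cocone nu zz_cocone).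
Proof.
apply: nu_colimit_at.
- exact: zz_strong.
- exact: zz_path_rigid.
- exact: colim_strong_steiner.
- exact: lg_rigid.
- exact: colim_surj.
- move=> n i j b b' Bb Bb' E.
  exact: (@qglued_glued Q X Xe n (mkqpt b) (mkqpt b')
    (proj1 (colim_glued zz_hasB zz_edge_basis Bb Bb') E)).
Qed.

(** A strong Steiner system constrains every colimiting cocone, while the construction yields one;
    the properties are carried along the canonical isomorphism. *)
Lemma zz_transport (c : cocone F) : is_colimit c ->
  strong_steiner (apex c) /\ forall v, rigid (leg c v : adcmor _ _).
Proof.
move=> hc; have [h [hE _]] := zz_is_colimit c.
have [k [kh hk]] := colimit_iso zz_is_colimit hc hE.
have phiK n (x : M n) : (k : adcmor _ _) n ((h : adcmor M _) n x) = x.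
  exact: (congr1 (fun m : adcmor M M => m n x) kh).
have psiK n (x : (apex c : adc) n) : (h : adcmor M _) n ((k : adcmor _ M) n x) = x.
  exact: (congr1 (fun m : adcmor (apex c) (apex c) => m n x) hk).
split; first exact: (iso_strong_steiner phiK psiK colim_strong_steiner).
move=> v; rewrite -(hE v); apply: rigid_cmp; last exact: lg_rigid.
exact: (iso_rigid phiK psiK colim_strong_steiner).
Qed.

End Zigzag.

Theorem mainTheorem9 (l : nat) (K : 'I_l.+1 -> adc) (L : 'I_l -> adc)
    (f : forall i : 'I_l, adcmor (L i) (K (widen_ord (leqnSn l) i)))
    (g : forall i : 'I_l, adcmor (L i) (K (lift ord0 i))) :
  (forall k : 'I_l.+1, strong_steiner (K k)) ->
  (forall i : 'I_l, strong_steiner (L i)) ->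
  (forall i : 'I_l, ordered_rigid_inclusion (f i)) ->
  (forall i : 'I_l, ordered_rigid_inclusion (g i)) ->
  let F := @zigzag Cda l K L f g in
  strong_steiner_system F /\
  (exists c : cocone F, is_colimit c) /\
  (forall c : cocone F, is_colimit c -> strong_steiner (apex c)) /\
  commutes_with_colimit nu F.
Proof.
move=> sK sL ordf ordg F.
have hF : exists c : cocone F, is_colimit c.
  by eexists; exact: (zz_is_colimit sK sL ordf ordg).
have hc (c : cocone F) : is_colimit c ->
  strong_steiner (apex c) /\ forall v, rigid (leg c v : adcmor _ _).
  exact: (zz_transport sK sL ordf ordg).
split; last split=> //; last split.
- split=> //.
  + exact: (zz_strong sK sL).
  + exact: (zz_path_rigid sK sL ordf ordg).
  + by move=> c /hc[].
  + by move=> c /hc[].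
- by move=> c /hc[].
- exact: commutes_with_colimit_of (zz_is_colimit sK sL ordf ordg) (zz_nu_colimit sK sL ordf ordg).
Qed.
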